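(* Assume that $\alpha\in(0,1)$ and $\beta\in(0,1-\alpha)$ are fixed, $\epsilon>0$, $\delta\in[0,1)$, $B\ge6\alpha^{-1}\log(2\beta^{-1})$, and $\lambda_j\le1$ for $j\in[d]$. Then the minimum separation of $\phi^u_{\mathrm{dpdHSIC}}$ with Gaussian kernels over $\mathcal P^s_{L_2}$ is upper bounded as $$\rho^2_{\phi^u_{\mathrm{dpdHSIC}},L_2}\le C\Big\{\sum_{j=1}^d\sum_{i=1}^{p_j}\lambda_{j,i}^{2s}+\frac1{n\sqrt{\lambda_0}}+\frac1{n\lambda_0\xi_{\epsilon,\delta}}\Big\},$$ where $C=C_{\alpha,\beta,s,R,M,p_1,\dots,p_d}$ is some positive constant depending only on $\alpha,\beta,s,R,M,p_1,\dots,p_d$.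
   Context: Superscripts $j\in[d]=\{1,\dots,d\}$ on $k,K,X,\pi$ are indices, not exponents; $d\ge2$. Kernels: for $x,x'\in\mathbb R^{p_j}$ and bandwidths $\lambda_{j,1},\dots,\lambda_{j,p_j}>0$ (possibly depending on $n$), $k^j(x,x')=\prod_{i=1}^{p_j}\frac1{\sqrt{2\pi}\lambda_{j,i}}\exp\{-(x_i-x_i')^2/(2\lambda_{j,i}^2)\}$. Put $\lambda_j=\prod_{i=1}^{p_j}\lambda_{j,i}$, $\lambda_0=\prod_{j=1}^d\lambda_j$, $p=\sum_{j=1}^dp_j$, $\xi_{\epsilon,\delta}=\epsilon+\log(1/(1-\delta))$. With $\mathbf i_q^n$ the set of $q$-tuples drawn without replacement from $[n]$, $n\ge2d$, and $\mathcal X_n=(\mathbf X_i)_{i\le n}$, $\mathbf X_i=(X_i^1,\dots,X_i^d)$, an i.i.d. sample from $P=P_{X^1,\dots,X^d}$ on $\mathbb R^{p_1}\times\dots\times\mathbb R^{p_d}$, $$U_{\mathrm{dHSIC}}(\mathcal X_n)=\frac{(n-2)!}{n!}\sum_{\mathbf i_2^n}\prod_{j=1}^dk^j(X_{i_1}^j,X_{i_2}^j)+\frac{(n-2d)!}{n!}\sum_{\mathbf i_{2d}^n}\prod_{j=1}^dk^j(X_{i_{2j-1}}^j,X_{i_{2j}}^j)-\frac{2(n-d-1)!}{n!}\sum_{\mathbf i_{d+1}^n}\prod_{j=1}^dk^j(X_{i_1}^j,X_{i_{j+1}}^j).$$ For a $d$-tuple $\boldsymbol\pi=(\pi^1,\dots,\pi^d)$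 of permutations of $[n]$, $\mathcal X_n^{\boldsymbol\pi}$ has $i$-th element $(X^1_{\pi^1(i)},\dots,X^d_{\pi^d(i)})$. Test $\phi^u_{\mathrm{dpdHSIC}}$: let $\Delta_T$ be the sensitivity $\sup_{\boldsymbol\pi}\sup|U_{\mathrm{dHSIC}}(\mathcal X_n^{\boldsymbol\pi})-U_{\mathrm{dHSIC}}(\tilde{\mathcal X}_n^{\boldsymbol\pi})|$ over all $\boldsymbol\pi$ and all datasets differing in at most one observation; $\boldsymbol\pi_0$ the identity, $\boldsymbol\pi_1,\dots,\boldsymbol\pi_B$ i.i.d. uniform $d$-tuples of permutations, $\zeta_0,\dots,\zeta_B$ i.i.d. standard Laplace (location $0$, scale $1$), all independent of each other and of the data; $M_i=U_{\mathrm{dHSIC}}(\mathcal X_n^{\boldsymbol\pi_i})+2\Delta_T\xi_{\epsilon,\delta}^{-1}\zeta_i$; $\hat p_{\mathrm{dp}}=\frac1{B+1}\{\sum_{i=1}^B\mathbb 1(M_i\ge M_0)+1\}$; $\phi^u_{\mathrm{dpdHSIC}}=\mathbb 1(\hat p_{\mathrm{dp}}\le\alpha)$. Alternatives: for $s,R>0$, $\mathcal S_p^s(R)=\{f\in L_1(\mathbb R^p)\cap L_2(\mathbb R^p):\int_{\mathbb R^p}\|w\|_2^{2s}|\hat f(w)|^2\,dw\le(2\pi)^pR^2\}$, with $\hat f(w)=\int f(x)e^{-ix^Tw}dx$. For $M,\rho>0$, $\mathcal P^s_{L_2}(\rho)$ is the set of distributions $P_{X^1,\dots,X^d}$ on $\mathbb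 R^{p_1}\times\dots\times\mathbb R^{p_d}$ with Lebesgue density $p_{X^1,\dots,X^d}$ and product of marginal densities $p_{X^1}\cdots p_{X^d}$ such that $\|p_{X^1,\dots,X^d}-p_{X^1}\cdots p_{X^d}\|_{L_2}\ge\rho$, $p_{X^1,\dots,X^d}-p_{X^1}\cdots p_{X^d}\in\mathcal S_p^s(R)$, and $\max(\|p_{X^1,\dots,X^d}\|_{L_\infty},\|p_{X^1}\cdots p_{X^d}\|_{L_\infty})\le M$; norms are with respect to Lebesgue measure on $\mathbb R^p$. The minimum separation is $$\rho_{\phi^u_{\mathrm{dpdHSIC}},L_2}=\inf\Big\{\rho>0:\sup_{P\in\mathcal P^s_{L_2}(\rho)}\mathbb E_P[1-\phi^u_{\mathrm{dpdHSIC}}]\le\beta\Big\}$$ (a supremum over an empty class is read as $0$). *)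

(* Defs.v *)
From HB Require Import structures.
From mathcomp Require Import all_boot all_order all_algebra all_fingroup.
From mathcomp Require Import complex.
From mathcomp Require Import all_classical all_reals all_analysis.
From mathcomp Require Import measurable_realfun.

Set Implicit Arguments.
Unset Strict Implicit.
Unset Printing Implicit Defensive.

Import Order.TTheory GRing.Theory Num.Theory.
Import numFieldNormedType.Exports.

Local Open Scope classical_set_scope.
Local Open Scope ring_scope.

(** * Finite powers of a sigma-finite measure *)

Section power_measure_step.
Context d (T : measurableType d) (R : realType) (n : nat).
Variable mu : {sigma_finite_measure set T -> \bar R}.
Variable nu : {sigma_finite_measure set (n.-tuple T) -> \bar R}.

Definition tcons (x : T * n.-tuple T) : n.+1.-tuple T :=
  [the n.+1.-tuple T of x.1 :: x.2].

Lemma measurable_tcons : measurable_fun [set: T * n.-tuple T] tcons.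
Proof.
by apply: (@measurable_cons _ _ _ _ fst _ snd);
  [exact: measurable_fst|exact: measurable_snd].
Qed.

Definition power_measure_step : set (n.+1.-tuple T) -> \bar R :=
  pushforward (mu \x nu)%E tcons.

Let step0 : power_measure_step set0 = 0%E.
Proof. by rewrite /power_measure_step /pushforward preimage_set0 measure0. Qed.

Let step_ge0 A : (0 <= power_measure_step A)%E.
Proof. by rewrite /power_measure_step /pushforward; apply: measure_ge0. Qed.

Let step_sigma_additive : semi_sigma_additive power_measure_step.
Proof.
move=> F mF tF mUF; rewrite /power_measure_step /pushforward preimage_bigcup.
apply: measure_semi_sigma_additive.
- by move=> k; rewrite -[X in measurable X]setTI; exact: measurable_tcons.
- apply/trivIsetP => /= i j _ _ ij; rewrite -preimage_setI.
  by move/trivIsetP : tF => /(_ _ _ _ _ ij) ->//; rewrite preimage_set0.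
- by rewrite -preimage_bigcup -[X in measurable X]setTI; exact: measurable_tcons.
Qed.

HB.instance Definition _ := isMeasure.Build _ _ _ power_measure_step
  step0 step_ge0 step_sigma_additive.

Let step_sigma_finite : sigma_finite setT power_measure_step.
Proof.
have /sigma_finiteP[F [TF ndF Foo]] := sigma_finiteT mu.
have /sigma_finiteP[G [TG ndG Goo]] := sigma_finiteT nu.
pose g (y : n.+1.-tuple T) : T * n.-tuple T := (thead y, [tuple of behead y]).
have mg : measurable_fun setT g.
  apply/measurable_fun_pairP; split.
    exact: (measurable_tnth ord0).
  exact: measurable_behead.
have gK x : g (tcons x) = x.
  by case: x => x y; congr (_, _); exact/val_inj.
exists (fun k => g @^-1` (F k `*` G k)).
  apply/esym/seteqP; split => // y _.
  have [i _ Fi] : (\bigcup_i F i) (g y).1 by rewrite -TF.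
  have [j _ Gj] : (\bigcup_i G i) (g y).2 by rewrite -TG.
  exists (maxn i j) => //; split.
    by move: (_.1) Fi; exact/subsetPset/ndF/leq_maxl.
  by move: (_.2) Gj; exact/subsetPset/ndG/leq_maxr.
move=> k; have [mFk Fkoo] := Foo k; have [mGk Gkoo] := Goo k; split.
  by rewrite -[X in measurable X]setTI; apply: mg => //; exact: measurableX.
rewrite /power_measure_step /pushforward (_ : _ @^-1` _ = F k `*` G k).
  by rewrite product_measure1E// lte_mul_pinfty// ge0_fin_numE.
by rewrite -comp_preimage (_ : g \o tcons = id)//; apply/funext => x; exact: gK.
Qed.

HB.instance Definition _ := Measure_isSigmaFinite.Build _ _ _
  power_measure_step step_sigma_finite.

End power_measure_step.

Fixpoint power_measure d (T : measurableType d) (R : realType)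
    (mu : {sigma_finite_measure set T -> \bar R}) (n : nat) :
    {sigma_finite_measure set (n.-tuple T) -> \bar R} :=
  match n with
  | 0 => \d_([tuple] : 0.-tuple T)
  | m.+1 => power_measure_step mu (power_measure mu m)
  end.

(** * The standard Laplace distribution *)

Section laplace.
Context {R : realType}.

Definition laplace_pdf (x : R) : R := expR (- `|x|) / 2.

Definition laplace_prob (A : set (measurableTypeR R)) : \bar R :=
  (\int[lebesgue_measure]_(x in A) (laplace_pdf x)%:E)%E.

Lemma laplace_pdf_ge0 (x : R) : 0 <= laplace_pdf x.
Proof. by rewrite divr_ge0// expR_ge0. Qed.

Lemma continuous_laplace_pdf : continuous (laplace_pdf : R -> R).
Proof.
move=> x; apply: (@continuousM _ R^o (fun x : R^o => expR (- `|x|)) (fun=> 2^-1));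
  last exact: cst_continuous.
apply: continuous_comp; last exact: continuous_expR.
by apply: (@continuousN _ R^o); exact: norm_continuous.
Qed.

Lemma measurable_laplace_pdf : measurable_fun [set: R] laplace_pdf.
Proof. by apply: continuous_measurable_fun; exact: continuous_laplace_pdf. Qed.

Let laplace0 : laplace_prob set0 = 0%E.
Proof. by rewrite /laplace_prob integral_set0. Qed.

Let laplace_ge0 A : (0 <= laplace_prob A)%E.
Proof. by apply: integral_ge0 => x _; rewrite lee_fin laplace_pdf_ge0. Qed.

Let laplace_sigma_additive : semi_sigma_additive laplace_prob.
Proof.
move=> /= F mF tF mUF; rewrite /laplace_prob; apply: cvg_toP.
  apply: ereal_nondecreasing_is_cvgn => m n mn.
  apply: lee_sum_nneg_natr => // k _ _; apply: integral_ge0 => /= x Fkx.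
  by rewrite lee_fin laplace_pdf_ge0.
rewrite ge0_integral_bigcup//=.
- apply/measurable_EFinP/(measurable_funS measurableT) => //.
  exact: measurable_laplace_pdf.
- by move=> x _; rewrite lee_fin laplace_pdf_ge0.
Qed.

HB.instance Definition _ := isMeasure.Build _ _ _
  laplace_prob laplace0 laplace_ge0 laplace_sigma_additive.

Let laplace_setT : laplace_prob [set: _] = 1%E.
Proof.
rewrite /laplace_prob ge0_symfun_integralT; first last.
- by move=> x; rewrite /laplace_pdf /= normrN.
- exact: continuous_laplace_pdf.
- exact: laplace_pdf_ge0.
have -> : [set x : R | 0 <= x] = `[(0:R), +oo[%classic.
  by apply/seteqP; split => x /=; rewrite in_itv/= andbT.
have := @integral_exponential_pdf R 1 ltr01.
rewrite -(setUv `[0, +oo[%classic) ge0_integral_setU//=; last 4 first.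
- exact: measurableC.
- by rewrite setUv; apply/measurable_EFinP; exact: measurable_exponential_pdf.
- by move=> x _; rewrite lee_fin exponential_pdf_ge0.
- exact/disj_setPCl.
rewrite [X in (_ + X)%E]integral0_eq ?adde0; last first.
  by move=> x x0; rewrite /exponential_pdf patchE ifF// memNset.
move=> <-; rewrite -ge0_integralZl//=.
- apply: eq_integral => x; rewrite inE/= in_itv/= andbT => x0.
  rewrite exponential_pdfE// /laplace_pdf ger0_norm// mulN1r mul1r -EFinM.
  by rewrite mulrCA mulfV// mulr1.
- apply/measurable_EFinP/(measurable_funS measurableT) => //.
  exact: measurable_laplace_pdf.
- by move=> x _; rewrite lee_fin laplace_pdf_ge0.
Qed.

HB.instance Definition _ :=
  @Measure_isProbability.Build _ _ R laplace_prob laplace_setT.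

End laplace.

(** * Euclidean spaces, Lebesgue measure, Fourier transform *)

(* [R^m]; the carrier of [measurableTypeR R] is [R] with its Borel sets. *)
Notation euclid R m := (m.-tuple (measurableTypeR R)).

Definition lebesgue_euclid (R : realType) (m : nat) :
    {sigma_finite_measure set (euclid R m) -> \bar R} :=
  power_measure (@lebesgue_measure R) m.

Definition dotp (R : realType) m (x w : euclid R m) : R :=
  \sum_(i < m) tnth x i * tnth w i.

Definition norm2 (R : realType) m (w : euclid R m) : R := Num.sqrt (dotp w w).

(* [\int f(x) e^{-i x^T w} dx], integrated componentwise, with
   [e^{-i t} = cos t - i sin t]. *)
Definition fourier (R : realType) m (f : euclid R m -> R) (w : euclid R m) :
    R[i] :=
  Complex (\int[lebesgue_euclid R m]_x (f x * cos (dotp x w)))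
          (- \int[lebesgue_euclid R m]_x (f x * sin (dotp x w))).

Definition sobolev_ball (R : realType) m (s rad : R) :
    set (euclid R m -> R) :=
  [set f | [/\ f \in Lfun (lebesgue_euclid R m) 1,
               f \in Lfun (lebesgue_euclid R m) 2%:E &
     (\int[lebesgue_euclid R m]_w
        (norm2 w `^ (2 * s) * Normc.normc (fourier f w) ^+ 2)%:E
      <= ((2 * pi) ^+ m * rad ^+ 2)%:E)%E]].

(* [f] is a version of the Lebesgue density of the set function [nu]. *)
Definition is_density (R : realType) m (nu : set (euclid R m) -> \bar R)
    (f : euclid R m -> R) : Prop :=
  [/\ measurable_fun [set: euclid R m] f, (forall x, 0 <= f x) &
      forall A, measurable A ->
        nu A = (\int[lebesgue_euclid R m]_(x in A) (f x)%:E)%E].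

(** * Multivariate observations *)

(* A point of [R^{p_1} x ... x R^{p_d}] is stored as a point of [R^p] with
   [p = p_1 + ... + p_d], through the enumeration [tagnat] of the pairs
   [(j, i)] with [i < p j]. *)
Notation obs R p := (euclid R (\sum_j p j)%N).

Definition block (R : realType) d (p : 'I_d -> nat) (j : 'I_d)
    (x : obs R p) : euclid R (p j) :=
  [tuple tnth x (tagnat.Rank j i) | i < p j].

Definition gauss_kernel (R : realType) m (lam : 'I_m -> R)
    (x y : euclid R m) : R :=
  \prod_(i < m) ((Num.sqrt (2 * pi) * lam i)^-1 *
    expR (- (tnth x i - tnth y i) ^+ 2 / (2 * lam i ^+ 2))).

(* [blockk lam j x y] is [k^j(x^j, y^j)]. *)
Definition blockk (R : realType) d (p : 'I_d -> nat)
    (lam : forall j, 'I_(p j) -> R) (j : 'I_d) (x y : obs R p) : R :=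
  gauss_kernel (lam j) (block j x) (block j y).

(* 0-based positions of [i_{2j-1}] and [i_{2j}] in [(i_1, ..., i_{2d})]. *)
Lemma pos_odd_subproof d (j : 'I_d) : (j.*2 < 2 * d)%N.
Proof. by rewrite mul2n ltn_double. Qed.

Lemma pos_even_subproof d (j : 'I_d) : (j.*2.+1 < 2 * d)%N.
Proof. by rewrite mul2n ltn_Sdouble. Qed.

Definition pos_odd d (j : 'I_d) : 'I_(2 * d) := Ordinal (pos_odd_subproof j).
Definition pos_even d (j : 'I_d) : 'I_(2 * d) := Ordinal (pos_even_subproof j).

(** * The statistic, the test and its minimum separation *)

(* [q]-tuples drawn without replacement are the duplicate-free [q]-tuples. *)
Definition U_dHSIC (R : realType) d (p : 'I_d -> nat)
    (lam : forall j, 'I_(p j) -> R) n (X : n.-tuple (obs R p)) : R :=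
  (n - 2)`!%:R / n`!%:R *
    (\sum_(i : 2.-tuple 'I_n | uniq i) \prod_(j < d)
       blockk lam j (tnth X (tnth i ord0)) (tnth X (tnth i ord_max)))
  + (n - 2 * d)`!%:R / n`!%:R *
    (\sum_(i : (2 * d).-tuple 'I_n | uniq i) \prod_(j < d)
       blockk lam j (tnth X (tnth i (pos_odd j)))
                    (tnth X (tnth i (pos_even j))))
  - (2 * (n - d - 1)`!%:R) / n`!%:R *
    (\sum_(i : d.+1.-tuple 'I_n | uniq i) \prod_(j < d)
       blockk lam j (tnth X (tnth i ord0)) (tnth X (tnth i (lift ord0 j)))).

(* Coordinate [k] of an observation belongs to the block [tagnat.sig1 k]. *)
Definition permute_data (R : realType) d (p : 'I_d -> nat) n
    (pi : {ffun 'I_d -> 'S_n}) (X : n.-tuple (obs R p)) : n.-tuple (obs R p) :=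
  [tuple [tuple tnth (tnth X (pi (tagnat.sig1 k) i)) k | k < _] | i < n].

Definition hamming (T : eqType) n (X Y : n.-tuple T) : nat :=
  #|[pred i | tnth X i != tnth Y i]|.

(* The kernels are bounded, so this [sup] is over a bounded set. *)
Definition sensitivity (R : realType) d (p : 'I_d -> nat)
    (lam : forall j, 'I_(p j) -> R) (n : nat) : R :=
  sup [set r | exists pi : {ffun 'I_d -> 'S_n},
               exists X Y : n.-tuple (obs R p), (hamming X Y <= 1)%N /\
       r = `|U_dHSIC lam (permute_data pi X) - U_dHSIC lam (permute_data pi Y)|].

Definition xi (R : realType) (eps delta : R) : R :=
  eps + ln (1 / (1 - delta)).

Definition noisy_stat (R : realType) d (p : 'I_d -> nat)
    (lam : forall j, 'I_(p j) -> R) n (eps delta : R)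
    (X : n.-tuple (obs R p)) (pi : {ffun 'I_d -> 'S_n}) (zeta : R) : R :=
  U_dHSIC lam (permute_data pi X)
  + 2 * sensitivity lam n * (xi eps delta)^-1 * zeta.

(* [pis] lists [pi_1, ..., pi_B] and [zeta] lists [zeta_0, ..., zeta_B]. *)
Definition dp_pvalue (R : realType) d (p : 'I_d -> nat)
    (lam : forall j, 'I_(p j) -> R) n B (eps delta : R)
    (X : n.-tuple (obs R p)) (pis : {ffun 'I_B -> {ffun 'I_d -> 'S_n}})
    (zeta : euclid R B.+1) : R :=
  let M0 := noisy_stat lam eps delta X [ffun=> 1%g] (tnth zeta ord0) in
  (B.+1%:R)^-1 *
    (\sum_(i < B)
       (M0 <= noisy_stat lam eps delta X (pis i) (tnth zeta (lift ord0 i)))%R%:R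
     + 1).

Definition dpdHSIC_test (R : realType) d (p : 'I_d -> nat)
    (lam : forall j, 'I_(p j) -> R) n B (alpha eps delta : R)
    (X : n.-tuple (obs R p)) (pis : {ffun 'I_B -> {ffun 'I_d -> 'S_n}})
    (zeta : euclid R B.+1) : R :=
  (dp_pvalue lam eps delta X pis zeta <= alpha)%R%:R.

(* [E_P[1 - phi]]: by independence the data and the noise have the product law
   [P^n (x) Laplace^(B+1)], and the permutations are averaged uniformly. *)
Definition type2_error (R : realType) d (p : 'I_d -> nat)
    (lam : forall j, 'I_(p j) -> R) (n B : nat) (alpha eps delta : R)
    (P : probability (obs R p) R) : \bar R :=
  (\int[power_measure P n \x power_measure (@laplace_prob R) B.+1]_w
     ((#|{: {ffun 'I_B -> {ffun 'I_d -> 'S_n}}}|%:R)^-1 *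
      \sum_(pis : {ffun 'I_B -> {ffun 'I_d -> 'S_n}})
         (1 - dpdHSIC_test lam alpha eps delta w.1 pis w.2))%:E)%E.

(* The densities are determined up to null sets, on which none of the
   conditions depends. *)
Definition alternatives (R : realType) d (p : 'I_d -> nat) (s rad M rho : R) :
    set (probability (obs R p) R) :=
  [set P | exists (f : obs R p -> R) (fj : forall j, euclid R (p j) -> R),
     let prodf x := \prod_(j < d) fj j (block j x) in
     let L := lebesgue_euclid R (\sum_j p j) in
     [/\ is_density P f /\
         (forall j, is_density (pushforward P (@block R d p j)) (fj j)),
         (rho%:E <= 'N[L]_2%:E[EFin \o (f \- prodf)%R])%E,
         sobolev_ball s rad (f \- prodf) &
         (maxe 'N[L]_+oo[EFin \o f] 'N[L]_+oo[EFin \o prodf] <= M%:E)%E]].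

(* Over an empty class the supremum is [-oo] here; as [0 <= beta] this selects
   the same [rho] as the value [0]. *)
Definition min_separation (R : realType) d (p : 'I_d -> nat)
    (lam : forall j, 'I_(p j) -> R) (n B : nat)
    (alpha beta eps delta s rad M : R) : \bar R :=
  ereal_inf [set rho%:E | rho in [set rho : R | 0 < rho /\
    (ereal_sup [set type2_error lam n B alpha eps delta P
               | P in @alternatives R d p s rad M rho] <= beta%:E)%E]].

(* Main.v *)
Require Import Defs.
From HB Require Import structures.
From mathcomp Require Import all_boot all_order all_algebra all_fingroup.
From mathcomp Require Import complex.
From mathcomp Require Import all_classical all_reals all_analysis.
From mathcomp Require Import measurable_realfun ess_sup_inf.
From mathcomp Require Import ring lra.

Set Implicit Arguments.
Unset Strict Implicit.
Unset Printing Implicit Defensive.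

Import Order.TTheory GRing.Theory Num.Theory.
Import numFieldNormedType.Exports.

(** The test accepts only if a fixed fraction of the noisy permuted statistics reach the noisy
    observed statistic, so by Markov the type II error is at most a constant times the probability
    that one of them does ([type2_error_le]).  The observed statistic has as mean the energy [H] of
    the kernel for the difference [psi] of the joint density and of the product of the marginal
    densities.  Such an exceedance requires that the observed statistic lies far below [H], that the
    permuted statistic is of the order of [H], or that a noise is; each of these is unlikely once
    [H] exceeds a constant times [1 / (n sqrt lam0) + 1 / (n lam0 xi)].

    Observed statistic.  The three sums of the statistic are averages over all permutations of the
    sample of one kernel of [2 d] observations ([U_dHSIC_ustat]).  Its variance is an average of
    correlations between two windows of [2 d] indices: disjoint windows contribute nothing, windows
    with a single common index contribute [1 / n] times the second moment of the first projection,
    all others a multiple of [1 / (n^2 lam0)] ([overlap_average], [ustat_variance]).  The projection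
    is made of the smoothed difference, whose second moment is at most [M] times the energy for the
    doubled variances and hence at most [M H] ([expect_witness_sqr_le]).

    Permuted statistic.  Permuting the blocks independently makes the statistic degenerate for fixed
    data, so that the terms of order [1 / n] cancel and its second moment is of order [n^-2] times a
    product of one squared kernel moment for each block ([perm_moment]).  Up to a constant factor
    these moments are their expectations, with large probability; the product of the expectations is
    the second moment of the full kernel under the product of the marginals ([prod_edge_mean]) and
    hence at most [M / lam0].

    Noise.  One observation enters a fraction [O (1 / n)] of the permutations, and the kernel is
    bounded by a multiple of [1 / lam0], so the sensitivity is at most [16 d^2 / (n lam0)]
    ([sensitivity_le]).

    Separation.  It remains to bound [H] from below by the distance [rho].  The energy is the
    integral of the squared Fourier transform of [psi] against a Gaussian
    ([quadratic_form_spectrum]).  A frequency which this Gaussian dampens by more than a constant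
    has a large smoothness weight ([frequency_split]), so the energy for arbitrarily small
    bandwidths is at most [exp (1 / 2) H] plus [rad^2] times the sum of the [lam^(2 s)]
    ([hsic_smooth]).  As Gaussian kernels form an approximate identity, the energies for small
    bandwidths approach the squared [L2] norm of [psi] ([sqr_distance_le_hsic]), which is at least
    [rho^2]. *)

Local Open Scope ring_scope.

(** * Averages over the symmetric group *)

Section perm_average.
Variables (R : realFieldType) (n : nat).

Definition pavg (g : 'S_n -> R) : R := n`!%:R^-1 * \sum_(s : 'S_n) g s.

(** Built along the list, one transposition at a time. *)
Lemma perm_ext (v t : seq 'I_n) : uniq v -> uniq t -> size v = size t ->
  exists tau : 'S_n, map tau v = t.
Proof.
elim: v t => [|a v ih] [|b t]//= ; first by exists 1%g.
move=> /andP[av uv] /andP[bt ut] [svt].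
have [tau tauE] := ih _ uv ut svt; exists (tau * tperm (tau a) b)%g.
rewrite permM tpermL; congr (_ :: _); rewrite -[RHS]tauE; apply/eq_in_map => i iv.
rewrite permM tpermD//.
  by apply: contraNneq av => /perm_inj ->.
by apply: contraNneq bt => ->; rewrite -tauE map_f.
Qed.

Lemma nfact_neq0 : n`!%:R != 0 :> R.
Proof. by rewrite pnatr_eq0 -lt0n fact_gt0. Qed.

Lemma pavg_cst (c : R) : pavg (fun=> c) = c.
Proof.
by rewrite /pavg sumr_const card_Sn -(mulr_natr c) mulrCA mulVf ?mulr1// nfact_neq0.
Qed.

Lemma sum_bool_card (T : finType) (P : pred T) :
  \sum_(x : T) (P x)%:R = #|[set x | P x]|%:R :> R.
Proof.
rewrite -natr_sum -sum1dep_card [in RHS]big_mkcond/=; by congr _%:R.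
Qed.

Lemma eq_pavg f g : f =1 g -> pavg f = pavg g.
Proof. by move=> fg; congr (_ * _); apply: eq_bigr. Qed.

Lemma le_pavg f g : (forall s, f s <= g s) -> pavg f <= pavg g.
Proof. by move=> fg; rewrite ler_wpM2l ?invr_ge0//; apply: ler_sum. Qed.

Lemma pavg_ge0 f : (forall s, 0 <= f s) -> 0 <= pavg f.
Proof. by move=> f0; rewrite mulr_ge0 ?invr_ge0//; apply: sumr_ge0. Qed.

Lemma pavgD f g : pavg (fun s => f s + g s) = pavg f + pavg g.
Proof. by rewrite /pavg big_split mulrDr. Qed.

Lemma pavgB f g : pavg (fun s => f s - g s) = pavg f - pavg g.
Proof. by rewrite /pavg sumrB mulrBr. Qed.

Lemma pavgZl c f : pavg (fun s => c * f s) = c * pavg f.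
Proof. by rewrite /pavg -mulr_sumr mulrCA. Qed.

Lemma pavgZr c f : pavg (fun s => f s * c) = pavg f * c.
Proof. by rewrite /pavg -mulr_suml mulrA. Qed.

Lemma pavg_sum I (r : seq I) (P : pred I) (F : I -> 'S_n -> R) :
  pavg (fun s => \sum_(i <- r | P i) F i s) = \sum_(i <- r | P i) pavg (F i).
Proof. by rewrite /pavg exchange_big mulr_sumr. Qed.

Lemma pavg_norm f : `|pavg f| <= pavg (fun s => `|f s|).
Proof.
rewrite /pavg normrM ger0_norm ?invr_ge0//.
by rewrite ler_wpM2l ?invr_ge0//; apply: ler_norm_sum.
Qed.

Lemma pavg_mull (t : 'S_n) f : pavg (fun s => f (t * s)%g) = pavg f.
Proof. by rewrite /pavg [in RHS](reindex_inj (mulgI t)). Qed.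

Lemma pavg_mulr (t : 'S_n) f : pavg (fun s => f (s * t)%g) = pavg f.
Proof. by rewrite /pavg [in RHS](reindex_inj (mulIg t)). Qed.

(** Left translation by a permutation that carries one list to the other shows that a
    uniform permutation does not see which distinct points it is evaluated at. *)
Lemma pavg_map (F : seq 'I_n -> R) (v v' : seq 'I_n) :
  uniq v -> uniq v' -> size v = size v' ->
  pavg (fun s => F (map s v)) = pavg (fun s => F (map s v')).
Proof.
move=> uv uv' svv'; have [tau <-] := perm_ext uv uv' svv'.
rewrite -[LHS](pavg_mull tau); apply: eq_pavg => s; congr F.
by rewrite -map_comp; apply: eq_map => i /=; rewrite permM.
Qed.

(** Right translation shows that each of the [n ^_ q] lists of [q] distinct values is
    attained equally often, so the count is [n!] divided by [n ^_ q]. *)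
Lemma card_perm_map (v t : seq 'I_n) : uniq v -> uniq t -> size v = size t ->
  #|[set s : 'S_n | map s v == t]| = (n - size v)`!.
Proof.
move=> uv ut svt.
have svn : (size v <= n)%N by rewrite -(card_uniqP uv) -[leqRHS]card_ord max_card.
pose q := size v.
pose c (x : q.-tuple 'I_n) := #|[set s : 'S_n | map s v == x]|.
have cE (x : q.-tuple 'I_n) : uniq x -> c x = #|[set s : 'S_n | map s v == t]|.
  move=> ux; have [tau tauE] : exists tau : 'S_n, map tau x = t.
    by apply: perm_ext => //; rewrite size_tuple.
  rewrite /c -(card_imset _ (mulIg tau)); apply: eq_card => s; rewrite inE.
  apply/imsetP/eqP => [[s' ]|sv].
    rewrite inE => /eqP s'v ->; rewrite -tauE -s'v -map_comp.
    by apply: eq_map => i /=; rewrite permM.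
  exists (s * tau^-1)%g; last by rewrite mulgKV.
  rewrite inE; apply/eqP; apply: (inj_map (@perm_inj _ tau)).
  rewrite tauE -sv -map_comp; apply: eq_map => i /=.
  by rewrite permM permKV.
have := card_uniq_tuples q (@predT 'I_n); rewrite (_ : #|@predT 'I_n| = n) ?card_ord//.
pose D := [set x : q.-tuple 'I_n | all (@predT 'I_n) x & uniq x].
rewrite -/D => cardD.
have tot : (\sum_(x in D) c x = n`!)%N.
  rewrite -[in RHS](card_Sn n) -sum1_card.
  rewrite [RHS](partition_big (fun s : 'S_n => [tuple of map s (in_tuple v)]) (mem D)) /=.
    apply: eq_bigr => x xD; rewrite sum1_card; apply: eq_card => s.
    by rewrite inE.
  move=> s _; rewrite inE /=; apply/andP; split; first exact/allP.
  by rewrite map_inj_uniq//; exact: perm_inj.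
move: tot; rewrite (eq_bigr (fun=> #|[set s : 'S_n | map s v == t]|)); last first.
  by move=> x; rewrite inE => /andP[_ ux]; exact: cE.
rewrite sum_nat_const cardD -(ffact_fact svn) => /eqP.
by rewrite eqn_pmul2l ?ffact_gt0// => /eqP.
Qed.

(** The images of [q] fixed points under a uniform permutation are a sample drawn without
    replacement; this turns the normalized sums of the statistic into averages over
    permutations. *)
Lemma pavg_uniq q (w : 'I_q -> 'I_n) (g : q.-tuple 'I_n -> R) : injective w ->
  pavg (fun s => g [tuple s (w i) | i < q]) =
  (n - q)`!%:R / n`!%:R * \sum_(x : q.-tuple 'I_n | uniq x) g x.
Proof.
move=> wI; rewrite [RHS]mulrAC /pavg mulrC; congr (_ / _); rewrite mulrC.
pose v : seq 'I_n := map w (enum 'I_q).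
have uv : uniq v by rewrite map_inj_uniq// enum_uniq.
have sv : size v = q by rewrite size_map size_enum_ord.
rewrite (partition_big (fun s : 'S_n => [tuple s (w i) | i < q])
  (fun x : q.-tuple 'I_n => uniq x)) /=; last first.
  move=> s _; rewrite map_inj_uniq ?enum_uniq//.
  by move=> i j /perm_inj /wI.
rewrite mulr_suml; apply: eq_bigr => x ux.
rewrite (eq_bigr (fun=> g x)); last by move=> s /eqP ->.
rewrite sumr_const -[in LHS]mulr_natr; congr (_ * _%:R).
rewrite -[in RHS]sv -(@card_perm_map v x)//; last by rewrite sv size_tuple.
apply: eq_card => s; rewrite inE unfold_in /v -map_comp.
by [].
Qed.

Lemma pavg_eq (a b : 'I_n) : pavg (fun s => (s a == b)%:R) = n%:R^-1.
Proof.
rewrite /pavg sum_bool_card.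
have -> : #|[set s : 'S_n | s a == b]| = n.-1`!.
  rewrite -subn1 -(@card_perm_map [:: a] [:: b])//.
  by apply: eq_card => s; rewrite !inE /= eqseq_cons eqxx andbT.
have n0 : (0 < n)%N by case: (n) a => [[]|].
have f0 : (n.-1)`!%:R != 0 :> R by rewrite pnatr_eq0 -lt0n fact_gt0.
by rewrite -[in n`!](prednK n0) factS natrM prednK// invfM mulrAC -mulrA mulfV ?mulr1.
Qed.

Lemma pavg_eq2 (a b a' b' : 'I_n) : a != a' -> b != b' ->
  pavg (fun s => ((s a == b) && (s a' == b'))%:R) = (n%:R * n.-1%:R)^-1.
Proof.
move=> aa bb; rewrite /pavg sum_bool_card.
have -> : #|[set s : 'S_n | (s a == b) && (s a' == b')]| = n.-2`!.
  rewrite -subn2 -(@card_perm_map [:: a; a'] [:: b; b'])//= ?inE ?andbT//.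
  by apply: eq_card => s; rewrite !inE /= !eqseq_cons eqxx andbT.
have n1 : (1 < n)%N.
  case: (n) a a' aa {b b' bb} => [|[|//]]; first by case.
  by move=> a a'; rewrite !ord1 eqxx.
have -> : n`! = (n * (n.-1 * n.-2`!))%N.
  by case: (n) n1 => [|[|m]].
have f0 : (n.-2)`!%:R != 0 :> R by rewrite pnatr_eq0 -lt0n fact_gt0.
by rewrite !natrM !invfM -!mulrA mulVf ?mulr1.
Qed.

End perm_average.

(** * Overlap of two windows of indices *)

Section overlap.
Variables (R : realFieldType) (n N : nat) (w : 'I_N -> 'I_n).
Hypotheses (wI : injective w) (n1 : (1 < n)%N).

(** [Rf s] stands for the correlation of a function of the window [w] with the same
    function of the window [s \o w].  Disjoint windows are uncorrelated; an overlap at the single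
    pair [v], [v'] gives [r v v'] and happens with probability about [1 / n]; two overlaps happen
    with probability of order [n ^ -2] and are paid for by the uniform bound [K]. *)
Lemma overlap_average (Rf : 'S_n -> R) (r : 'I_N -> 'I_N -> R) (K : R) :
  (forall s : 'S_n, (forall v v', s (w v') != w v) -> Rf s = 0) ->
  (forall (s : 'S_n) v v', s (w v') = w v ->
     (forall u u', s (w u') = w u -> u = v /\ u' = v') -> Rf s = r v v') ->
  (forall s, `|Rf s| <= K) -> (forall v v', `|r v v'| <= K) ->
  pavg Rf <= n%:R^-1 * (\sum_v \sum_v' r v v')
           + (1 + N ^ 2)%:R * (N ^ 4)%:R * K * 2 / n%:R ^+ 2.
Proof.
move=> H0 H1 HK Hr.
have [N0|N0] := eqVneq N 0%N.
  have Rf0 s : Rf s = 0.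
    by apply: H0 => v; exfalso; case: v => m; rewrite N0.
  have N4 : (N ^ 4)%:R = 0 :> R by rewrite N0.
  rewrite (eq_pavg (g := fun=> 0))// pavg_cst N4 mulr0 !mul0r.
  rewrite big1 ?mulr0 ?addr0//.
  by case => m m0; exfalso; rewrite N0 in m0.
have K0 : 0 <= K by apply: le_trans (HK 1%g).
pose i (s : 'S_n) v v' : R := (s (w v') == w v)%:R.
(* [i] counts the overlaps of the two windows and [i2] the pairs of distinct overlaps. *)
pose i2 (s : 'S_n) v v' u u' : R :=
  (v != u)%:R * ((v' != u')%:R * ((s (w v') == w v) && (s (w u') == w u))%:R).
have i2_ge0 s v v' u u' : 0 <= i2 s v v' u u' by rewrite !mulr_ge0.
pose c : R := (1 + N ^ 2)%:R * K.
have c0 : 0 <= c by rewrite mulr_ge0.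
have pw s : Rf s <= (\sum_v \sum_v' i s v v' * r v v') +
    c * (\sum_v \sum_v' \sum_u \sum_u' i2 s v v' u u').
  have [/existsP[v /existsP[v' /eqP svv']]|] :=
    boolP [exists v, exists v', s (w v') == w v]; last first.
    move=> no; have {}no v v' : s (w v') != w v.
      by apply: contraNN no => ?; apply/existsP; exists v; apply/existsP; exists v'.
    rewrite H0//; apply: addr_ge0.
      rewrite big1// => v _; rewrite big1// => v' _.
      by rewrite /i (negbTE (no _ _)) mul0r.
    by rewrite mulr_ge0//; do 4 (apply: sumr_ge0 => ? _).
  have [/existsP[u /existsP[u' /andP[/eqP suu' neq]]]|] :=
    boolP [exists u, exists u', (s (w u') == w u) && ((u != v) || (u' != v'))].
    have uv : u != v.
      apply/negP => /eqP uv; move: neq; rewrite uv eqxx /= => /negP; apply.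
      by apply/eqP/wI/(@perm_inj _ s); rewrite svv' suu' uv.
    have uv' : u' != v'.
      by apply: contraNneq uv => uv'; apply/eqP/wI; rewrite -svv' -suu' uv'.
    have one : 1 <= \sum_v \sum_v' \sum_u \sum_u' i2 s v v' u u'.
      rewrite (bigD1 v)//= (bigD1 v')//= (bigD1 u)//= (bigD1 u')//=.
      rewrite {1}/i2 svv' suu' !eqxx eq_sym uv eq_sym uv' !mul1r -!addrA lerDl.
      by rewrite !addr_ge0//; do ?(apply: sumr_ge0 => ? _).
    apply: (@le_trans _ _ K); first exact: le_trans (ler_norm _) (HK s).
    have s1 : - ((N ^ 2)%:R * K) <= \sum_v \sum_v' i s v v' * r v v'.
      apply: (@le_trans _ _ (\sum_(v < N) \sum_(v' < N) - K)).
        by rewrite !sumr_const card_ord -!mulrnA mulr_natl mulNrn expnS expn1.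
      apply: ler_sum => x _; apply: ler_sum => y _.
      have := Hr x y; rewrite ler_norml => /andP[? ?]; rewrite /i.
      by case: (_ == _); rewrite ?mul1r ?mul0r//; lra.
    have := ler_wpM2l c0 one; rewrite mulr1 {1}/c natrD mulrDl mul1r.
    by move: ((N ^ 2)%:R * K) s1 => z; lra.
  move=> no; rewrite (H1 s v v')//; last first.
    move=> u u' suu'; have /negP := no.
    have [e|uv] := eqVneq u v.
      subst u; have [->//|uv'] := eqVneq u' v'.
      by case; apply/existsP; exists v; apply/existsP; exists u'; rewrite suu' uv' orbT eqxx.
    by case; apply/existsP; exists u; apply/existsP; exists u'; rewrite suu' uv eqxx.
  rewrite (bigD1 v)//= (bigD1 v')//= {1}/i svv' eqxx mul1r.
  rewrite [X in r v v' + X + _]big1 ?addr0; last first.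
    move=> u' uv'; rewrite /i (_ : (_ == _) = false) ?mul0r//.
    apply/negbTE; apply: contraNneq uv' => e.
    by apply/eqP/wI/(@perm_inj _ s); rewrite e svv'.
  rewrite [X in r v v' + X + _]big1 ?addr0; last first.
    move=> u uv; rewrite big1// => u' _; rewrite /i (_ : (_ == _) = false) ?mul0r//.
    apply/negbTE; apply: contraNN no => e.
    by apply/existsP; exists u; apply/existsP; exists u'; rewrite e uv.
  by rewrite lerDl mulr_ge0//; do 4 (apply: sumr_ge0 => ? _).
apply: le_trans (le_pavg pw) _; rewrite pavgD pavgZl; apply: lerD.
  rewrite pavg_sum mulr_sumr; rewrite le_eqVlt; apply/orP; left; apply/eqP; apply: eq_bigr => v _.
  rewrite pavg_sum mulr_sumr; apply: eq_bigr => v' _.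
  by rewrite pavgZr pavg_eq.
have n0 : 0 < n%:R :> R by rewrite ltr0n ltnW.
have n2 : 0 < n.-1%:R :> R by rewrite ltr0n -ltnS prednK// ltnW.
have bnd : pavg (fun s => \sum_v \sum_v' \sum_u \sum_u' i2 s v v' u u') <=
    (N ^ 4)%:R * (n%:R * n.-1%:R)^-1.
  apply: (@le_trans _ _ (\sum_(v < N) \sum_(v' < N) \sum_(u < N) \sum_(u' < N)
     (n%:R * n.-1%:R)^-1)); last first.
    by rewrite !sumr_const card_ord -!mulrnA [leRHS]mulr_natl !expnS expn0 muln1 !mulnA.
  rewrite pavg_sum; apply: ler_sum => v _; rewrite pavg_sum; apply: ler_sum => v' _.
  rewrite pavg_sum; apply: ler_sum => u _; rewrite pavg_sum; apply: ler_sum => u' _.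
  have inv0 : 0 <= (n%:R * n.-1%:R)^-1 :> R by rewrite invr_ge0 mulr_ge0 ?ltW.
  rewrite /i2 pavgZl pavgZl; case: eqVneq => [|vu]; first by rewrite mul0r.
  rewrite mul1r; case: eqVneq => [|vu']; first by rewrite mul0r.
  by rewrite mul1r pavg_eq2// (inj_eq wI).
apply: le_trans (ler_wpM2l c0 bnd) _.
have e : (n%:R * n.-1%:R)^-1 <= 2 / n%:R ^+ 2 :> R.
  have : n.-1%:R + 1 = n%:R :> R by rewrite natr1 prednK// ltnW.
  have : 1 <= n.-1%:R :> R by rewrite ler1n -ltnS prednK// ltnW.
  rewrite -div1r ler_pdivrMr ?mulr_gt0// mulrAC ler_pdivlMr ?exprn_gt0//.
  by move: (n%:R) (n.-1%:R) n0 n2 => a b; nra.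
rewrite mulrA; apply: le_trans (ler_wpM2l (mulr_ge0 c0 (ler0n R (N ^ 4))) e) _.
by rewrite /c; move: ((N ^ 4)%:R) ((1 + N ^ 2)%:R) (n%:R ^+ 2)^-1 => x y z; lra.
Qed.

End overlap.

(** * The kernel of the U-statistic *)

(** The three sums of the statistic: [tA] is the joint term, [tB] the term in which all
    arguments are distinct and [tC] the mixed one. *)
Definition term := option bool.
Notation tA := (Some true : term).
Notation tB := (Some false : term).
Notation tC := (None : term).

Section edges.
Variables (R : realFieldType) (d : nat).
Hypothesis hd : (1 < d)%N.

Definition coef (t : term) : R := if t is None then - 2 else 1.

Lemma big_term (F : term -> R) : \sum_(t : term) F t = F tA + F tB + F tC.
Proof.
rewrite (bigD1 tA)//= (bigD1 tB)//= (bigD1 tC)//= big1 ?addr0 ?addrA// => -[[]|]//.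
Qed.

Lemma sum_coef (F : term -> R) : \sum_(t : term) coef t * F t = F tA + F tB - 2 * F tC.
Proof. by rewrite big_term /coef !mul1r mulNr. Qed.

Lemma pzero_subproof : (0 < 2 * d)%N. Proof. by rewrite muln_gt0 /= ltnW. Qed.
Lemma pone_subproof : (1 < 2 * d)%N.
Proof. by rewrite mul2n -addnn; apply: (leq_trans hd); exact: leq_addr. Qed.
Lemma pstar_subproof (j : 'I_d) : (j.+1 < 2 * d)%N.
Proof.
rewrite mul2n -addnn; apply: (@leq_ltn_trans d); first exact: ltn_ord.
by rewrite -[X in (X < _)%N]addn0 ltn_add2l ltnW.
Qed.

Definition pzero := Ordinal pzero_subproof.
Definition pone := Ordinal pone_subproof.
Definition pstar j := Ordinal (pstar_subproof j).

(** [ea t j] and [eb t j] are the two positions compared by the [j]-th kernel in the term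
    [t], all taken in a common window of [2 * d] positions: an edge labelled [j]. *)
Definition ea (t : term) (j : 'I_d) : 'I_(2 * d) :=
  match t with Some true => pzero | Some false => pos_odd j | None => pzero end.
Definition eb (t : term) (j : 'I_d) : 'I_(2 * d) :=
  match t with Some true => pone | Some false => pos_even j | None => pstar j end.

Lemma ea_neq_eb t j : ea t j != eb t j.
Proof. by case: t => [[]|]; rewrite -val_eqE //= neq_ltn ltnSn. Qed.

Lemma pos_odd_inj : injective (@pos_odd d).
Proof. by move=> i j [] /double_inj /val_inj. Qed.
Lemma pos_even_inj : injective (@pos_even d).
Proof. by move=> i j [] /double_inj /val_inj. Qed.
Lemma pstar_inj : injective pstar.
Proof. by move=> i j [] /val_inj. Qed.
Lemma pos_odd_even i j : @pos_odd d i != pos_even j.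
Proof.
rewrite -val_eqE /=; apply/negP => /eqP e.
by have := congr1 odd e; rewrite /= !odd_double.
Qed.
Lemma pzero_pstar j : pzero != pstar j. Proof. by rewrite -val_eqE. Qed.

Definition inc (t : term) (j : 'I_d) (v : 'I_(2 * d)) := (v == ea t j) || (v == eb t j).

Lemma sum_vertices_A (f : 'I_(2 * d) -> R) a a0 :
  f pzero = a -> f pone = a -> (forall v, v != pzero -> v != pone -> f v = a0) ->
  \sum_v f v = 2 * a + (2 * d - 2)%:R * a0.
Proof.
move=> f0 f1 fv; rewrite (bigD1 pzero)//= (bigD1 pone)//= f0 f1.
rewrite (eq_bigr (fun=> a0)); last by move=> v /andP[]; exact: fv.
rewrite sumr_const; set k := #|_|.
have -> : k = (2 * d - 2)%N.
  rewrite /k (_ : #|_| = #|~: [set pzero; pone]|); last first.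
    by apply: eq_card => v; rewrite !inE negb_or.
  by rewrite cardsCs finset.setCK card_ord cards2.
by rewrite mulr_natl addrA -mulr2n mulr_natl.
Qed.

Lemma sum_vertices_B (f : 'I_(2 * d) -> R) :
  \sum_v f v = \sum_j (f (pos_odd j) + f (pos_even j)).
Proof.
rewrite big_split /= (bigID (fun v : 'I_(2 * d) => ~~ odd v)) /=; congr (_ + _).
  rewrite [RHS](_ : _ = \sum_(v in (@pos_odd d) @: [set: 'I_d]) f v).
    apply: eq_bigl => v; apply/idP/imsetP => [ov|[j _ ->]]; last by rewrite /= odd_double.
    have vd : (v./2 < d)%N by rewrite ltn_half_double -mul2n.
    exists (Ordinal vd) => //; apply: val_inj => /=.
    by rewrite -[LHS](odd_double_half v) (negbTE ov).
  rewrite big_imset/=; first by apply: eq_bigl => j; rewrite inE.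
  by move=> i j _ _; exact: pos_odd_inj.
rewrite [RHS](_ : _ = \sum_(v in (@pos_even d) @: [set: 'I_d]) f v).
  apply: eq_bigl => v; rewrite negbK; apply/idP/imsetP => [ov|[j _ ->]]; last by rewrite /= odd_double.
  have vd : (v./2 < d)%N by rewrite ltn_half_double -mul2n.
  exists (Ordinal vd) => //; apply: val_inj => /=.
  by rewrite -[LHS](odd_double_half v) ov.
rewrite big_imset/=; first by apply: eq_bigl => j; rewrite inE.
by move=> i j _ _; exact: pos_even_inj.
Qed.

Lemma sum_vertices_C (f : 'I_(2 * d) -> R) g g0 :
  f pzero = g -> (forall v, v != pzero -> (forall j, v != pstar j) -> f v = g0) ->
  \sum_v f v = g + \sum_j f (pstar j) + (d - 1)%:R * g0.
Proof.
move=> f0 fv; rewrite (bigD1 pzero)//= f0 -addrA; congr (_ + _).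
rewrite (bigID (fun v => v \in pstar @: [set: 'I_d])) /=; congr (_ + _).
  rewrite [RHS](_ : _ = \sum_(v in pstar @: [set: 'I_d]) f v).
    apply: eq_bigl => v; apply/andb_idl => /imsetP[j _ ->].
    by rewrite eq_sym pzero_pstar.
  rewrite big_imset/=; first by apply: eq_bigl => j; rewrite inE.
  by move=> i j _ _; exact: pstar_inj.
rewrite (eq_bigr (fun=> g0)); last first.
  move=> v /andP[v0 vN]; apply: fv => // j.
  by apply: contraNneq vN => ->; rewrite imset_f.
rewrite sumr_const mulr_natl; congr (_ *+ _).
rewrite (_ : #|_| = #|~: (pzero |: pstar @: [set: 'I_d])|); last first.
  by apply: eq_card => v; rewrite !inE negb_or.
rewrite cardsCs finset.setCK card_ord cardsU1 card_imset ?cardsT ?card_ord; last exact: pstar_inj.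
have -> : pzero \notin pstar @: [set: 'I_d].
  by apply/negP => /imsetP[j _ /eqP]; rewrite (negbTE (pzero_pstar _)).
by rewrite add1n mul2n -addnn subnS addnK subn1.
Qed.

(** Here [f t v] is the mean of the term [t] given the entry at position [v].  Summing over the
    positions produces the first-order projection of the kernel: in [tA] only the positions [0]
    and [1] count, in [tB] every position lies on one edge, in [tC] the position [0] lies on all
    edges and the positions [1], ..., [d] on one edge each. *)
Lemma sum_vertices (f : term -> 'I_(2 * d) -> R) a a0 b g g0 e :
  f tA pzero = a -> f tA pone = a ->
  (forall v, v != pzero -> v != pone -> f tA v = a0) ->
  (forall j, f tB (pos_odd j) = b j) -> (forall j, f tB (pos_even j) = b j) ->
  f tC pzero = g -> (forall j, f tC (pstar j) = e j) ->
  (forall v, v != pzero -> (forall j, v != pstar j) -> f tC v = g0) ->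
  \sum_v \sum_t coef t * f t v =
  2 * a + 2 * (\sum_j b j) - 2 * (g + \sum_j e j) + 2 * (d - 1)%:R * (a0 - g0).
Proof.
move=> h1 h2 h3 h4 h5 h6 h7 h8.
rewrite exchange_big/= [LHS](eq_bigr (fun t => coef t * \sum_v f t v)); last first.
  by move=> t _; rewrite mulr_sumr.
rewrite sum_coef (sum_vertices_A h1 h2 h3) (sum_vertices_C h6 h8) sum_vertices_B.
rewrite (eq_bigr (fun j => 2 * b j)); last by move=> j _; rewrite h4 h5; ring.
have -> : \sum_j f tC (pstar j) = \sum_j e j by apply: eq_bigr => j _; exact: h7.
rewrite -mulr_sumr.
have -> : (2 * d - 2)%N = (2 * (d - 1))%N by rewrite mulnBr.
by rewrite natrM; ring.
Qed.

End edges.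

(** * Second moment of the permuted statistic *)

Section perm_moment.
Variables (R : realFieldType) (d n : nat) (hd : (1 < d)%N) (hn : (2 * d <= n)%N).
Local Notation w := (widen_ord hn).
Variable K : 'I_d -> 'I_n -> 'I_n -> R.
Hypothesis Ksym : forall j a b, K j a b = K j b a.

(** [L j a b] is the kernel matrix of the block [j]; the kernel of the statistic is
    evaluated at the first [2 * d] entries of the permuted sample. *)
Definition ustat_kernel (L : 'I_d -> 'I_n -> 'I_n -> R) (s : 'S_n) : R :=
  \sum_(t : term) coef R t *
    \prod_(j < d) L j (s (w (ea hd t j))) (s (w (eb hd t j))).
Definition ustat L := pavg (ustat_kernel L).

Lemma widen_inj : injective w.
Proof. by move=> i j [] /val_inj. Qed.

(** The mean of the squared entries of the [j]-th kernel matrix off the diagonal. *)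
Definition edge_sqr (j : 'I_d) : R :=
  pavg (fun rho => K j (rho (w (pzero hd))) (rho (w (pone hd))) ^+ 2).

Let m2 := edge_sqr.

Let q2_subproof : (2 < 2 * d)%N.
Proof. by rewrite mul2n -addnn; apply: (@leq_trans (2 + 2)) => //; exact: leq_add. Qed.
Let q3_subproof : (3 < 2 * d)%N.
Proof. by rewrite mul2n -addnn; apply: (@leq_trans (2 + 2)) => //; exact: leq_add. Qed.
Let q2 := Ordinal q2_subproof.
Let q3 := Ordinal q3_subproof.

Let m1 (j : 'I_d) : R := pavg (fun rho =>
  K j (rho (w (pzero hd))) (rho (w (pone hd))) * K j (rho (w (pzero hd))) (rho (w q2))).
Let m0 (j : 'I_d) : R := pavg (fun rho =>
  K j (rho (w (pzero hd))) (rho (w (pone hd))) * K j (rho (w q2)) (rho (w q3))).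

Let sqrE (j : 'I_d) (a b : 'I_n) : a != b -> pavg (fun rho => K j (rho a) (rho b) ^+ 2) = m2 j.
Proof.
move=> ab; rewrite /m2 /edge_sqr.
apply: (@pavg_map _ _ (fun s => if s is [:: x; y] then K j x y ^+ 2 else 0)
  [:: a; b] [:: w (pzero hd); w (pone hd)]) => //=; first by rewrite inE ab.
Qed.

Let m0E j (a b c e : 'I_n) : uniq [:: a; b; c; e] ->
  pavg (fun rho => K j (rho a) (rho b) * K j (rho c) (rho e)) = m0 j.
Proof.
move=> u.
by apply: (@pavg_map _ _ (fun s => if s is [:: x; y; z; t] then K j x y * K j z t else 0)
  [:: a; b; c; e] [:: w (pzero hd); w (pone hd); w q2; w q3]).
Qed.

Let m1E j (a b c : 'I_n) : uniq [:: a; b; c] ->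
  pavg (fun rho => K j (rho a) (rho b) * K j (rho a) (rho c)) = m1 j.
Proof.
move=> u.
by apply: (@pavg_map _ _ (fun s => if s is [:: x; y; z] then K j x y * K j x z else 0)
  [:: a; b; c] [:: w (pzero hd); w (pone hd); w q2]).
Qed.

Let m2_ge0 j : 0 <= m2 j.
Proof. by apply: pavg_ge0 => s; exact: sqr_ge0. Qed.

Let prod_le j (a b c e : 'I_n) : a != b -> c != e ->
  `|pavg (fun rho => K j (rho a) (rho b) * K j (rho c) (rho e))| <= m2 j.
Proof.
move=> ab ce; apply: le_trans (pavg_norm _) _.
have -> : m2 j = pavg (fun rho => 2^-1 * (K j (rho a) (rho b) ^+ 2 + K j (rho c) (rho e) ^+ 2)).
  by rewrite pavgZl pavgD !sqrE//; lra.
apply: le_pavg => s; move: (K j (s a) (s b)) (K j (s c) (s e)) => x y.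
have := sqr_ge0 (x - y); have := sqr_ge0 (x + y).
by rewrite ler_norml => h1 h2; apply/andP; split; lra.
Qed.

(** The correlation of the kernel with its copy on the window permuted by [s], once the blocks
    have been permuted independently: the average then factorizes over the blocks, and each
    factor is an average of a product of two entries of one kernel matrix. *)
Definition cross (s : 'S_n) : R :=
  \sum_(t : term) \sum_(t' : term) coef R t * coef R t' * \prod_(j < d)
     pavg (fun rho => K j (rho (w (ea hd t j))) (rho (w (eb hd t j))) *
       K j (rho (s (w (ea hd t' j)))) (rho (s (w (eb hd t' j))))).

(* [m2], [m1] and [m0] are the averages of a product of two entries whose index pairs share
   two, one or no index, so [r v v'] is the value of [cross] when the windows meet only at [v],
   [v']. *)
Let r (v v' : 'I_(2 * d)) : R :=
  \sum_(t : term) \sum_(t' : term) coef R t * coef R t' * \prod_(j < d)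
     (if inc hd t j v && inc hd t' j v' then m1 j else m0 j).

Let sumcoef0 (c : R) : \sum_(t : term) \sum_(t' : term) coef R t * coef R t' * c = 0.
Proof. by rewrite !big_term /coef; ring. Qed.

Let normcoef (F : term -> term -> R) c : (forall t t', `|F t t'| <= c) ->
  `|\sum_(t : term) \sum_(t' : term) coef R t * coef R t' * F t t'| <= 16 * c.
Proof.
move=> h; rewrite !big_term /coef.
have H t t' : - c <= F t t' <= c by rewrite -ler_norml.
have := H tA tA; have := H tA tB; have := H tA tC; have := H tB tA; have := H tB tB;
have := H tB tC; have := H tC tA; have := H tC tB; have := H tC tC.
rewrite ler_norml; lra.
Qed.

Let w_eq x y : (w x == w y) = (x == y).
Proof. by rewrite (inj_eq widen_inj). Qed.

(* With independently permuted blocks the three terms have the same mean given one entry, so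
   the statistic is degenerate and the contribution of order [1 / n] cancels. *)
Let sum_r0 : \sum_v \sum_v' r v v' = 0.
Proof.
rewrite exchange_big /= big1// => v' _.
have -> : \sum_v r v v' = \sum_(t' : term) coef R t' * \sum_v \sum_(t : term) coef R t *
    \prod_(j < d) (if inc hd t j v && inc hd t' j v' then m1 j else m0 j).
  rewrite /r; under eq_bigr do rewrite exchange_big /=.
  rewrite exchange_big /=; apply: eq_bigr => t' _; rewrite mulr_sumr.
  apply: eq_bigr => v _; rewrite mulr_sumr; apply: eq_bigr => t _.
  by rewrite mulrA; congr (_ * _); rewrite mulrC.
rewrite big1// => t' _.
pose u j := if inc hd t' j v' then m1 j else m0 j.
pose b j := u j * \prod_(l < d | l != j) m0 l.
rewrite (@sum_vertices _ _ hd _ (\prod_(j < d) u j) (\prod_(j < d) m0 j) b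
  (\prod_(j < d) u j) (\prod_(j < d) m0 j) b).
- by ring.
- by apply: eq_bigr => j _; rewrite /inc eqxx.
- by apply: eq_bigr => j _; rewrite /inc eqxx orbT.
- by move=> v v0 v1; apply: eq_bigr => j _; rewrite /inc (negbTE v0) (negbTE v1).
- move=> j; rewrite (bigD1 j)//= /inc eqxx; congr (_ * _); apply: eq_bigr => l lj.
  by rewrite (inj_eq (@pos_odd_inj d)) eq_sym (negbTE lj) (negbTE (pos_odd_even _ _)).
- move=> j; rewrite (bigD1 j)//= /inc eqxx orbT; congr (_ * _); apply: eq_bigr => l lj.
  by rewrite (inj_eq (@pos_even_inj d)) [_ == pos_odd _]eq_sym (negbTE (pos_odd_even _ _)) eq_sym (negbTE lj).
- by apply: eq_bigr => j _; rewrite /inc eqxx.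
- move=> j; rewrite (bigD1 j)//= /inc eqxx orbT; congr (_ * _); apply: eq_bigr => l lj.
  by rewrite (inj_eq (@pstar_inj _ hd)) eq_sym (negbTE (pzero_pstar _ _)) eq_sym (negbTE lj).
- move=> v v0 vN; apply: eq_bigr => j _.
  by rewrite /inc (negbTE v0) (negbTE (vN _)).
Qed.

Let cE : 16 * \prod_(j < d) m2 j >= 0.
Proof. by rewrite mulr_ge0// prodr_ge0. Qed.

(** The contribution of single overlaps cancels, so only the [n ^ -2] term of
    [overlap_average] is left. *)
Lemma cross_average : pavg cross <=
  (1 + (2 * d) ^ 2)%:R * ((2 * d) ^ 4)%:R * (16 * \prod_(j < d) edge_sqr j) * 2 / n%:R ^+ 2.
Proof.
have n1 : (1 < n)%N by apply: leq_trans hn; exact: pone_subproof.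
have := @overlap_average R n (2 * d) _ widen_inj n1 cross r (16 * \prod_(j < d) m2 j).
rewrite sum_r0 mulr0 add0r; apply.
- move=> s no; rewrite /cross -[RHS](sumcoef0 (\prod_(j < d) m0 j)).
  apply: eq_bigr => t _; apply: eq_bigr => t' _; congr (_ * _); apply: eq_bigr => j _.
  apply: m0E => /=; rewrite !inE !negb_or !(inj_eq (@perm_inj _ s)) !w_eq !ea_neq_eb /=.
  by rewrite ![w _ == s _]eq_sym !no.
- move=> s v v' svv' only; apply: eq_bigr => t _; apply: eq_bigr => t' _; congr (_ * _).
  apply: eq_bigr => j _.
  have key x y : (s (w y) == w x) = (x == v) && (y == v').
    apply/eqP/andP => [/only [-> ->]|[/eqP -> /eqP ->]] //.
  have u4 : ~~ (inc hd t j v && inc hd t' j v') ->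
      uniq [:: w (ea hd t j); w (eb hd t j); s (w (ea hd t' j)); s (w (eb hd t' j))].
    move=> ninc /=; rewrite !inE !negb_or !(inj_eq (@perm_inj _ s)) !w_eq !ea_neq_eb /=.
    rewrite ![w _ == s _]eq_sym !key !andbT -!negb_or.
    apply: contra ninc; rewrite /inc => h.
    by rewrite ![v == _]eq_sym ![v' == _]eq_sym; move: h; do 4 case: (_ == _).
  case: ifPn => [|/u4 /m0E //].
  have ab := ea_neq_eb hd t j; have ab' := ea_neq_eb hd t' j.
  have gen x y' : x != v -> y' != v' ->
      pavg (fun rho => K j (rho (w v)) (rho (w x)) *
        K j (rho (s (w v'))) (rho (s (w y')))) = m1 j.
    move=> xv yv; rewrite svv'; apply: m1E => /=.
    rewrite !inE !negb_or w_eq eq_sym xv [w v == _]eq_sym key [w _ == s _]eq_sym key.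
    by rewrite (negbTE yv) !andbF.
  rewrite /inc => /andP[/orP[]/eqP va /orP[]/eqP va'].
  + by rewrite -va -va'; apply: gen; rewrite ?va ?va' eq_sym.
  + rewrite -(gen (eb hd t j) (ea hd t' j)) ?va ?va' 1?eq_sym//; last by rewrite eq_sym.
    by apply: eq_pavg => rho; congr (_ * _); rewrite Ksym.
  + rewrite -(gen (ea hd t j) (eb hd t' j)) ?va ?va' 1?eq_sym//; last by rewrite eq_sym.
    by apply: eq_pavg => rho; congr (_ * _); rewrite Ksym.
  + rewrite -(gen (ea hd t j) (ea hd t' j)) ?va ?va'//.
    by apply: eq_pavg => rho; congr (_ * _); rewrite Ksym.
- move=> s; apply: normcoef => t t'; rewrite normr_prod; apply: ler_prod => j _.
  rewrite normr_ge0 /=; apply: prod_le; rewrite ?(inj_eq (@perm_inj _ s)) w_eq; exact: ea_neq_eb.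
- move=> v v'; apply: normcoef => t t'; rewrite normr_prod; apply: ler_prod => j _.
  rewrite normr_ge0 /=; case: ifP => _; apply: prod_le; by rewrite w_eq.
Qed.

(** The average over independent uniform permutations, one for each block. *)
Definition favg (F : {ffun 'I_d -> 'S_n} -> R) : R :=
  #|{: {ffun 'I_d -> 'S_n}}|%:R^-1 * \sum_pi F pi.

Lemma favg_prod (g : 'I_d -> 'S_n -> R) :
  favg (fun pi => \prod_(j < d) g j (pi j)) = \prod_(j < d) pavg (g j).
Proof.
rewrite /favg /pavg big_split /= bigA_distr_bigA /=; congr (_ * _).
rewrite prodr_const card_ord card_ffun card_ord card_Sn natrX exprVn//.
Qed.

Lemma favg_sum I (rs : seq I) (P : pred I) (F : I -> {ffun 'I_d -> 'S_n} -> R) :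
  favg (fun s => \sum_(i <- rs | P i) F i s) = \sum_(i <- rs | P i) favg (F i).
Proof. by rewrite /favg exchange_big mulr_sumr. Qed.

Lemma favgZl c F : favg (fun s => c * F s) = c * favg F.
Proof. by rewrite /favg -mulr_sumr mulrCA. Qed.

Lemma eq_favg F G : F =1 G -> favg F = favg G.
Proof. by move=> fg; congr (_ * _); apply: eq_bigr. Qed.

Lemma favg_pavg (F : 'S_n -> {ffun 'I_d -> 'S_n} -> R) :
  favg (fun pi => pavg (F^~ pi)) = pavg (fun s => favg (F s)).
Proof. by rewrite /pavg favgZl favg_sum. Qed.

(** Independent permutations of the blocks make the statistic a degenerate U-statistic of the
    fixed data: its second moment is of order [n ^ -2] times the product over the blocks of the
    mean squared kernel entries. *)
Lemma perm_moment :
  favg (fun pi => ustat (fun j a b => K j (pi j a) (pi j b)) ^+ 2) <=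
  (1 + (2 * d) ^ 2)%:R * ((2 * d) ^ 4)%:R * (16 * \prod_(j < d) edge_sqr j) * 2 / n%:R ^+ 2.
Proof.
apply: le_trans cross_average; rewrite le_eqVlt; apply/orP; left; apply/eqP.
rewrite (eq_favg (G := fun pi => pavg (fun s => pavg (fun s' => 
   ustat_kernel (fun j a b => K j (pi j a) (pi j b)) s *
   ustat_kernel (fun j a b => K j (pi j a) (pi j b)) s')))); last first.
  move=> pi; rewrite expr2 {1}/ustat -pavgZr; apply: eq_pavg => s.
  by rewrite -pavgZl.
rewrite (favg_pavg (fun s pi => pavg (fun s' => _ * _))) -[RHS](@pavg_cst R n); apply: eq_pavg => s.
rewrite (favg_pavg (fun s' pi => _ * _)) -[RHS](pavg_mulr (s^-1)%g); apply: eq_pavg => s'.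
rewrite (eq_favg (G := fun pi => \sum_(t : term) \sum_(t' : term) coef R t * coef R t' *
  \prod_(j < d) (K j (pi j (s (w (ea hd t j)))) (pi j (s (w (eb hd t j)))) *
     K j (pi j (s' (w (ea hd t' j)))) (pi j (s' (w (eb hd t' j))))))); last first.
  move=> pi; rewrite /ustat_kernel mulr_suml; apply: eq_bigr => t _.
  by rewrite mulr_sumr; apply: eq_bigr => t' _; rewrite big_split /=; ring.
rewrite favg_sum; apply: eq_bigr => t _; rewrite favg_sum; apply: eq_bigr => t' _.
rewrite favgZl (favg_prod (fun j rho => K j (rho (s (w (ea hd t j)))) (rho (s (w (eb hd t j)))) *
     K j (rho (s' (w (ea hd t' j)))) (rho (s' (w (eb hd t' j)))))).
congr (_ * _); apply: eq_bigr => j _.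
rewrite -[RHS](pavg_mull s); apply: eq_pavg => rho.
by rewrite !permM !permKV.
Qed.

End perm_moment.

Local Open Scope classical_set_scope.
Local Open Scope ring_scope.

(** * Measures with a density and finite powers of a measure *)

Section density.
Local Open Scope ereal_scope.
Context d (T : measurableType d) (R : realType).
Variables (nu mu : {measure set T -> \bar R}) (f : T -> R).
Hypotheses (mf : measurable_fun setT f) (f0 : forall x, (0 <= f x)%R).
Hypothesis nuE : forall A, measurable A -> nu A = \int[mu]_(x in A) (f x)%:E.

Import HBNNSimple.

(** Both sides are monotone limits over simple functions, for which the claim is the
    hypothesis on sets. *)
Lemma ge0_integral_density (g : T -> \bar R) :
  measurable_fun setT g -> (forall x, 0 <= g x) ->
  \int[nu]_x g x = \int[mu]_x (g x * (f x)%:E).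
Proof.
move=> mg g0; pose h := nnsfun_approx measurableT mg.
have mfE : measurable_fun setT (EFin \o f) by exact/measurable_EFinP.
have -> : \int[nu]_x g x = lim (\int[nu]_x (EFin \o h n) x @[n --> \oo]).
  have gE x : g x = lim ((EFin \o h n) x @[n --> \oo]).
    by apply/esym/cvg_lim => //; exact: cvg_nnsfun_approx.
  under eq_integral => x _ do rewrite gE.
  apply: monotone_convergence => //.
  - by move=> n; exact/measurable_EFinP.
  - by move=> n x _ /=; rewrite lee_fin.
  - by move=> x _ a b ab; rewrite lee_fin; exact/lefP/nd_nnsfun_approx.
have -> : \int[mu]_x (g x * (f x)%:E) =
    lim (\int[mu]_x ((EFin \o h n) x * (f x)%:E) @[n --> \oo]).
  have gE x : g x * (f x)%:E = lim ((EFin \o h n) x * (f x)%:E @[n --> \oo]).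
    by apply/esym/cvg_lim => //; apply: cvgeZr => //; exact: cvg_nnsfun_approx.
  under eq_integral => x _ do rewrite gE.
  apply: monotone_convergence => //.
  - move=> n; apply: emeasurable_funM => //; exact/measurable_EFinP.
  - by move=> n x _ /=; rewrite mule_ge0// lee_fin.
  - move=> x _ a b ab /=; rewrite lee_wpmul2r ?lee_fin//.
    exact/lefP/nd_nnsfun_approx.
suff suf n : \int[nu]_x (EFin \o h n) x = \int[mu]_x ((EFin \o h n) x * (f x)%:E).
  by under eq_fun do rewrite suf.
have mi r : measurable_fun setT
    (fun x => (r * \1_(h n @^-1` [set r]) x)%:E : \bar R).
  apply/measurable_EFinP; apply: measurable_funM => //.
have i0 (y : R) x : y \in range (h n) -> 0 <= (y * \1_(h n @^-1` [set y]) x)%:E :> \bar R.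
  by move=> _; exact: nnfun_muleindic_ge0.
transitivity (\int[nu]_x
   (\sum_(y \in range (h n)) (y * \1_(h n @^-1` [set y]) x)%:E)).
  by apply: eq_integral => t tE; rewrite /= fimfunE -fsumEFin.
rewrite ge0_integral_fsum//; last by move=> m y _; exact: nnfun_muleindic_ge0.
transitivity (\int[mu]_x (\sum_(y \in range (h n))
    (y * \1_(h n @^-1` [set y]) x)%:E * (f x)%:E)); last first.
  apply: eq_integral => x _ /=.
  rewrite -ge0_mule_fsuml => [|y]; last exact: nnfun_muleindic_ge0.
  by rewrite fsumEFin // -(fimfunE _ x).
rewrite ge0_integral_fsum//; last 2 first.
  - by move=> y; apply: emeasurable_funM => //; exact: mi.
  - by move=> m y _; rewrite mule_ge0 ?lee_fin ?f0//; exact: nnfun_muleindic_ge0.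
apply: eq_fsbigr => r; rewrite inE => -[t _ rE].
have r0 : (0 <= r)%R by rewrite -rE.
have mA : measurable (h n @^-1` [set r]).
  by rewrite -[X in measurable X]setTI; apply: (measurable_funPT (h n)).
under eq_integral do rewrite EFinM.
rewrite ge0_integralZl//; last first.
  exact/measurable_EFinP/measurable_indic.
rewrite integral_indic// setIT nuE//.
under [RHS]eq_integral do rewrite EFinM -muleA.
rewrite ge0_integralZl//; last 2 first.
  - by apply: emeasurable_funM => //; exact/measurable_EFinP.
  - by move=> x _; rewrite mule_ge0 ?lee_fin.
congr (_ * _); rewrite integral_mkcond; apply: eq_integral => x _.
rewrite patchE indicE; case: ifPn => _; by rewrite (mul1e, mul0e).
Qed.

End density.

Section rect.
Context d (T : measurableType d) (R : realType) (n : nat).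

Definition rect (A : 'I_n -> set T) : set (n.-tuple T) :=
  [set x | forall i, A i (tnth x i)].

Lemma rectE A : rect A = \bigcap_(i in [set: 'I_n]) ((@tnth n T)^~ i @^-1` A i).
Proof. by apply/seteqP; split => x /= h i; [move=> _|]; exact: h. Qed.

Lemma measurable_rect A : (forall i, measurable (A i)) -> measurable (rect A).
Proof.
move=> mA; rewrite rectE; apply: fin_bigcap_measurable => // i _.
by rewrite -[X in measurable X]setTI; exact: measurable_tnth.
Qed.

(** Rectangles are stable under intersection and generate the product sigma-algebra. *)
Lemma rect_unique (nu1 nu2 : {measure set (n.-tuple T) -> \bar R}) :
  (nu1 setT < +oo)%E ->
  (forall A, (forall i, measurable (A i)) -> nu1 (rect A) = nu2 (rect A)) ->
  forall B, measurable B -> nu1 B = nu2 B.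
Proof.
move=> fin eqR B mB.
pose G := [set C | exists2 A : 'I_n -> set T, (forall i, measurable (A i)) & C = rect A].
apply: (g_sigma_algebra_measure_unique G _ (fun=> setT)) => //.
- by move=> _ [A mA ->]; exact: measurable_rect.
- move=> _; exists (fun=> setT) => //.
  by apply/seteqP; split.
- by rewrite bigcup_const.
- move=> _ _ [A mA ->] [A' mA' ->]; exists (fun i => A i `&` A' i).
    by move=> i; exact: measurableI.
  by apply/seteqP; split => x /=; [move=> [h h'] i; split|move=> h; split=> i; case: (h i)].
- by move=> _ [A mA ->]; exact: eqR.
- move: B mB; apply: smallest_sub; first exact: smallest_sigma_algebra.
  move=> C; rewrite /= -bigcup_seq /= => -[i _] [D mD <-].
  apply: sub_sigma_algebra; exists (fun j => if j == i then D else setT).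
    by move=> j; case: ifP.
  rewrite setTI; apply/seteqP; split => x /=.
    by move=> Dx j; case: eqP => // ->.
  by move=> /(_ i); rewrite eqxx.
Qed.

End rect.

Section power.
Context d (T : measurableType d) (R : realType).
Variable mu : {sigma_finite_measure set T -> \bar R}.
Local Open Scope ereal_scope.

Lemma tconsE n (x : T) (y : n.-tuple T) i :
  tnth (tcons (x, y)) i = if unlift ord0 i is Some j then tnth y j else x.
Proof.
case: (unliftP ord0 i) => [j ->|->]; last by rewrite tnth0.
by rewrite tnthS.
Qed.

Lemma power_rect n (A : 'I_n -> set T) : (forall i, measurable (A i)) ->
  power_measure mu n (rect A) = \prod_(i < n) mu (A i).
Proof.
elim: n A => [|n ih] A mA.
  rewrite big_ord0 /= diracE mem_set//.
  by case.
rewrite /= /power_measure_step /pushforward big_ord_recl.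
rewrite (_ : _ @^-1` _ = A ord0 `*` rect (fun i => A (lift ord0 i))).
  by rewrite product_measure1E ?ih//; exact: measurable_rect.
apply/seteqP; split => -[x y] /=.
  move=> h; split; first by have := h ord0; rewrite tconsE unlift_none.
  by move=> i; have := h (lift ord0 i); rewrite tconsE liftK.
move=> [h0 h] i; rewrite tconsE.
by case: (unliftP ord0 i) => [j ->|->] //=; exact: h.
Qed.

Lemma power_setT n : mu setT = 1 -> power_measure mu n setT = 1.
Proof.
move=> mu1; transitivity (power_measure mu n (rect (fun=> setT))).
  by congr (power_measure _ _ _); apply/seteqP; split.
by rewrite power_rect// big1.
Qed.

Lemma ge0_integral_power0 (G : 0.-tuple T -> \bar R) :
  \int[power_measure mu 0]_x G x = G [tuple].
Proof.
rewrite (_ : G = cst (G [tuple])); last by apply/funext => x; rewrite tuple0.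
by rewrite /= integral_dirac// diracT mul1e.
Qed.

Lemma ge0_integral_powerS n (G : n.+1.-tuple T -> \bar R) :
  measurable_fun setT G -> (forall x, 0 <= G x) ->
  \int[power_measure mu n.+1]_x G x =
  \int[mu]_x \int[power_measure mu n]_y G (tcons (x, y)).
Proof.
move=> mG G0; transitivity (\int[mu \x power_measure mu n]_z G (tcons z)).
  rewrite [LHS](_ : _ = \int[pushforward (mu \x power_measure mu n) (@tcons _ T n)]_x G x)//.
  by rewrite ge0_integral_pushforward ?preimage_setT//; exact: measurable_tcons.
rewrite fubini_tonelli1//.
by apply: (measurableT_comp mG); exact: measurable_tcons.
Qed.

End power.

Section law.
Context d (T : measurableType d) (R : realType).
Variable mu : {sigma_finite_measure set T -> \bar R}.
Hypothesis mu1 : mu setT = 1%E.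
Context d' (O : measurableType d') (nu : {measure set O -> \bar R}).
Hypothesis nu1 : nu setT = 1%E.
Context (n : nat) (Phi : O -> n.-tuple T) (mPhi : measurable_fun setT Phi).
Hypothesis PhiE : forall A : 'I_n -> set T, (forall i, measurable (A i)) ->
  nu [set w | forall i, A i (tnth (Phi w) i)] = (\prod_(i < n) mu (A i))%E.
Local Open Scope ereal_scope.

Let Phi' : {mfun O >-> n.-tuple T} := HB.pack Phi (isMeasurableFun.Build _ _ _ _ _ mPhi).

(** The law of [Phi] is the power measure as soon as they agree on rectangles. *)
Lemma ge0_integral_law (G : n.-tuple T -> \bar R) :
  measurable_fun setT G -> (forall x, 0 <= G x) ->
  \int[power_measure mu n]_x G x = \int[nu]_w G (Phi w).
Proof.
move=> mG G0.
transitivity (\int[pushforward nu Phi']_x G x); last first.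
  by rewrite ge0_integral_pushforward ?preimage_setT.
apply: eq_measure_integral => A mA _.
apply: rect_unique => //; first by rewrite [X in X < _](_ : _ = 1) ?ltry//; exact: power_setT.
move=> B mB; transitivity (\prod_(i < n) mu (B i)); first exact: power_rect.
by rewrite -PhiE.
Qed.

End law.

(** * Expectations of bounded measurable functions *)

Section bounded_fun.
Context d (T : measurableType d) (R : realType).
Implicit Types f g : T -> R.

(** Kernels, indicators and all functions of them that occur are bounded and measurable.  This
    class is stable under the operations used, and its members are integrable for every
    probability measure, so that integrability is settled by a membership proof. *)
Definition bfun f := measurable_fun setT f /\ exists K, forall x, `|f x| <= K.

Lemma bfun_cst (c : R) : bfun (fun=> c).
Proof. by split => //; exists `|c|. Qed.

Lemma bfunD f g : bfun f -> bfun g -> bfun (fun x => f x + g x).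
Proof.
move=> [mf [K fK]] [mg [L gL]]; split; first exact: measurable_funD.
by exists (K + L) => x; rewrite (le_trans (ler_normD _ _))// lerD.
Qed.

Lemma bfunM f g : bfun f -> bfun g -> bfun (fun x => f x * g x).
Proof.
move=> [mf [K fK]] [mg [L gL]]; split; first exact: measurable_funM.
by exists (K * L) => x; rewrite normrM ler_pM.
Qed.

Lemma bfunN f : bfun f -> bfun (fun x => - f x).
Proof.
move=> [mf [K fK]]; split; first exact: measurableT_comp.
by exists K => x; rewrite normrN.
Qed.

Lemma bfunB f g : bfun f -> bfun g -> bfun (fun x => f x - g x).
Proof. by move=> bf bg; apply: bfunD => //; exact: bfunN. Qed.

Lemma bfunX f n : bfun f -> bfun (fun x => f x ^+ n).
Proof.
move=> bf; elim: n => [|n ih]; first exact: bfun_cst.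
rewrite (_ : (fun _ => _) = fun x => f x * f x ^+ n); first exact: bfunM.
by apply/funext => x; rewrite exprS.
Qed.

Lemma bfun_sum I (s : seq I) (P : pred I) (F : I -> T -> R) :
  (forall i, P i -> bfun (F i)) -> bfun (fun x => \sum_(i <- s | P i) F i x).
Proof.
move=> bF; elim: s => [|i s ih].
  rewrite (_ : (fun _ => _) = fun=> 0); first exact: bfun_cst.
  by apply/funext => x; rewrite big_nil.
rewrite (_ : (fun _ => _) = fun x =>
  (if P i then F i x else 0) + \sum_(j <- s | P j) F j x).
  by apply: bfunD => //; case: (boolP (P i)) => Pi; [exact: bF|exact: bfun_cst].
by apply/funext => x; rewrite big_cons; case: ifP; rewrite ?add0r.
Qed.

Lemma bfun_prod I (s : seq I) (P : pred I) (F : I -> T -> R) :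
  (forall i, P i -> bfun (F i)) -> bfun (fun x => \prod_(i <- s | P i) F i x).
Proof.
move=> bF; elim: s => [|i s ih].
  rewrite (_ : (fun _ => _) = fun=> 1); first exact: bfun_cst.
  by apply/funext => x; rewrite big_nil.
rewrite (_ : (fun _ => _) = fun x =>
  (if P i then F i x else 1) * \prod_(j <- s | P j) F j x).
  by apply: bfunM => //; case: (boolP (P i)) => Pi; [exact: bF|exact: bfun_cst].
by apply/funext => x; rewrite big_cons; case: ifP; rewrite ?mul1r.
Qed.

End bounded_fun.

Lemma bfun_comp d1 d2 (T1 : measurableType d1) (T2 : measurableType d2)
    (R : realType) (f : T2 -> R) (g : T1 -> T2) :
  bfun f -> measurable_fun setT g -> bfun (fun x => f (g x)).
Proof.
move=> [mf [K fK]] mg; split; first exact: measurableT_comp.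
by exists K.
Qed.

Section expect.
Context d (T : measurableType d) (R : realType).
Variable mu : {measure set T -> \bar R}.
Hypothesis mu1 : mu setT = 1%E.
Implicit Types f g : T -> R.

Lemma bfun_integrable f : bfun f -> mu.-integrable setT (EFin \o f).
Proof.
move=> [mf [K fK]]; apply: measurable_bounded_integrable => //.
  by rewrite mu1 ltry.
by exists K; split; rewrite ?num_real// => x Kx y _; exact: le_trans (fK y) (ltW Kx).
Qed.

Lemma EFin_Rintegral f : bfun f -> (\int[mu]_x f x)%:E = (\int[mu]_x (f x)%:E)%E.
Proof.
by move=> bf; rewrite fineK//; apply: integrable_fin_num => //; exact: bfun_integrable.
Qed.

Lemma expect_cst (c : R) : \int[mu]_x c = c.
Proof. by rewrite Rintegral_cst// mu1 mulr1. Qed.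

Lemma expectD f g : bfun f -> bfun g ->
  \int[mu]_x (f x + g x) = \int[mu]_x f x + \int[mu]_x g x.
Proof. by move=> bf bg; rewrite RintegralD//; exact: bfun_integrable. Qed.

Lemma expectB f g : bfun f -> bfun g ->
  \int[mu]_x (f x - g x) = \int[mu]_x f x - \int[mu]_x g x.
Proof. by move=> bf bg; rewrite RintegralB//; exact: bfun_integrable. Qed.

Lemma expectZl (c : R) f : bfun f -> \int[mu]_x (c * f x) = c * \int[mu]_x f x.
Proof. by move=> bf; rewrite RintegralZl//; exact: bfun_integrable. Qed.

Lemma expectZr (c : R) f : bfun f -> \int[mu]_x (f x * c) = \int[mu]_x f x * c.
Proof. by move=> bf; rewrite RintegralZr//; exact: bfun_integrable. Qed.

Lemma expect_sum I (s : seq I) (P : pred I) (F : I -> T -> R) :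
  (forall i, P i -> bfun (F i)) ->
  \int[mu]_x (\sum_(i <- s | P i) F i x) = \sum_(i <- s | P i) \int[mu]_x F i x.
Proof.
move=> bF; elim: s => [|i s ih].
  under eq_Rintegral do rewrite big_nil.
  by rewrite expect_cst big_nil.
under eq_Rintegral do rewrite big_cons.
rewrite big_cons; case: ifP => // Pi.
by rewrite expectD ?ih//; [exact: bF|exact: bfun_sum].
Qed.

Lemma le_expect f g : bfun f -> bfun g -> (forall x, f x <= g x) ->
  \int[mu]_x f x <= \int[mu]_x g x.
Proof. by move=> bf bg fg; apply: le_Rintegral => //; exact: bfun_integrable. Qed.

Lemma expect_ge0 f : (forall x, 0 <= f x) -> 0 <= \int[mu]_x f x.
Proof. by move=> f0; apply: Rintegral_ge0. Qed.

Lemma norm_expect f K : bfun f -> (forall x, `|f x| <= K) -> `|\int[mu]_x f x| <= K.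
Proof.
move=> bf fK; apply: le_trans (le_normr_Rintegral _ _) _ => //.
  exact: bfun_integrable.
rewrite -[leRHS]expect_cst; apply: le_expect => //; last exact: bfun_cst.
by case: bf => mf [L fL]; split; [exact: measurableT_comp|exists L => x; rewrite normr_id].
Qed.

Lemma expect_sqr_le f : bfun f -> (\int[mu]_x f x) ^+ 2 <= \int[mu]_x f x ^+ 2.
Proof.
move=> bf; set m := \int[mu]_x f x.
have : 0 <= \int[mu]_x ((f x - m) ^+ 2) by apply: expect_ge0 => x; exact: sqr_ge0.
have -> : (fun x => (f x - m) ^+ 2) = fun x => (f x ^+ 2 - (2 * m) * f x) + m ^+ 2.
  by apply/funext => x; ring.
have b2 : bfun (fun x => f x ^+ 2) by exact: bfunX.
have bZ : bfun (fun x => (2 * m) * f x) by apply: bfunM => //; exact: bfun_cst.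
rewrite expectD; [|exact: bfunB|exact: bfun_cst].
rewrite expectB// expect_cst expectZl// -/m; nra.
Qed.

(** The variance does not exceed the second moment. *)
Lemma expect_center_le f (c : R) : bfun f -> \int[mu]_x (f x + c) = 0 ->
  \int[mu]_x (f x + c) ^+ 2 <= \int[mu]_x f x ^+ 2.
Proof.
move=> bf; rewrite expectD ?expect_cst; [|by []|exact: bfun_cst] => m0.
have -> : (fun x => (f x + c) ^+ 2) = fun x => (f x ^+ 2 + (2 * c) * f x) + c ^+ 2.
  by apply/funext => x; ring.
have b2 : bfun (fun x => f x ^+ 2) by exact: bfunX.
have bZ : bfun (fun x => (2 * c) * f x) by apply: bfunM => //; exact: bfun_cst.
rewrite expectD; [|exact: bfunD|exact: bfun_cst].
by rewrite expectD// expect_cst expectZl//; nra.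
Qed.

End expect.

Section expect_section.
Context d1 d2 (T1 : measurableType d1) (T2 : measurableType d2) (R : realType).
Variable m2 : {sigma_finite_measure set T2 -> \bar R}.
Hypothesis m21 : m2 setT = 1%E.

Lemma bfun_pairl (f : T1 * T2 -> R) y : bfun f -> bfun (fun x => f (x, y)).
Proof. by move=> bf; apply: bfun_comp bf _; exact: measurable_fun_pair. Qed.

Lemma bfun_pairr (f : T1 * T2 -> R) x : bfun f -> bfun (fun y => f (x, y)).
Proof. by move=> bf; apply: bfun_comp bf _; exact: measurable_fun_pair. Qed.

(** Adding a bound makes the integrand nonnegative, where measurability of the partial
    integral is part of the theorem of Tonelli. *)
Lemma bfun_expectr (f : T1 * T2 -> R) : bfun f -> bfun (fun x => \int[m2]_y f (x, y)).
Proof.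
move=> bf; case: (bf) => mf [K fK]; split; last first.
  by exists K => x; apply: norm_expect => //; exact: bfun_pairr.
have bK : bfun (fun w => f w + K) by apply: bfunD => //; exact: bfun_cst.
have K0 w : (0 <= (f w + K)%:E)%E.
  by rewrite lee_fin; have := fK w; rewrite ler_norml; lra.
rewrite (_ : (fun x => _) = fun x => \int[m2]_y (f (x, y) + K) - K); last first.
  apply/funext => x; rewrite expectD ?expect_cst ?addrK//; first exact: bfun_pairr.
  exact: bfun_cst.
apply: measurable_funB => //; apply/measurable_EFinP.
rewrite (_ : _ \o _ = fubini_F m2 (fun w => (f w + K)%:E)).
  by apply: measurable_fun_fubini_tonelli_F => //; apply/measurable_EFinP; case: bK.
apply/funext => x /=; rewrite EFin_Rintegral//.
by apply: bfunD; [exact: bfun_pairr|exact: bfun_cst].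
Qed.

End expect_section.

Section expect_sectionl.
Context d1 d2 (T1 : measurableType d1) (T2 : measurableType d2) (R : realType).
Variable m1 : {sigma_finite_measure set T1 -> \bar R}.
Hypothesis m11 : m1 setT = 1%E.

Lemma bfun_expectl (f : T1 * T2 -> R) : bfun f -> bfun (fun y => \int[m1]_x f (x, y)).
Proof.
move=> bf; apply: (bfun_expectr m11 (f := fun w : T2 * T1 => f (w.2, w.1))).
by apply: bfun_comp bf _; exact: measurable_fun_pair.
Qed.

End expect_sectionl.

Section expect_prod.
Context d1 d2 (T1 : measurableType d1) (T2 : measurableType d2) (R : realType).
Variables (m1 : {sigma_finite_measure set T1 -> \bar R})
          (m2 : {sigma_finite_measure set T2 -> \bar R}).
Hypotheses (m11 : m1 setT = 1%E) (m21 : m2 setT = 1%E).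

Lemma prod_setT : (m1 \x m2)%E setT = 1%E.
Proof.
rewrite -setXTT product_measure1E//; apply: eq_trans (mule1 1%E).
exact: (f_equal2 *%E m11 m21).
Qed.

Lemma EFin_section_r (f : T1 * T2 -> R) : bfun f ->
  (fun x => (\int[m2]_y f (x, y))%:E) = fubini_F m2 (EFin \o f).
Proof. by move=> bf; apply/funext => x; rewrite EFin_Rintegral//; exact: bfun_pairr. Qed.

Lemma EFin_section_l (f : T1 * T2 -> R) : bfun f ->
  (fun y => (\int[m1]_x f (x, y))%:E) = fubini_G m1 (EFin \o f).
Proof. by move=> bf; apply/funext => y; rewrite EFin_Rintegral//; exact: bfun_pairl. Qed.

Lemma expect_prodr (f : T1 * T2 -> R) : bfun f ->
  \int[(m1 \x m2)%E]_w f w = \int[m1]_x \int[m2]_y f (x, y).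
Proof.
move=> bf; apply: EFin_inj; rewrite EFin_Rintegral//; last exact: prod_setT.
rewrite EFin_Rintegral//; last exact: bfun_expectr.
rewrite -[LHS]integral12_prod_meas1; last by apply: bfun_integrable => //; exact: prod_setT.
by apply: eq_integral => x _; rewrite -EFin_section_r.
Qed.

Lemma expect_prodl (f : T1 * T2 -> R) : bfun f ->
  \int[(m1 \x m2)%E]_w f w = \int[m2]_y \int[m1]_x f (x, y).
Proof.
move=> bf; apply: EFin_inj; rewrite EFin_Rintegral//; last exact: prod_setT.
rewrite EFin_Rintegral//; last exact: bfun_expectl.
rewrite -[LHS]integral21_prod_meas1; last by apply: bfun_integrable => //; exact: prod_setT.
by apply: eq_integral => x _; rewrite -EFin_section_l.
Qed.

Lemma expect_swap (f : T1 * T2 -> R) : bfun f ->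
  \int[m1]_x \int[m2]_y f (x, y) = \int[m2]_y \int[m1]_x f (x, y).
Proof. by move=> bf; rewrite -expect_prodr// expect_prodl. Qed.

End expect_prod.

Section expect_law.
Context d (T : measurableType d) (R : realType).
Variable mu : {sigma_finite_measure set T -> \bar R}.
Hypothesis mu1 : mu setT = 1%E.
Context d' (O : measurableType d') (nu : {measure set O -> \bar R}).
Hypothesis nu1 : nu setT = 1%E.

(** Adding a bound reduces a bounded function to a nonnegative one. *)
Lemma bfun_ge0_expect (f : T -> R) (Phi : O -> T) :
  measurable_fun setT Phi ->
  (forall G : T -> \bar R, measurable_fun setT G -> (forall x, 0 <= G x)%E ->
     (\int[mu]_x G x = \int[nu]_w G (Phi w))%E) ->
  bfun f -> \int[mu]_x f x = \int[nu]_w f (Phi w).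
Proof.
move=> mPhi h [mf [K fK]].
have bK : bfun (fun x => f x + K).
  split; first by apply: measurable_funD.
  by exists (K + `|K|) => x; rewrite (le_trans (ler_normD _ _))// lerD.
suff : \int[mu]_x (f x + K) = \int[nu]_w (f (Phi w) + K).
  rewrite !expectD ?expect_cst//; first by move/addIr.
  - by apply: (bfun_comp (g:=Phi)) => //; split => //; exists K.
  - exact: bfun_cst.
  - by split => //; exists K.
  - exact: bfun_cst.
congr fine; rewrite (h (fun x => (f x + K)%:E))//.
  by apply/measurable_EFinP; case: bK.
by move=> x; rewrite lee_fin; have := fK x; rewrite ler_norml; lra.
Qed.

End expect_law.

Section expect_power.
Context d (T : measurableType d) (R : realType).
Variable mu : {sigma_finite_measure set T -> \bar R}.
Hypothesis mu1 : mu setT = 1%E.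

Lemma expect_law d' (O : measurableType d') (nu : {measure set O -> \bar R})
    (n : nat) (Phi : O -> n.-tuple T) (f : n.-tuple T -> R) :
  nu setT = 1%E -> measurable_fun setT Phi ->
  (forall A : 'I_n -> set T, (forall i, measurable (A i)) ->
    nu [set w | forall i, A i (tnth (Phi w) i)] = (\prod_(i < n) mu (A i))%E) ->
  bfun f -> \int[power_measure mu n]_x f x = \int[nu]_w f (Phi w).
Proof.
move=> nu1 mPhi PhiE bf; apply: bfun_ge0_expect => //; first exact: power_setT.
by move=> G mG G0; exact: (ge0_integral_law mu1).
Qed.

End expect_power.

(** Total mass one for probability measures, their powers and their products; this side
    condition accompanies every use of an expectation. *)
Ltac prob1 := first
  [ assumption | exact: probability_setT
  | apply: power_setT; prob1 | apply: prod_setT; prob1 ].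

#[local] Hint Extern 0 (@eq (extended _) _ 1%E) => solve [prob1] : core.

(** * Independent coordinates *)

Section coords.
Context d (T : measurableType d) (R : realType).
Variable mu : {sigma_finite_measure set T -> \bar R}.
Hypothesis mu1 : mu setT = 1%E.

Definition merge n (A : pred 'I_n) (w : n.-tuple T * n.-tuple T) : n.-tuple T :=
  [tuple if A i then tnth w.1 i else tnth w.2 i | i < n].

Definition upd n (x : n.-tuple T) (i : 'I_n) (y : T) : n.-tuple T :=
  [tuple if j == i then y else tnth x j | j < n].

Definition sel m n (s : 'I_m -> 'I_n) (x : n.-tuple T) : m.-tuple T :=
  [tuple tnth x (s i) | i < m].

Lemma measurable_merge n (A : pred 'I_n) : measurable_fun setT (merge A).
Proof.
apply/measurable_fun_tnthP => i; rewrite (_ : _ \o _ =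
  if A i then (fun w => tnth w.1 i) else (fun w => tnth w.2 i)); last first.
  by apply/funext => w /=; rewrite tnth_mktuple; case: ifP.
by case: ifP => _; apply: measurableT_comp (measurable_tnth i) _.
Qed.

Lemma measurable_upd n i : measurable_fun setT (fun w : n.-tuple T * T => upd w.1 i w.2).
Proof.
apply/measurable_fun_tnthP => j; rewrite (_ : _ \o _ =
  if j == i then snd else (fun w => tnth w.1 j)); last first.
  by apply/funext => w /=; rewrite tnth_mktuple; case: ifP.
by case: ifP => _ //; apply: measurableT_comp (measurable_tnth j) _.
Qed.

Lemma measurable_updl n i y : measurable_fun setT (fun x : n.-tuple T => upd x i y).
Proof.
by apply: (measurableT_comp (measurable_upd i) (g := fun x => (x, y))).
Qed.

Lemma measurable_sel m n (s : 'I_m -> 'I_n) : measurable_fun setT (sel s).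
Proof.
apply/measurable_fun_tnthP => j; rewrite (_ : _ \o _ = fun x => tnth x (s j)).
  exact: measurable_tnth.
by apply/funext => x /=; rewrite tnth_mktuple.
Qed.

(** Exchanging coordinates between two independent copies preserves the law; this is how
    independence of disjoint sets of coordinates is expressed below. *)
Lemma expect_merge n (A : pred 'I_n) (f : n.-tuple T -> R) : bfun f ->
  \int[power_measure mu n]_x f x =
  \int[(power_measure mu n \x power_measure mu n)%E]_w f (merge A w).
Proof.
move=> bf; apply: expect_law => //.
- exact: measurable_merge.
- move=> B mB.
  rewrite (_ : [set _ | _] = rect (fun i => if A i then B i else setT)
    `*` rect (fun i => if A i then setT else B i)); last first.
    apply/seteqP; split => -[x y] /=.
      by move=> h; split => i; have := h i; rewrite tnth_mktuple; case: ifP.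
    by move=> [h h'] i; rewrite tnth_mktuple /=; have := h i; have := h' i; case: ifP.
  rewrite [LHS]product_measure1E; [|by apply: measurable_rect => i; case: ifP..].
  transitivity ((\prod_(i < n) mu (if A i then B i else setT)) *
                (\prod_(i < n) mu (if A i then setT else B i)))%E.
    by congr (_ * _)%E; apply: power_rect => i; case: ifP.
  rewrite -big_split /=; apply: eq_bigr => i _.
  by case: ifP => _; rewrite mu1 ?mule1 ?mul1e.
Qed.

Lemma expect_upd n (i : 'I_n) (f : n.-tuple T -> R) : bfun f ->
  \int[power_measure mu n]_x f x =
  \int[(power_measure mu n \x mu)%E]_w f (upd w.1 i w.2).
Proof.
move=> bf; apply: expect_law => //.
- exact: measurable_upd.
- move=> B mB.
  rewrite (_ : [set _ | _] = rect (fun j => if j == i then setT else B j) `*` B i);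
    last first.
    apply/seteqP; split => -[x y] /=.
      move=> h; split; last by have := h i; rewrite tnth_mktuple eqxx.
      by move=> j; have := h j; rewrite tnth_mktuple; case: ifP.
    move=> [h h'] j; rewrite tnth_mktuple /=; have := h j.
    by case: eqP => // ->.
  rewrite [LHS]product_measure1E//; last by apply: measurable_rect => j; case: ifP.
  rewrite (bigD1 i)//= muleC; congr (_ * _)%E.
  transitivity (\prod_(j < n) mu (if j == i then setT else B j))%E.
    by apply: power_rect => j; case: ifP.
  rewrite (bigD1 i)//= eqxx mu1 mul1e; apply: eq_bigr => j /negbTE ->//.
Qed.

Lemma power_sel_rect m n (s : 'I_m -> 'I_n) (B : 'I_m -> set T) :
  injective s -> (forall i, measurable (B i)) ->
  power_measure mu n [set x | forall i, B i (tnth (sel s x) i)] =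
  (\prod_(i < m) mu (B i))%E.
Proof.
move=> sI mB.
pose C j := if [pick i | s i == j] is Some i then B i else setT.
have Cs i : C (s i) = B i.
  rewrite /C; case: pickP => [i' /eqP/sI ->//|/(_ i)]; by rewrite eqxx.
rewrite (_ : [set _ | _] = rect C); last first.
  apply/seteqP; split => x /=.
    move=> h j; rewrite /C; case: pickP => // i /eqP <-.
    by have := h i; rewrite tnth_mktuple.
  by move=> h i; rewrite tnth_mktuple; have := h (s i); rewrite Cs.
transitivity (\prod_(j < n) mu (C j))%E.
  by apply: power_rect => j; rewrite /C; case: pickP.
rewrite (bigID (fun j => j \in s @: [set: 'I_m]%SET))/= [X in (_ * X)%E]big1 ?mule1.
  rewrite big_imset/=; last by move=> ? ? _ _; exact: sI.
  by apply: eq_big => i; rewrite ?inE ?Cs.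
move=> j jN; rewrite /C; case: pickP => // i /eqP ij.
by rewrite -ij imset_f ?inE in jN.
Qed.

Lemma ge0_integral_sel m n (s : 'I_m -> 'I_n) (f : m.-tuple T -> \bar R) :
  injective s -> measurable_fun setT f -> (forall x, 0 <= f x)%E ->
  (\int[power_measure mu m]_x f x = \int[power_measure mu n]_x f (sel s x))%E.
Proof.
move=> sI mf f0; apply: ge0_integral_law => //; first exact: (measurable_sel s).
by move=> B mB; exact: power_sel_rect.
Qed.

Lemma expect_sel m n (s : 'I_m -> 'I_n) (f : m.-tuple T -> R) :
  injective s -> bfun f ->
  \int[power_measure mu m]_x f x = \int[power_measure mu n]_x f (sel s x).
Proof.
move=> sI bf; apply: expect_law => //; first exact: (measurable_sel s).
by move=> B mB; exact: power_sel_rect.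
Qed.

Lemma expect_tnth n (i : 'I_n) (f : T -> R) : bfun f ->
  \int[power_measure mu n]_x f (tnth x i) = \int[mu]_y f y.
Proof.
move=> bf; rewrite (expect_upd i); last by apply: bfun_comp bf _; exact: measurable_tnth.
rewrite expect_prodr//; last first.
  apply: (bfun_comp (f := fun x => f (tnth x i)) (g := fun w => upd w.1 i w.2)).
    by apply: bfun_comp bf _; exact: measurable_tnth.
  exact: measurable_upd.
rewrite -[RHS](expect_cst (mu := power_measure mu n))//.
apply: eq_Rintegral => x _; apply: eq_Rintegral => y _.
by rewrite tnth_mktuple eqxx.
Qed.

Definition depends n (A : pred 'I_n) (f : n.-tuple T -> R) :=
  forall x y, (forall i, A i -> tnth x i = tnth y i) -> f x = f y.

Lemma expect_indep n (A : pred 'I_n) (f g : n.-tuple T -> R) :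
  bfun f -> bfun g -> depends A f -> depends (predC A) g ->
  \int[power_measure mu n]_x (f x * g x) =
  \int[power_measure mu n]_x f x * \int[power_measure mu n]_x g x.
Proof.
move=> bf bg fA gA.
have fm w : f (merge A w) = f w.1.
  by apply: fA => i Ai; rewrite tnth_mktuple Ai.
have gm w : g (merge A w) = g w.2.
  by apply: gA => i /negbTE Ai; rewrite tnth_mktuple Ai.
have bfm : bfun (fun w : n.-tuple T * n.-tuple T => f w.1) by exact: bfun_comp.
have bgm : bfun (fun w : n.-tuple T * n.-tuple T => g w.2) by exact: bfun_comp.
rewrite (expect_merge A); last exact: bfunM.
rewrite [LHS](@eq_Rintegral _ _ _ _ _ (fun w => f w.1 * g w.2)); last first.
  by move=> w _; rewrite fm gm.
rewrite expect_prodr//; last exact: bfunM.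
rewrite -expectZr//; apply: eq_Rintegral => x _ /=.
by rewrite expectZl.
Qed.

(** Two functions that share a single coordinate are independent once it is fixed. *)
Lemma expect_indep1 n (A B : pred 'I_n) v (f g : n.-tuple T -> R) :
  bfun f -> bfun g -> depends A f -> depends B g ->
  (forall i, A i -> B i -> i = v) ->
  \int[power_measure mu n]_x (f x * g x) =
  \int[mu]_y ((\int[power_measure mu n]_x f (upd x v y)) *
              (\int[power_measure mu n]_x g (upd x v y))).
Proof.
move=> bf bg fA gA AB.
rewrite (expect_upd v); last exact: bfunM.
rewrite expect_prodl//; last first.
  by apply: (bfun_comp (f := fun x => f x * g x)); [exact: bfunM|exact: measurable_upd].
apply: eq_Rintegral => y _ /=.
apply: (@expect_indep _ (fun i => A i && (i != v))).
- by apply: bfun_comp bf _; exact: measurable_updl.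
- by apply: bfun_comp bg _; exact: measurable_updl.
- move=> x x' h; apply: fA => i Ai; rewrite !tnth_mktuple.
  by case: eqP => // /eqP iv; apply: h; rewrite Ai.
- move=> x x' h; apply: gA => i Bi; rewrite !tnth_mktuple.
  case: eqP => // iv; apply: h => /=.
  by apply/negP => /andP[Ai _]; apply: iv; exact: AB.
Qed.

Lemma expect_sel2 m1 m2 n (s1 : 'I_m1 -> 'I_n) (s2 : 'I_m2 -> 'I_n)
    (G : m1.-tuple T * m2.-tuple T -> R) :
  injective s1 -> injective s2 -> (forall i j, s1 i != s2 j) -> bfun G ->
  \int[power_measure mu n]_x G (sel s1 x, sel s2 x) =
  \int[power_measure mu m1]_z \int[power_measure mu m2]_z' G (z, z').
Proof.
move=> i1 i2 s12 bG.
have mp : measurable_fun setT (fun x : n.-tuple T => (sel s1 x, sel s2 x)).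
  by apply: measurable_fun_pair; exact: measurable_sel.
rewrite (expect_merge [pred i | i \in codom s1]); last exact: bfun_comp bG mp.
have bG2 : bfun (fun w : n.-tuple T * n.-tuple T => G (sel s1 w.1, sel s2 w.2)).
  apply: bfun_comp bG _; apply: measurable_fun_pair;
  by apply: measurableT_comp => //; exact: measurable_sel.
rewrite [LHS](@eq_Rintegral _ _ _ _ _ (fun w => G (sel s1 w.1, sel s2 w.2))); last first.
  move=> w _; congr (G (_, _)); apply: eq_from_tnth => i; rewrite !tnth_mktuple /=.
    by rewrite codom_f.
  case: ifPn => // /codomP[j /eqP]; by rewrite eq_sym (negbTE (s12 _ _)).
rewrite expect_prodr//= (expect_sel i1); last exact: bfun_expectr.
apply: eq_Rintegral => x _; rewrite (expect_sel i2)//.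
exact: bfun_pairr.
Qed.

End coords.

(** * The second moment of the centred U-statistic *)

Lemma sum_sqr_le (R : realFieldType) (I : finType) (x : I -> R) :
  (\sum_i x i) ^+ 2 <= #|I|%:R * \sum_i x i ^+ 2.
Proof.
have -> : (\sum_i x i) ^+ 2 = \sum_i \sum_j x i * x j.
  by rewrite expr2 mulr_suml; apply: eq_bigr => i _; rewrite mulr_sumr.
have -> : #|I|%:R * \sum_i x i ^+ 2 =
    \sum_i \sum_j (2^-1 * x i ^+ 2 + 2^-1 * x j ^+ 2).
  under [RHS]eq_bigr do rewrite big_split /= sumr_const -mulr_sumr.
  rewrite big_split /= sumr_const sumrMnl -mulr_sumr -mulrnDl.
  rewrite -mulrDl (_ : 2^-1 + 2^-1 = 1 :> R) ?mul1r ?mulr_natl//.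
  by field.
apply: ler_sum => i _; apply: ler_sum => j _.
by have := sqr_ge0 (x i - x j); nra.
Qed.

Section laws.
Context d (T : measurableType d) (R : realType).
Variable mu : {sigma_finite_measure set T -> \bar R}.
Hypothesis mu1 : mu setT = 1%E.

Lemma ord1_inj (I : Type) (f : 'I_1 -> I) : injective f.
Proof. by move=> i j _; rewrite !ord1. Qed.

Lemma expect_tnth_sel n m (i : 'I_n) (s : 'I_m -> 'I_n)
    (G : m.-tuple T * T -> R) :
  injective s -> (forall l, s l != i) -> bfun G ->
  \int[power_measure mu n]_x G (sel s x, tnth x i) =
  \int[power_measure mu m]_z \int[mu]_u G (z, u).
Proof.
move=> sI si bG.
have bG' : bfun (fun w : m.-tuple T * 1.-tuple T => G (w.1, tnth w.2 ord0)).
  apply: bfun_comp bG _; apply: measurable_fun_pair => //.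
  by apply: measurableT_comp (measurable_tnth _) _.
transitivity (\int[power_measure mu n]_x
  (fun w : m.-tuple T * 1.-tuple T => G (w.1, tnth w.2 ord0)) (sel s x, sel (fun=> i) x)).
  by apply: eq_Rintegral => x _ /=; rewrite !tnth_mktuple.
apply: (eq_trans (expect_sel2 mu1 sI (@ord1_inj _ _) _ bG')) => [l ?//|].
apply: eq_Rintegral => z _ /=.
rewrite (expect_tnth mu1 ord0 (f := fun u => G (z, u)))//.
exact: bfun_pairr.
Qed.

Lemma expect_tnth2 n (i j : 'I_n) (G : T * T -> R) :
  i != j -> bfun G ->
  \int[power_measure mu n]_x G (tnth x i, tnth x j) = \int[mu]_x \int[mu]_u G (x, u).
Proof.
move=> ij bG.
have bG' : bfun (fun w : 1.-tuple T * T => G (tnth w.1 ord0, w.2)).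
  apply: bfun_comp bG _; apply: measurable_fun_pair => //.
  by apply: measurableT_comp (measurable_tnth _) _.
transitivity (\int[power_measure mu n]_x
  (fun w : 1.-tuple T * T => G (tnth w.1 ord0, w.2)) (sel (fun=> i) x, tnth x j)).
  by apply: eq_Rintegral => x _ /=; rewrite !tnth_mktuple.
apply: (eq_trans (expect_tnth_sel (@ord1_inj _ _) _ bG')) => [l //|] /=.
rewrite (expect_tnth mu1 ord0 (f := fun x => \int[mu]_u G (x, u)))//.
exact: bfun_expectr.
Qed.

Lemma expect_prod_tnth n (g : 'I_n -> T -> R) : (forall i, bfun (g i)) ->
  \int[power_measure mu n]_x (\prod_(i < n) g i (tnth x i)) = \prod_(i < n) \int[mu]_y g i y.
Proof.
move=> bg.
have bgt i : bfun (fun x : n.-tuple T => g i (tnth x i)).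
  by apply: bfun_comp (bg i) _; exact: measurable_tnth.
suff h (s : seq 'I_n) : uniq s ->
    \int[power_measure mu n]_x (\prod_(i <- s) g i (tnth x i)) = \prod_(i <- s) \int[mu]_y g i y.
  by rewrite -(h _ (index_enum_uniq _)).
elim: s => [_|i s ih /= /andP[is_ us]].
  by under eq_Rintegral do rewrite big_nil; rewrite big_nil expect_cst.
under eq_Rintegral do rewrite big_cons.
rewrite big_cons -ih// -(expect_tnth mu1 i)//.
apply: (expect_indep mu1 (A := pred1 i)) => //.
- exact: bfun_prod.
- by move=> x y xy; congr g; apply: xy => /=.
- move=> x y xy; rewrite !big_seq; apply: eq_bigr => j js; congr g; apply: xy => /=.
  by apply: contraNneq is_ => <-.
Qed.

End laws.

Lemma expect_prod_le d (T : measurableType d) (R : realType)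
    (mu : {measure set T -> \bar R}) (f g : T -> R) K :
  mu setT = 1%E -> bfun f -> bfun g ->
  \int[mu]_x f x ^+ 2 <= K -> \int[mu]_x g x ^+ 2 <= K -> `|\int[mu]_x (f x * g x)| <= K.
Proof.
move=> mu1 bf bg fK gK.
have b2 : bfun (fun x => f x ^+ 2) by exact: bfunX.
have b2g : bfun (fun x => g x ^+ 2) by exact: bfunX.
have bp : bfun (fun x => f x * g x) by exact: bfunM.
have bs : bfun (fun x => 2^-1 * (f x ^+ 2 + g x ^+ 2)).
  by apply: bfunM; [exact: bfun_cst|exact: bfunD].
have sK : \int[mu]_x (2^-1 * (f x ^+ 2 + g x ^+ 2)) <= K.
  by rewrite expectZl ?expectD//; [lra|exact: bfunD].
have u : \int[mu]_x (f x * g x) <= \int[mu]_x (2^-1 * (f x ^+ 2 + g x ^+ 2)).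
  by apply: le_expect => // x; have := sqr_ge0 (f x - g x); nra.
have l : \int[mu]_x (- 1 * (f x * g x)) <= \int[mu]_x (2^-1 * (f x ^+ 2 + g x ^+ 2)).
  apply: le_expect => //; first by apply: bfunM => //; exact: bfun_cst.
  by move=> x; have := sqr_ge0 (f x + g x); nra.
move: l; rewrite expectZl// => l; rewrite ler_norml; apply/andP; split; lra.
Qed.

Section variance.
Context dd (T : measurableType dd) (R : realType).
Variable P : {sigma_finite_measure set T -> \bar R}.
Hypothesis P1 : P setT = 1%E.
Variables (d n : nat) (hd : (1 < d)%N) (hn : (2 * d <= n)%N).
Local Notation w := (widen_ord hn).
Variable kk : 'I_d -> T -> T -> R.
Hypothesis bkk : forall j, bfun (fun w : T * T => kk j w.1 w.2).
Hypothesis kksym : forall j x y, kk j x y = kk j y x.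
Variable mix : d.-tuple T -> T.
Hypothesis mmix : measurable_fun setT mix.
Hypothesis kkmix : forall j z x, kk j (mix z) x = kk j (tnth z j) x.

Variable k : T -> T -> R.
Hypothesis kE : forall x y, k x y = \prod_(j < d) kk j x y.

Let kf x := \int[P]_u k x u.
Let kq x := \int[power_measure P d]_z k x (mix z).
Let kpsi x := kf x - kq x.

(** The energy [<psi, k psi>] of the signed measure [psi], the difference of the law [P] and of
    the law of [mix]; [kpsi] is its image under the kernel. *)
Definition hsic := \int[P]_x kpsi x - \int[power_measure P d]_z kpsi (mix z).

Let ksym x y : k x y = k y x.
Proof. by rewrite !kE; apply: eq_bigr => j _; rewrite kksym. Qed.

Let bk dO (O : measurableType dO) (a b : O -> T) :
  measurable_fun setT a -> measurable_fun setT b -> bfun (fun o => k (a o) (b o)).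
Proof.
move=> ma mb; rewrite (_ : (fun o => _) = fun o => \prod_(j < d) kk j (a o) (b o)); last first.
  by apply/funext => o; exact: kE.
apply: bfun_prod => j _.
by apply: (bfun_comp (g := fun o => (a o, b o)) (bkk j)); exact: measurable_fun_pair.
Qed.

Let bkf : bfun kf.
Proof. by apply: (bfun_expectr P1 (f := fun w => k w.1 w.2)); exact: bk. Qed.

Let bkq : bfun kq.
Proof.
apply: (bfun_expectr _ (f := fun w : T * d.-tuple T => k w.1 (mix w.2))) => //.
by apply: bk => //; exact: measurableT_comp.
Qed.

Let bkpsi : bfun kpsi. Proof. exact: bfunB. Qed.

Let hker (x : n.-tuple T) (s : 'S_n) : R :=
  ustat_kernel hd hn (fun j a b => kk j (tnth x a) (tnth x b)) s.

Let tm (t : term) (x : n.-tuple T) : R :=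
  \prod_(j < d) kk j (tnth x (w (ea hd t j))) (tnth x (w (eb hd t j))).

Let btm t : bfun (tm t).
Proof.
apply: bfun_prod => j _.
apply: (bfun_comp (g := fun x : n.-tuple T => (tnth x _, tnth x _)) (bkk j)).
by apply: measurable_fun_pair; exact: measurable_tnth.
Qed.

Let h x := \sum_t coef R t * tm t x.

Let hkerE x s : hker x s = h (sel s x).
Proof.
apply: eq_bigr => t _; congr (_ * _); apply: eq_bigr => j _.
by rewrite !tnth_mktuple.
Qed.

Let bh : bfun h.
Proof. by apply: bfun_sum => t _; apply: bfunM => //; exact: bfun_cst. Qed.

Let F x := h x - hsic.

Let bF : bfun F. Proof. by apply: bfunB => //; exact: bfun_cst. Qed.

Let zA (x : n.-tuple T) := sel (fun j => w (pos_odd j)) x : d.-tuple T.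
Let zB (x : n.-tuple T) := sel (fun j => w (pos_even j)) x : d.-tuple T.
Let zC (x : n.-tuple T) := sel (fun j => w (pstar hd j)) x : d.-tuple T.
Let w0 := w (pzero hd).
Let w1 := w (pone hd).

Let tmA x : tm tA x = k (tnth x w0) (tnth x w1). Proof. by rewrite kE. Qed.
Let tmB x : tm tB x = k (mix (zA x)) (mix (zB x)).
Proof.
rewrite /tm kE; apply: eq_bigr => j _; rewrite [RHS]kkmix [RHS]kksym [RHS]kkmix [RHS]kksym.
by rewrite /zA /zB !tnth_mktuple.
Qed.
Let tmC x : tm tC x = k (tnth x w0) (mix (zC x)).
Proof.
by rewrite kE; apply: eq_bigr => j _; rewrite [RHS]kksym kkmix kksym /zC !tnth_mktuple.
Qed.

Let odd_inj : injective (fun j : 'I_d => w (pos_odd j)).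
Proof. by move=> i j /widen_inj /pos_odd_inj. Qed.
Let even_inj : injective (fun j : 'I_d => w (pos_even j)).
Proof. by move=> i j /widen_inj /pos_even_inj. Qed.
Let star_inj : injective (fun j : 'I_d => w (pstar hd j)).
Proof. by move=> i j /widen_inj /pstar_inj. Qed.
Let weq a b : (w a == w b) = (a == b). Proof. exact/inj_eq/widen_inj. Qed.

Section term_laws.
(* The identity is used for the mean of the statistic and the square for its second moment. *)
Variable phi : R -> R.
Hypothesis bphi : forall dO (O : measurableType dO) (f : O -> R), bfun f -> bfun (fun o => phi (f o)).

Let lawA : \int[power_measure P n]_x phi (tm tA x) = \int[P]_x \int[P]_u phi (k x u).
Proof.
have bG : bfun (fun w : T * T => phi (k w.1 w.2)) by apply: bphi; exact: bk.
have w01 : w0 != w1 by rewrite weq.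
under eq_Rintegral do rewrite tmA.
exact: (expect_tnth2 P1 w01 bG).
Qed.

Let lawB : \int[power_measure P n]_x phi (tm tB x) =
  \int[power_measure P d]_z \int[power_measure P d]_z' phi (k (mix z) (mix z')).
Proof.
under eq_Rintegral do rewrite tmB.
apply: (expect_sel2 P1 odd_inj even_inj (G := fun w => phi (k (mix w.1) (mix w.2)))).
  by move=> i j; rewrite weq pos_odd_even.
by apply: bphi; apply: bk; exact: measurableT_comp.
Qed.

Let lawC : \int[power_measure P n]_x phi (tm tC x) =
  \int[power_measure P d]_z \int[P]_u phi (k (mix z) u).
Proof.
under eq_Rintegral do rewrite tmC ksym.
apply: (expect_tnth_sel P1 star_inj (G := fun w => phi (k (mix w.1) w.2))).
  by move=> l; rewrite weq eq_sym pzero_pstar.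
by apply: bphi; apply: bk => //; exact: measurableT_comp.
Qed.

Definition term_laws := (lawA, lawB, lawC).

End term_laws.

Let mu_n := power_measure P n.

(** Expanding the energy gives the three terms, since [kk j] sees [mix z] only through
    the [j]-th entry of [z]. *)
Lemma expect_ustat_kernel : \int[mu_n]_x h x = hsic.
Proof.
rewrite expect_sum; [|prob1|]; last by move=> t _; apply: bfunM => //; exact: bfun_cst.
under eq_bigr do rewrite expectZl//.
rewrite sum_coef.
have [[lA lB] lC] := term_laws (phi := id) (fun _ _ _ bf => bf).
rewrite [X in X + _ - _]lA [X in _ + X - _]lB [X in _ - 2 * X]lC.
have bkfm : bfun (fun z => kf (mix z)) by exact: (bfun_comp bkf mmix).
have bkqm : bfun (fun z => kq (mix z)) by exact: (bfun_comp bkq mmix).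
rewrite /hsic /kpsi expectB// expectB//.
rewrite -[X in X + _ - _]/(\int[P]_x kf x).
rewrite -[X in _ + X - _]/(\int[power_measure P d]_z kq (mix z)).
rewrite -[X in _ - 2 * X]/(\int[power_measure P d]_z kf (mix z)).
have -> : \int[P]_x kq x = \int[power_measure P d]_z kf (mix z); last by lra.
rewrite /kq /kf.
rewrite (expect_swap P1 _ (f := fun w => k w.1 (mix w.2)))//.
  by apply: eq_Rintegral => z _; apply: eq_Rintegral => x _; rewrite ksym.
by apply: bk => //; exact: measurableT_comp.
Qed.

Let EF0 : \int[mu_n]_x F x = 0.
Proof.
rewrite /F expectB//; last exact: bfun_cst.
by rewrite expect_cst// expect_ustat_kernel subrr.
Qed.

Variable Q : R.
Hypothesis QA : \int[P]_x \int[P]_u k x u ^+ 2 <= Q.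
Hypothesis QB : \int[power_measure P d]_z \int[power_measure P d]_z' k (mix z) (mix z') ^+ 2 <= Q.
Hypothesis QC : \int[power_measure P d]_z \int[P]_u k (mix z) u ^+ 2 <= Q.

(** The square of [a + b - 2 c] is at most [3 (a^2 + b^2 + 4 c^2)], which is where
    [18 = 3 (1 + 1 + 4)] comes from. *)
Lemma expect_F2 : \int[mu_n]_x F x ^+ 2 <= 18 * Q.
Proof.
apply: (@le_trans _ _ (\int[mu_n]_x h x ^+ 2)).
  apply: (expect_center_le _ (c := - hsic)) => //.
have [[lA lB] lC] := term_laws (phi := fun x => x ^+ 2) (fun _ _ _ bf => bfunX 2 bf).
apply: (@le_trans _ _ (\int[mu_n]_x (3 * (tm tA x ^+ 2 + tm tB x ^+ 2 + 4 * tm tC x ^+ 2)))).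
  apply: le_expect => //.
  - exact: bfunX.
  - apply: bfunM; first exact: bfun_cst.
    apply: bfunD; first by apply: bfunD; exact: bfunX.
    by apply: bfunM; [exact: bfun_cst|exact: bfunX].
  - move=> x; rewrite /h sum_coef.
    move: (tm tA x) (tm tB x) (tm tC x) => a b c.
    have := sqr_ge0 (a - b); have := sqr_ge0 (a + 2 * c); have := sqr_ge0 (b + 2 * c).
    by nra.
rewrite expectZl//; last first.
  apply: bfunD; first by apply: bfunD; exact: bfunX.
  by apply: bfunM; [exact: bfun_cst|exact: bfunX].
rewrite expectD//; [|by apply: bfunD; exact: bfunX|by apply: bfunM; [exact: bfun_cst|exact: bfunX]].
rewrite expectD//; [|exact: bfunX|exact: bfunX].
rewrite expectZl//; last exact: bfunX.
have hA : \int[mu_n]_x tm tA x ^+ 2 <= Q by apply: le_trans QA; rewrite -lA.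
have hB : \int[mu_n]_x tm tB x ^+ 2 <= Q by apply: le_trans QB; rewrite -lB.
have hC : \int[mu_n]_x tm tC x ^+ 2 <= Q by apply: le_trans QC; rewrite -lC.
lra.
Qed.

(* The projection of the centred kernel on the entry at position [v]. *)
Let g (v : 'I_(2 * d)) (y : T) := \int[mu_n]_x F (upd x (w v) y).

Let bupd v : bfun (fun a : n.-tuple T * T => F (upd a.1 v a.2)).
Proof. by apply: bfun_comp bF _; exact: measurable_upd. Qed.

Let bg v : bfun (g v).
Proof. exact: (bfun_expectl _ (bupd (w v))). Qed.

Let g2 v : \int[P]_y g v y ^+ 2 <= \int[mu_n]_x F x ^+ 2.
Proof.
rewrite (expect_upd P1 (w v)); last exact: bfunX.
rewrite expect_prodl//; last by apply: bfunX; exact: bupd.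
apply: le_expect => //.
- exact: bfunX.
- by apply: (bfun_expectl _ (f := fun a => F (upd a.1 (w v) a.2) ^+ 2)) => //; exact: bfunX.
- move=> y; apply: expect_sqr_le => //.
  exact: (bfun_pairl y (bupd (w v))).
Qed.

(* The derivative of the energy in the direction of a point mass at [y]: one term for [P], one
   for each entry of [z] in the law of [mix]. *)
Let Y y := 2 * kpsi y - 2 * \sum_(j < d) \int[power_measure P d]_z kpsi (mix (upd z j y)).

Let bmu j : bfun (fun a : d.-tuple T * T => kpsi (mix (upd a.1 j a.2))).
Proof.
apply: (bfun_comp (g := fun a => mix (upd a.1 j a.2)) bkpsi).
by apply: (measurableT_comp mmix); exact: measurable_upd.
Qed.

Let bY : bfun Y.
Proof.
apply: bfunB; first by apply: bfunM => //; exact: bfun_cst.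
apply: bfunM; first exact: bfun_cst.
by apply: bfun_sum => j _; exact: (bfun_expectl _ (bmu j)).
Qed.

Let upd_sel m (s : 'I_m -> 'I_n) x j y : injective s ->
  sel s (upd x (s j) y) = upd (sel s x) j y :> m.-tuple T.
Proof.
move=> sI; apply: eq_from_tnth => i; rewrite !tnth_mktuple.
by rewrite (inj_eq sI).
Qed.

Let upd_sel_out m (s : 'I_m -> 'I_n) x a y : (forall i, s i != a) ->
  sel s (upd x a y) = sel s x :> m.-tuple T.
Proof.
move=> sa; apply: eq_from_tnth => i; rewrite !tnth_mktuple.
by rewrite (negbTE (sa _)).
Qed.

Let gE v y : g v y = \sum_t coef R t * (\int[mu_n]_x tm t (upd x (w v) y)) - hsic.
Proof.
have bt t : bfun (fun x => tm t (upd x (w v) y)).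
  by apply: bfun_comp (btm t) _; exact: measurable_updl.
rewrite /g /F expectB//; [|by apply: bfun_sum => t _; apply: bfunM => //; exact: bfun_cst|exact: bfun_cst].
rewrite expect_cst// expect_sum//; last by move=> t _; apply: bfunM => //; exact: bfun_cst.
by congr (_ - _); apply: eq_bigr => t _; rewrite expectZl.
Qed.

Let updE (x : n.-tuple T) i y j : tnth (upd x i y) j = if j == i then y else tnth x j.
Proof. by rewrite tnth_mktuple. Qed.

Let sum_g : exists c, forall y, \sum_v g v y = Y y + c.
Proof.
pose a0 := \int[mu_n]_x k (tnth x w0) (tnth x w1).
pose g0 := \int[mu_n]_x k (tnth x w0) (mix (zC x)).
exists (2 * (d - 1)%:R * (a0 - g0) - (2 * d)%:R * hsic) => y.
under eq_bigr do rewrite gE.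
rewrite sumrB sumr_const card_ord -[hsic *+ _]mulr_natl.
pose b j := \int[power_measure P d]_z kq (mix (upd z j y)).
pose e j := \int[power_measure P d]_z kf (mix (upd z j y)).
have bm j : measurable_fun setT (fun z : d.-tuple T => mix (upd z j y)).
  by apply: measurableT_comp mmix _; exact: measurable_updl.
rewrite (@sum_vertices _ _ hd (fun t v => \int[mu_n]_x tm t (upd x (w v) y))
  (kf y) a0 b (kq y) g0 e).
- rewrite /Y.
  have -> : \sum_(j < d) \int[power_measure P d]_z kpsi (mix (upd z j y)) =
      \sum_(j < d) (e j - b j).
    by apply: eq_bigr => j _; rewrite /kpsi expectB//; exact: (bfun_comp _ (bm j)).
  by rewrite sumrB /kpsi; ring.
- transitivity (\int[mu_n]_x k y (tnth x w1)).
    by apply: eq_Rintegral => x _; rewrite tmA !updE eqxx weq.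
  apply: (expect_tnth P1 w1 (f := fun u => k y u)).
  by apply: bk.
- transitivity (\int[mu_n]_x k y (tnth x w0)).
    by apply: eq_Rintegral => x _; rewrite tmA !updE eqxx weq /= ksym.
  apply: (expect_tnth P1 w0 (f := fun u => k y u)).
  by apply: bk.
- move=> v v0 v1; apply: eq_Rintegral => x _.
  by rewrite tmA !updE !weq ![_ == v]eq_sym (negbTE v0) (negbTE v1).
- move=> j; transitivity (\int[mu_n]_x k (mix (upd (zA x) j y)) (mix (zB x))).
    apply: eq_Rintegral => x _; rewrite tmB /zA (upd_sel _ _ _ odd_inj) /zB upd_sel_out//.
    by move=> i; rewrite weq eq_sym pos_odd_even.
  apply: (expect_sel2 P1 odd_inj even_inj (G := fun a => k (mix (upd a.1 j y)) (mix a.2))).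
    by move=> i l; rewrite weq pos_odd_even.
  apply: bk; last exact: measurableT_comp.
  exact: (measurableT_comp (bm j)).
- move=> j; transitivity (\int[mu_n]_x k (mix (upd (zB x) j y)) (mix (zA x))).
    apply: eq_Rintegral => x _; rewrite tmB /zB (upd_sel _ _ _ even_inj) /zA upd_sel_out//.
    by move=> i; rewrite weq pos_odd_even.
  apply: (expect_sel2 P1 even_inj odd_inj (G := fun a => k (mix (upd a.1 j y)) (mix a.2))).
    by move=> i l; rewrite weq eq_sym pos_odd_even.
  apply: bk; last exact: measurableT_comp.
  exact: (measurableT_comp (bm j)).
- transitivity (\int[mu_n]_x k y (mix (zC x))).
    by apply: eq_Rintegral => x _; rewrite tmC updE eqxx /zC upd_sel_out.
  rewrite -[RHS]/(\int[power_measure P d]_z k y (mix z)).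
  rewrite [RHS](expect_sel P1 star_inj)//.
  by apply: bk.
- move=> j; transitivity (\int[mu_n]_x k (mix (upd (zC x) j y)) (tnth x w0)).
    apply: eq_Rintegral => x _; rewrite tmC updE /w0 weq (negbTE (pzero_pstar _ _)).
    by rewrite /zC (upd_sel _ _ _ star_inj) ksym.
  apply: (expect_tnth_sel P1 star_inj (G := fun a => k (mix (upd a.1 j y)) a.2)).
    by move=> l; rewrite weq eq_sym pzero_pstar.
  apply: bk => //; exact: (measurableT_comp (bm j)).
- move=> v v0 vN; apply: eq_Rintegral => x _.
  rewrite tmC updE weq eq_sym (negbTE v0) /zC upd_sel_out// => i.
  by rewrite weq eq_sym.
Qed.

(** Cauchy and Schwarz over the [d.+1] terms of [Y], then Jensen for the resampled entries. *)
Lemma expect_Y2 : \int[P]_y Y y ^+ 2 <= 4 * d.+1%:R *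
  (\int[P]_x kpsi x ^+ 2 + d%:R * \int[power_measure P d]_z kpsi (mix z) ^+ 2).
Proof.
pose G j y := \int[power_measure P d]_z kpsi (mix (upd z j y)).
have bG j : bfun (G j) by exact: (bfun_expectl _ (bmu j)).
have pw y : Y y ^+ 2 <= 4 * d.+1%:R * (kpsi y ^+ 2 + \sum_(j < d) G j y ^+ 2).
  pose a (i : 'I_d.+1) := if unlift ord0 i is Some j then - G j y else kpsi y.
  have a0 : a ord0 = kpsi y by rewrite /a unlift_none.
  have aS j : a (lift ord0 j) = - G j y by rewrite /a liftK.
  have := sum_sqr_le a; rewrite card_ord !big_ord_recl a0.
  under eq_bigr do rewrite aS; under [in X in _ <= X]eq_bigr do rewrite aS sqrrN.
  rewrite sumrN => hs.
  have -> : Y y ^+ 2 = 4 * (kpsi y - \sum_(j < d) G j y) ^+ 2 by rewrite /Y; ring.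
  by rewrite -mulrA ler_pM2l.
apply: (le_trans (le_expect _ _ _ pw)) => //.
- exact: bfunX.
- apply: bfunM; first exact: bfun_cst.
  by apply: bfunD; [exact: bfunX|apply: bfun_sum => j _; exact: bfunX].
rewrite expectZl//; last by apply: bfunD; [exact: bfunX|apply: bfun_sum => j _; exact: bfunX].
rewrite ler_wpM2l ?mulr_ge0//.
rewrite expectD//; [|exact: bfunX|by apply: bfun_sum => j _; exact: bfunX].
rewrite lerD2l expect_sum//; last by move=> j _; exact: bfunX.
apply: (@le_trans _ _ (\sum_(j < d) \int[power_measure P d]_z kpsi (mix z) ^+ 2));
  last by rewrite sumr_const card_ord mulr_natl.
apply: ler_sum => j _.
have bm2 : bfun (fun z => kpsi (mix z) ^+ 2) by apply: bfunX; exact: bfun_comp.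
rewrite (expect_upd P1 j (f := fun z => kpsi (mix z) ^+ 2))//.
rewrite expect_prodl//; last by apply: bfunX; exact: bmu.
apply: le_expect => //.
- exact: bfunX.
- by apply: (bfun_expectl _ (f := fun a => kpsi (mix (upd a.1 j a.2)) ^+ 2)) => //; apply: bfunX; exact: bmu.
- move=> y; apply: expect_sqr_le => //.
  exact: (bfun_pairl y (bmu j)).
Qed.

Let Fs (s : 'S_n) x := F (sel s x).

Let bFs s : bfun (Fs s).
Proof. by apply: bfun_comp bF _; exact: measurable_sel. Qed.

(* The correlation of the kernel with its copy on the permuted window. *)
Let Rf s := \int[mu_n]_x (F x * Fs s x).

Let depF : depends [pred i | i \in codom w] F.
Proof.
move=> x y xy; rewrite /F /h; congr (_ - _); apply: eq_bigr => t _; congr (_ * _).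
by apply: eq_bigr => j _; congr kk; apply: xy => /=; exact: codom_f.
Qed.

Let depFs (s : 'S_n) : depends [pred i | i \in codom (fun v => s (w v))] (Fs s).
Proof.
move=> x y xy; apply: depF => _ /codomP[v ->]; rewrite !tnth_mktuple.
by apply: xy => /=; apply/codomP; exists v.
Qed.

(** The variance is the average of [Rf] over all permutations.  Single overlaps contribute
    [1 / n] times the second moment of the sum of the projections, which is [Y] up to a constant
    and is controlled by the second moments of [kpsi]; all other overlaps contribute the second
    moment of the kernel times [n ^ -2]. *)
Lemma ustat_variance :
  \int[mu_n]_x (ustat hd hn (fun j a b => kk j (tnth x a) (tnth x b)) - hsic) ^+ 2 <=
  n%:R^-1 * (4 * d.+1%:R *
  (\int[P]_x kpsi x ^+ 2 + d%:R * \int[power_measure P d]_z kpsi (mix z) ^+ 2))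
  + (1 + (2 * d) ^ 2)%:R * ((2 * d) ^ 4)%:R * (18 * Q) * 2 / n%:R ^+ 2.
Proof.
have n1 : (1 < n)%N by apply: leq_trans hn; exact: pone_subproof.
have -> : \int[mu_n]_x (ustat hd hn (fun j a b => kk j (tnth x a) (tnth x b)) - hsic) ^+ 2
    = pavg Rf.
  transitivity (\int[mu_n]_x (n`!%:R^-1 * \sum_(s : 'S_n) (n`!%:R^-1 *
      \sum_(s' : 'S_n) (Fs s x * Fs s' x)))).
    apply: eq_Rintegral => x _.
    have -> : ustat hd hn (fun j a b => kk j (tnth x a) (tnth x b)) - hsic = pavg (Fs^~ x).
      rewrite /ustat -[hsic](@pavg_cst R n) -pavgB; apply: eq_pavg => s.
      by rewrite -[LHS]/(hker x s - hsic) hkerE.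
    rewrite expr2 {1}/pavg -!/(pavg _) -pavgZr; apply: eq_pavg => s.
    by rewrite -pavgZl.
  have bFF s s' : bfun (fun x => Fs s x * Fs s' x) by exact: bfunM.
  have bsF s : bfun (fun x => n`!%:R^-1 * \sum_(s' : 'S_n) (Fs s x * Fs s' x)).
    by apply: bfunM; [exact: bfun_cst|apply: bfun_sum => s' _].
  rewrite expectZl//; last by apply: bfun_sum => s _.
  rewrite expect_sum// -[LHS]/(pavg _) -[RHS](@pavg_cst R n); apply: eq_pavg => s.
  rewrite expectZl//; last by apply: bfun_sum => s' _.
  rewrite expect_sum// -[LHS]/(pavg _) -[RHS](pavg_mulr (s^-1)%g); apply: eq_pavg => s'.
  rewrite /Rf [RHS](expect_sel P1 (s := s) (@perm_inj _ s)); last exact: bfunM.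
  apply: eq_Rintegral => x _; congr (_ * _); rewrite /Fs; congr F.
  by apply: eq_from_tnth => i; rewrite !tnth_mktuple permM permKV.
pose r v v' := \int[P]_y (g v y * g v' y).
have sum_r : \sum_v \sum_v' r v v' <= \int[P]_y Y y ^+ 2.
  have -> : \sum_v \sum_v' r v v' = \int[P]_y (\sum_v g v y) ^+ 2.
    transitivity (\int[P]_y (\sum_v \sum_v' g v y * g v' y)).
      rewrite expect_sum//; last by move=> v _; apply: bfun_sum => v' _; exact: bfunM.
      apply: eq_bigr => v _; rewrite expect_sum// => v' _; exact: bfunM.
    apply: eq_Rintegral => y _; rewrite expr2 mulr_suml; apply: eq_bigr => v _.
    by rewrite mulr_sumr.
  have [c cE] := sum_g.
  under eq_Rintegral do rewrite cE.
  apply: expect_center_le => //.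
  under eq_Rintegral do rewrite -cE.
  rewrite expect_sum// big1// => v _.
  by rewrite -EF0 (expect_upd P1 (w v) bF) [RHS]expect_prodl.
have FF s : `|Rf s| <= \int[mu_n]_x F x ^+ 2.
  have e : \int[mu_n]_x Fs s x ^+ 2 = \int[mu_n]_x F x ^+ 2.
    rewrite [RHS](expect_sel P1 (s := s) (@perm_inj _ s))//; exact: bfunX.
  apply: expect_prod_le => //; by rewrite e.
have n0 : 0 <= n%:R^-1 :> R by rewrite invr_ge0.
apply: (le_trans (@overlap_average R n (2 * d) _ (@widen_inj d n hn) n1 Rf r _ _ _ FF _)).
- move=> s no; rewrite /Rf (expect_indep P1 (A := [pred i | i \in codom w]))//; first by rewrite EF0 mul0r.
  move=> x y xy; apply: depFs => i /codomP[v' ->]; apply: xy => /=.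
  by apply/negP => /codomP[v e]; have := no v v'; rewrite -e /= eqxx.
- move=> s v v' svv' only.
  rewrite /Rf (expect_indep1 P1 (v := w v) bF (bFs s) depF (depFs (s := s))); last first.
    move=> i /codomP[u ->] /codomP[u' e]; congr widen_ord.
    by have [-> _] := only u u' (esym e).
  apply: eq_Rintegral => y _; congr (_ * _).
  rewrite /g [RHS](expect_sel P1 (s := s) (@perm_inj _ s)); last first.
    by apply: bfun_comp bF _; exact: measurable_updl.
  apply: eq_Rintegral => x _; rewrite /Fs -svv' upd_sel//; exact: perm_inj.
- by move=> v v'; apply: expect_prod_le.
apply: lerD; first by rewrite ler_wpM2l// (le_trans sum_r)// expect_Y2.
rewrite ler_wpM2r ?invr_ge0 ?exprn_ge0// ler_wpM2r// ler_wpM2l ?mulr_ge0//.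
exact: expect_F2.
Qed.

End variance.

(** * Densities on blocks of coordinates *)

Section density_measure.
Local Open Scope ereal_scope.
Context d (T : measurableType d) (R : realType).
Variables (mu : {measure set T -> \bar R}) (f : T -> R).
Hypotheses (mf : measurable_fun setT f) (f0 : forall x, (0 <= f x)%R).

(** The hypotheses are arguments so that the measure structure can be attached to the
    constant. *)
Definition density_measure of measurable_fun setT f & (forall x, (0 <= f x)%R) :=
  fun A : set T => \int[mu]_(x in A) (f x)%:E.

Local Notation nu := (density_measure mf f0).

Let nu0 : nu set0 = 0. Proof. by rewrite /density_measure integral_set0. Qed.

Let nu_ge0 A : 0 <= nu A.
Proof. by apply: integral_ge0 => x _; rewrite lee_fin. Qed.

Let nu_sigma_additive : semi_sigma_additive nu.
Proof.
move=> /= F mF tF mUF; rewrite /density_measure; apply: cvg_toP.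
  apply: ereal_nondecreasing_is_cvgn => m n mn.
  apply: lee_sum_nneg_natr => // k _ _; apply: integral_ge0 => /= x Fkx.
  by rewrite lee_fin.
rewrite ge0_integral_bigcup//=.
- exact/measurable_EFinP/(measurable_funS measurableT).
- by move=> x _; rewrite lee_fin.
Qed.

HB.instance Definition _ := isMeasure.Build _ _ _ nu nu0 nu_ge0 nu_sigma_additive.

End density_measure.

Section product_integrals.
Local Open Scope ereal_scope.
Context d (T : measurableType d) (R : realType).
Variable mu : {sigma_finite_measure set T -> \bar R}.

Lemma measurable_prod_tnth n (h : 'I_n -> T -> R) :
  (forall i, measurable_fun setT (h i)) ->
  measurable_fun setT (fun x : n.-tuple T => \prod_(i < n) h i (tnth x i))%R.
Proof.
move=> mh; apply: measurable_prod => i _.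
by apply: measurableT_comp (mh i) _; exact: measurable_tnth.
Qed.

Lemma emeasurable_prod_tnth n (h : 'I_n -> T -> R) :
  (forall i, measurable_fun setT (h i)) ->
  measurable_fun setT (fun x : n.-tuple T => (\prod_(i < n) h i (tnth x i))%:E).
Proof. by move=> mh; apply/measurable_EFinP; exact: measurable_prod_tnth. Qed.

Lemma prod_tcons n (h : 'I_n.+1 -> T -> R) x (y : n.-tuple T) :
  (\prod_(i < n.+1) h i (tnth (tcons (x, y)) i) =
   h ord0 x * \prod_(i < n) h (lift ord0 i) (tnth y i))%R.
Proof.
rewrite big_ord_recl tconsE unlift_none; congr (_ * _)%R.
by apply: eq_bigr => i _; rewrite tconsE liftK.
Qed.

Lemma ge0_integral_prod n (h : 'I_n -> T -> R) :
  (forall i, measurable_fun setT (h i)) -> (forall i x, (0 <= h i x)%R) ->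
  \int[power_measure mu n]_x (\prod_(i < n) h i (tnth x i))%:E =
  \prod_(i < n) \int[mu]_x (h i x)%:E.
Proof.
elim: n h => [|n ih] h mh h0.
  by rewrite ge0_integral_power0 !big_ord0.
rewrite ge0_integral_powerS; [|exact: (emeasurable_prod_tnth mh)|
  by move=> x; rewrite lee_fin prodr_ge0].
transitivity (\int[mu]_x ((h ord0 x)%:E * \prod_(i < n) \int[mu]_y (h (lift ord0 i) y)%:E)).
  apply: eq_integral => x _; under eq_integral do rewrite prod_tcons EFinM.
  rewrite ge0_integralZl//; [|exact: (emeasurable_prod_tnth (fun i => mh (lift ord0 i)))|
    by move=> y _; rewrite lee_fin prodr_ge0|by rewrite lee_fin].
  by rewrite (ih (fun i => h (lift ord0 i))).
rewrite /= ge0_integralZr//.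
- by rewrite big_ord_recl.
- exact/measurable_EFinP.
- by move=> x _; rewrite lee_fin.
- by apply: prode_ge0 => i _; apply: integral_ge0 => x _; rewrite lee_fin.
Qed.

Lemma measurable_tcons_l n x : measurable_fun setT (fun y : n.-tuple T => tcons (x, y)).
Proof.
apply: (measurableT_comp (@measurable_tcons _ T n)).
exact: measurable_fun_pair.
Qed.

Variables (nu : {sigma_finite_measure set T -> \bar R}) (phi : T -> R).
Hypotheses (mphi : measurable_fun setT phi) (phi0 : forall x, (0 <= phi x)%R).
Hypothesis nuE : forall A, measurable A -> nu A = \int[mu]_(x in A) (phi x)%:E.

(** The density of a power is the product of the densities, by induction on the number
    of factors. *)
Lemma ge0_integral_power_density n (G : n.-tuple T -> \bar R) :
  measurable_fun setT G -> (forall x, 0 <= G x) ->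
  \int[power_measure nu n]_x G x =
  \int[power_measure mu n]_x (G x * (\prod_(i < n) phi (tnth x i))%:E).
Proof.
elim: n G => [|n ih] G mG G0.
  by rewrite ge0_integral_power0 ge0_integral_power0 big_ord0 mule1.
have mGt : measurable_fun setT (fun z => G (tcons z)).
  by apply: measurableT_comp mG _; exact: measurable_tcons.
have mphin m : measurable_fun setT (fun y : m.-tuple T => (\prod_(i < m) phi (tnth y i))%:E).
  exact: (emeasurable_prod_tnth (h := fun=> phi) (fun=> mphi)).
have phin0 m (y : m.-tuple T) : 0 <= (\prod_(i < m) phi (tnth y i))%:E.
  by rewrite lee_fin prodr_ge0.
rewrite ge0_integral_powerS// ge0_integral_powerS; [|exact: (emeasurable_funM mG (mphin _))|
  by move=> x; rewrite mule_ge0].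
have mGl x : measurable_fun setT (fun y : n.-tuple T => G (tcons (x, y))).
  by apply: measurableT_comp mG _; exact: measurable_tcons_l.
under eq_integral do rewrite ih//.
rewrite (ge0_integral_density mphi phi0 nuE); last 2 first.
- apply: (measurable_fun_fubini_tonelli_F (m2 := power_measure mu n)
    (fun z => G (tcons z) * (\prod_(i < n) phi (tnth z.2 i))%:E)).
    apply: emeasurable_funM => //.
    exact: (measurableT_comp (mphin n) measurable_snd).
  by move=> z; rewrite mule_ge0.
- by move=> x; apply: integral_ge0 => y _; rewrite mule_ge0.
apply: eq_integral => x _; rewrite -ge0_integralZr//; last 3 first.
- by apply: emeasurable_funM => //; exact: mphin.
- by move=> y _; rewrite mule_ge0.
- by rewrite lee_fin.
apply: eq_integral => y _; rewrite (prod_tcons (fun=> phi)) EFinM -!muleA.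
by congr (_ * _); rewrite muleC.
Qed.

End product_integrals.

Section blocks.
Variables (R : realType) (d : nat) (p : 'I_d -> nat).

Lemma big_rank (T : Type) (idx : T) (op : Monoid.com_law idx) (F : 'I_(\sum_j p j)%N -> T) :
  \big[op/idx]_k F k = \big[op/idx]_(j < d) \big[op/idx]_(i < p j) F (tagnat.Rank j i).
Proof.
rewrite (reindex _ (@tagnat.rank_bij_on _ p)) /=.
rewrite sig_big_dep /=; apply: eq_bigr => -[j i] _.
by rewrite tagnat.rankE.
Qed.

Lemma Rank_inj j : injective (@tagnat.Rank d p j).
Proof.
move=> i i' /tagnat.rank_inj /eqP; rewrite -tag_eqE /tag_eq /= eqxx /= tagged_asE.
by move/eqP.
Qed.

Lemma measurable_block j : measurable_fun setT (@block R d p j).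
Proof. exact: (measurable_sel (@tagnat.Rank d p j)). Qed.

(** When the entries of [z] are independent copies, the blocks of [mixb z] are independent
    and each keeps its law: the law of [mixb z] is the product of the marginals. *)
Definition mixb (z : d.-tuple (obs R p)) : obs R p :=
  [tuple tnth (tnth z (tagnat.sig1 k)) k | k < (\sum_j p j)%N].

Lemma measurable_mixb : measurable_fun setT mixb.
Proof.
apply/measurable_fun_tnthP => k; rewrite (_ : _ \o _ =
   (fun x : obs R p => tnth x k) \o (fun z => tnth z (tagnat.sig1 k))).
  by apply: measurableT_comp; exact: measurable_tnth.
by apply/funext => z /=; rewrite tnth_mktuple.
Qed.

Lemma block_mixb j z : block j (mixb z) = block j (tnth z j).
Proof. by apply: eq_from_tnth => i; rewrite !tnth_mktuple tagnat.Rank1K. Qed.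

Local Open Scope ereal_scope.

Lemma ge0_integral_mixb (gam : {sigma_finite_measure set (measurableTypeR R) -> \bar R})
    (G : obs R p -> \bar R) :
  gam setT = 1 -> measurable_fun setT G -> (forall x, 0 <= G x) ->
  \int[power_measure gam _]_x G x =
  \int[power_measure (power_measure gam (\sum_j p j)%N) d]_z G (mixb z).
Proof.
move=> gam1 mG G0; apply: ge0_integral_law => //; first exact: measurable_mixb.
move=> B mB.
pose C j k := if tagnat.sig1 k == j then B k else setT.
have mC j k : measurable (C j k) by rewrite /C; case: ifP.
rewrite (_ : [set _ | _] = rect (fun j => rect (C j))); last first.
  apply/seteqP; split => z /= h.
    move=> j k; rewrite /C; case: eqP => // <-.
    by have := h k; rewrite tnth_mktuple.
  by move=> k; have := h (tagnat.sig1 k) k; rewrite /C eqxx tnth_mktuple.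
transitivity (\prod_(j < d) power_measure gam (\sum_j p j)%N (rect (C j))).
  by apply: power_rect => j; exact: measurable_rect.
transitivity (\prod_(j < d) \prod_k gam (C j k)).
  by apply: eq_bigr => j _; exact: power_rect.
rewrite exchange_big /=; apply: eq_bigr => k _.
rewrite (bigD1 (tagnat.sig1 k))//= /C eqxx big1 ?mule1// => j.
by rewrite eq_sym => /negbTE ->.
Qed.

Let lap := @laplace_prob R.
Let phi := @laplace_pdf R.

Let phi_gt0 x : (0 < phi x)%R.
Proof. by rewrite divr_gt0// expR_gt0. Qed.

Let phin m (x : euclid R m) : R := (\prod_(i < m) phi (tnth x i))%R.

Let phin_gt0 m (x : euclid R m) : (0 < phin x)%R.
Proof. by apply: prodr_gt0. Qed.

Let psi (x : measurableTypeR R) : R := (2 * expR `|x|)%R.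

Let mpsi : measurable_fun setT psi.
Proof.
apply: measurable_funM => //; apply: (measurableT_comp (@measurable_expR R)).
exact: normr_measurable.
Qed.

Let psi_ge0 x : (0 <= psi x)%R. Proof. by rewrite mulr_ge0// expR_ge0. Qed.

Let psin m (x : euclid R m) : R := (\prod_(i < m) psi (tnth x i))%R.

Let psin_ge0 m (x : euclid R m) : (0 <= psin x)%R. Proof. exact: prodr_ge0. Qed.

Let mpsin m : measurable_fun setT (@psin m).
Proof. exact: (measurable_prod_tnth (h := fun=> psi) (fun=> mpsi)). Qed.

Let psiphi m (x : euclid R m) : (psin x * phin x = 1)%R.
Proof.
rewrite /psin /phin -big_split big1//= => i _.
by rewrite /psi /phi /laplace_pdf expRN; field; rewrite gt_eqF ?expR_gt0.
Qed.

Let lebE m (G : euclid R m -> R) : measurable_fun setT G -> (forall x, (0 <= G x)%R) ->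
  \int[lebesgue_euclid R m]_x (G x)%:E =
  \int[power_measure lap m]_x (G x * psin x)%:E.
Proof.
move=> mG G0.
rewrite (@ge0_integral_power_density _ _ _ lebesgue_measure lap phi).
- by apply: eq_integral => x _; rewrite -EFinM -/(phin x) -mulrA psiphi mulr1.
- exact: measurable_laplace_pdf.
- by move=> x; exact: ltW.
- by [].
- by apply/measurable_EFinP; apply: measurable_funM => //; exact: mpsin.
- by move=> x; rewrite lee_fin mulr_ge0.
Qed.

(** Lebesgue measure on [R^p] is the Laplace law times a positive weight that factorizes over
    the coordinates.  For a probability measure the blocks are independent selections of
    coordinates, so the claim reduces to the independence of coordinates. *)
Lemma block_fubini (g : forall j, euclid R (p j) -> R) :
  (forall j, measurable_fun setT (g j)) -> (forall j x, (0 <= g j x)%R) ->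
  \int[lebesgue_euclid R (\sum_j p j)%N]_x (\prod_(j < d) g j (block j x))%:E =
  \prod_(j < d) \int[lebesgue_euclid R (p j)]_x (g j x)%:E.
Proof.
move=> mg g0.
have mgb j : measurable_fun setT (fun x : obs R p => g j (block j x)).
  by apply: measurableT_comp (mg j) _; exact: measurable_block.
pose q j (x : euclid R (p j)) : R := (g j x * psin x)%R.
have mq j : measurable_fun setT (q j) by apply: (measurable_funM (mg j)); apply: mpsin.
have mqb j : measurable_fun setT (fun x : obs R p => q j (block j x)).
  by apply: measurableT_comp (mq j) _; exact: measurable_block.
have q0 j x : (0 <= q j x)%R by rewrite mulr_ge0.
rewrite lebE; [|exact: measurable_prod|by move=> x; exact: prodr_ge0].
have lap1 : lap setT = 1 by exact: probability_setT.
transitivity (\int[power_measure lap _]_x (\prod_(j < d) q j (block j x))%:E).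
  apply: eq_integral => x _; congr EFin; rewrite /q big_split /=; congr (_ * _)%R.
  rewrite /psin big_rank; apply: eq_bigr => j _; apply: eq_bigr => i _.
  by rewrite tnth_mktuple.
rewrite (ge0_integral_mixb lap1); last 2 first.
- exact/measurable_EFinP/measurable_prod.
- by move=> x; rewrite lee_fin; exact: prodr_ge0.
under eq_integral do under eq_bigr do rewrite block_mixb.
rewrite (@ge0_integral_prod _ _ _ _ _ (fun j x => q j (block j x)))//.
apply: eq_bigr => j _; rewrite lebE//.
rewrite [RHS](ge0_integral_sel (mu := lap) _ (s := @tagnat.Rank d p j))//.
- exact: Rank_inj.
- by apply/measurable_EFinP; exact: mq.
- by move=> x; rewrite lee_fin; exact: q0.
Qed.

(** On a rectangle both sides are the product of the marginal probabilities of its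
    blocks. *)
Lemma ge0_integral_mix_density (P : probability (obs R p) R)
    (fj : forall j, euclid R (p j) -> R) (G : obs R p -> \bar R) :
  (forall j, is_density (pushforward P (@block R d p j)) (fj j)) ->
  measurable_fun setT G -> (forall x, 0 <= G x) ->
  \int[power_measure P d]_z G (mixb z) =
  \int[lebesgue_euclid R (\sum_j p j)%N]_x (G x * (\prod_(j < d) fj j (block j x))%:E).
Proof.
move=> fjd mG G0.
have mf j : measurable_fun setT (fj j) by case: (fjd j).
have f0 j x : (0 <= fj j x)%R by case: (fjd j).
have mfb j : measurable_fun setT (fun x : obs R p => fj j (block j x)).
  by apply: measurableT_comp (mf j) _; exact: measurable_block.
pose f (x : obs R p) := (\prod_(j < d) fj j (block j x))%R.
have mff : measurable_fun setT f by exact: measurable_prod.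
have ff0 x : (0 <= f x)%R by exact: prodr_ge0.
pose mix' : {mfun d.-tuple (obs R p) >-> obs R p} :=
  HB.pack mixb (isMeasurableFun.Build _ _ _ _ _ measurable_mixb).
pose nu2 : {measure set (obs R p) -> \bar R} :=
  density_measure (lebesgue_euclid R (\sum_j p j)%N) mff ff0.
transitivity (\int[pushforward (power_measure P d) mix']_x G x).
  by rewrite ge0_integral_pushforward ?preimage_setT.
transitivity (\int[nu2]_x G x); last exact: (ge0_integral_density mff ff0).
apply: eq_measure_integral => A mA _; apply: rect_unique mA.
- by rewrite [X in X < _](_ : _ = 1) ?ltry.
- move=> B mB.
  pose C j := rect (fun i : 'I_(p j) => B (tagnat.Rank j i)).
  have mC j : measurable (C j) by exact: measurable_rect.
  transitivity (\prod_(j < d) \int[lebesgue_euclid R (p j)]_(x in C j) (fj j x)%:E).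
    rewrite /= /pushforward.
    rewrite (_ : _ @^-1` _ = rect (fun j => @block R d p j @^-1` C j)).
      transitivity (\prod_(j < d) P (@block R d p j @^-1` C j)).
        apply: power_rect => j.
        by rewrite -[X in measurable X]setTI; apply: measurable_block => //; exact: mC.
      by apply: eq_bigr => j _; case: (fjd j) => _ _ <-.
    apply/seteqP; split => z /= h.
      by move=> j i; rewrite tnth_mktuple; have := h (tagnat.Rank j i); rewrite tnth_mktuple tagnat.Rank1K.
    move=> k; rewrite tnth_mktuple; have := h (tagnat.sig1 k) (tagnat.sig2 k).
    by rewrite tnth_mktuple tagnat.sig2K.
  rewrite /nu2 /= /density_measure integral_mkcond.
  pose g j x := (fj j x * \1_(C j) x)%R.
  transitivity (\prod_(j < d) \int[lebesgue_euclid R (p j)]_x (g j x)%:E).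
    apply: eq_bigr => j _; rewrite integral_mkcond; apply: eq_integral => x _.
    by rewrite patchE /g indicE; case: ifP; rewrite (mulr1, mulr0).
  rewrite -block_fubini.
  - apply: eq_integral => x _; rewrite patchE.
    case: ifPn => [|xB].
      rewrite inE => xB; congr EFin; apply: eq_bigr => j _.
      rewrite /g indicE mem_set ?mulr1// => i.
      by rewrite tnth_mktuple; exact: xB.
    have [k Bk] : exists k, ~ B k (tnth x k).
      by apply/existsNP => xB'; move: xB; rewrite mem_set.
    rewrite (bigD1 (tagnat.sig1 k))//= /g indicE memNset ?mulr0 ?mul0r// => xC.
    by apply: Bk; have := xC (tagnat.sig2 k); rewrite tnth_mktuple tagnat.sig2K.
  - by move=> j; apply: (measurable_funM (mf j)); apply: measurable_indic; exact: mC.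
  - by move=> j x; rewrite mulr_ge0.
Qed.

End blocks.

(** * Integrability of real functions *)

Section integrable_real.
Context d (T : measurableType d) (R : realType) (mu : {measure set T -> \bar R}).
Implicit Types f g : T -> R.

Lemma rintegrableZ (c : R) f : mu.-integrable setT (EFin \o f) ->
  mu.-integrable setT (EFin \o (fun x => c * f x)).
Proof. by move=> fi; apply: integrableZl fi. Qed.

Lemma rintegrableB f g : mu.-integrable setT (EFin \o f) ->
  mu.-integrable setT (EFin \o g) -> mu.-integrable setT (EFin \o (fun x => f x - g x)).
Proof. by move=> fi gi; apply: integrableB fi gi. Qed.

Lemma rintegrable_le f g : mu.-integrable setT (EFin \o f) -> measurable_fun setT g ->
  (forall x, `|g x| <= `|f x|) -> mu.-integrable setT (EFin \o g).
Proof.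
move=> fi mg gf; apply: (le_integrable measurableT _ _ fi); first exact/measurable_EFinP.
by move=> x _ /=; rewrite lee_fin.
Qed.

End integrable_real.

(** * The Gaussian kernel on the line *)

Section gauss1.
Context {R : realType}.
Implicit Types (l t a b w : R).
Local Notation leb := (@lebesgue_measure R).

Definition gk1 l a b : R :=
  (Num.sqrt (2 * pi) * l)^-1 * expR (- (a - b) ^+ 2 / (2 * l ^+ 2)).

Let sp_gt0 : 0 < Num.sqrt (2 * pi) :> R.
Proof. by rewrite sqrtr_gt0 mulr_gt0 ?pi_gt0. Qed.

Lemma gk1_ge0 l a b : 0 <= l -> 0 <= gk1 l a b.
Proof. by move=> l0; rewrite mulr_ge0 ?expR_ge0// invr_ge0 mulr_ge0// ltW. Qed.

Lemma gk1_gt0 l a b : 0 < l -> 0 < gk1 l a b.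
Proof. by move=> l0; rewrite mulr_gt0 ?expR_gt0// invr_gt0 mulr_gt0. Qed.

Lemma gk1_sym l a b : gk1 l a b = gk1 l b a.
Proof. by rewrite /gk1 -(sqrrN (a - b)) opprB. Qed.

Lemma gk1_le l a b : 0 < l -> gk1 l a b <= (Num.sqrt (2 * pi) * l)^-1.
Proof.
move=> l0; rewrite ler_piMr// ?invr_ge0 ?mulr_ge0 ?(ltW l0) ?(ltW sp_gt0)//.
rewrite -[leRHS]expR0 ler_expR mulNr oppr_le0 divr_ge0 ?sqr_ge0//.
by rewrite mulr_ge0 ?sqr_ge0.
Qed.

Lemma gk1_normal l a b : 0 < l -> gk1 l a b = normal_pdf b l a.
Proof.
move=> l0; rewrite normal_pdfE ?gt_eqF// /gk1 /normal_peak /normal_fun; congr (_^-1 * _).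
  have -> : l ^+ 2 * pi *+ 2 = (2 * pi) * l ^+ 2 by ring.
  by rewrite [in RHS]sqrtrM ?mulr_ge0 ?pi_ge0// sqrtr_sqr ger0_norm ?(ltW l0).
by rewrite (mulr_natl (l ^+ 2)).
Qed.

Lemma continuous_gk1 l b : 0 < l -> continuous (gk1 l ^~ b : R -> R).
Proof.
move=> l0; rewrite (_ : gk1 l ^~ b = normal_pdf b l); last first.
  by apply/funext => a; exact: gk1_normal.
by apply: continuous_normal_pdf; rewrite gt_eqF.
Qed.

Lemma measurable_gk1 d (T : measurableType d) (f g : T -> R) l :
  measurable_fun setT f -> measurable_fun setT g ->
  measurable_fun setT (fun x => gk1 l (f x) (g x)).
Proof.
move=> mf mg; apply: measurable_funM => //; apply: (measurableT_comp (@measurable_expR R)).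
apply: measurable_funM => //; apply: measurableT_comp => //=.
by apply: measurable_funX; exact: measurable_funB.
Qed.

Lemma integral_gk1l l b : 0 < l -> (\int[leb]_a (gk1 l a b)%:E = 1)%E.
Proof.
move=> l0; rewrite -(integral_normal_pdf b l).
by apply: eq_integral => a _; rewrite gk1_normal.
Qed.

Lemma integral_gk1r l a : 0 < l -> (\int[leb]_b (gk1 l a b)%:E = 1)%E.
Proof.
by move=> l0; under eq_integral do rewrite gk1_sym; exact: integral_gk1l.
Qed.

Lemma integrable_gk1 l b : 0 < l -> leb.-integrable setT (fun a => (gk1 l a b)%:E).
Proof.
move=> l0; apply/integrableP; split.
  by apply/measurable_EFinP; exact: measurable_gk1.
under eq_integral do rewrite /= ger0_norm ?gk1_ge0 ?(ltW l0)//.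
by rewrite integral_gk1l// ltry.
Qed.

(** Completion of the square in [z]. *)
Lemma gk1_mul l x y z : 0 < l ->
  gk1 l x z * gk1 l z y =
  gk1 (Num.sqrt 2 * l) x y * gk1 (l / Num.sqrt 2) z ((x + y) / 2).
Proof.
move=> l0; rewrite /gk1.
have s2 : Num.sqrt 2 != 0 :> R by rewrite gt_eqF// sqrtr_gt0.
have s22 : Num.sqrt 2 ^+ 2 = 2 :> R by rewrite sqr_sqrtr.
have sp0 := lt0r_neq0 sp_gt0.
rewrite mulrACA -expRD [RHS]mulrACA -expRD; congr (_ * expR _).
  by field; rewrite s2 (gt_eqF l0) sp0.
rewrite !exprMn exprVn s22; field; by rewrite (gt_eqF l0).
Qed.

(** The convolution of two centred Gaussians adds their variances. *)
Lemma integral_gk1_conv l x y : 0 < l ->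
  (\int[leb]_z (gk1 l x z * gk1 l z y)%:E = (gk1 (Num.sqrt 2 * l) x y)%:E)%E.
Proof.
move=> l0; under eq_integral do rewrite gk1_mul// EFinM.
have l2 : 0 < l / Num.sqrt 2 by rewrite divr_gt0// sqrtr_gt0.
have l2' : 0 < Num.sqrt 2 * l by rewrite mulr_gt0// sqrtr_gt0.
rewrite ge0_integralZl//; last 2 first.
- by move=> z _; rewrite lee_fin gk1_ge0// ltW.
- by rewrite lee_fin gk1_ge0// ltW.
  by rewrite integral_gk1l// mule1.
by apply/measurable_EFinP; exact: measurable_gk1.
Qed.

(** A linear factor is absorbed by a wider Gaussian, because [y <= exp (y^2)]. *)
Lemma gk1_moment l w : 0 < l ->
  `|w * gk1 l w 0| <= 2 * Num.sqrt 2 * l * gk1 (Num.sqrt 2 * l) w 0.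
Proof.
move=> l0; rewrite normrM (ger0_norm (gk1_ge0 w 0 (ltW l0))) /gk1 !subr0.
have s2 : 0 < Num.sqrt 2 :> R by rewrite sqrtr_gt0.
have s22 : Num.sqrt 2 ^+ 2 = 2 :> R by rewrite sqr_sqrtr.
pose y := `|w| / (2 * l).
have wy : `|w| = 2 * l * y by rewrite /y; field; rewrite (gt_eqF l0).
have y2 : w ^+ 2 = 4 * l ^+ 2 * y ^+ 2 by rewrite -(real_normK (num_real w)) wy; ring.
have ey : y <= expR (y ^+ 2).
  apply: le_trans (expR_ge1Dx _); have := sqr_ge0 (y - 2^-1); nra.
have -> : - w ^+ 2 / (2 * l ^+ 2) = - y ^+ 2 - y ^+ 2 by rewrite y2; field; rewrite (gt_eqF l0).
have -> : - w ^+ 2 / (2 * (Num.sqrt 2 * l) ^+ 2) = - y ^+ 2.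
  by rewrite y2 [(Num.sqrt 2 * l) ^+ 2]exprMn s22; field; rewrite (gt_eqF l0).
rewrite expRD wy.
have -> : 2 * Num.sqrt 2 * l * ((Num.sqrt (2 * pi) * (Num.sqrt 2 * l))^-1 * expR (- y ^+ 2)) =
   2 / Num.sqrt (2 * pi) * expR (- y ^+ 2).
  by field; rewrite (gt_eqF s2) (gt_eqF l0) (gt_eqF sp_gt0).
have -> : 2 * l * y * ((Num.sqrt (2 * pi) * l)^-1 * (expR (- y ^+ 2) * expR (- y ^+ 2))) =
   2 / Num.sqrt (2 * pi) * (y * expR (- y ^+ 2) * expR (- y ^+ 2)).
  by field; rewrite (gt_eqF l0) (gt_eqF sp_gt0).
apply: ler_wpM2l; first by rewrite divr_ge0 ?(ltW sp_gt0).
rewrite -[leRHS]mul1r ler_wpM2r ?expR_ge0// expRN.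
by rewrite ler_pdivrMr ?expR_gt0// mul1r.
Qed.

End gauss1.

Section gauss_char.
Context {R : realType}.
Variables l theta : R.
Hypothesis l0 : 0 < l.
Local Notation leb := (@lebesgue_measure R).
Let N (w : R) : R := gk1 l w 0.

Let NE w : N w = (Num.sqrt (2 * pi) * l)^-1 * expR (- w ^+ 2 / (2 * l ^+ 2)).
Proof. by rewrite /N /gk1 subr0. Qed.

Let N_ge0 w : 0 <= N w. Proof. by rewrite gk1_ge0// ltW. Qed.

Let cN : continuous (N : R -> R). Proof. exact: continuous_gk1. Qed.

Let mN : measurable_fun setT N. Proof. by apply: measurable_gk1. Qed.

Let NN w : N (- w) = N w. Proof. by rewrite !NE sqrrN. Qed.

Let dN (w : R) : is_derive w 1 N (- (w / l ^+ 2) * N w).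
Proof.
rewrite (_ : N = fun w => (Num.sqrt (2 * pi) * l)^-1 * expR ((- (2 * l ^+ 2)^-1) * w ^+ 2)); last first.
  by apply/funext => x; rewrite NE; congr (_ * expR _); rewrite mulNr mulrC mulNr.
apply: is_derive_eq.
rewrite /GRing.scale /=; field; by rewrite (gt_eqF l0) gt_eqF// sqrtr_gt0 mulr_gt0 ?pi_gt0.
Qed.

Let wN_bound w : `|w * N w| <= 2 * Num.sqrt 2 * l * gk1 (Num.sqrt 2 * l) w 0.
Proof. exact: gk1_moment. Qed.

Let sl : 0 < Num.sqrt 2 * l. Proof. by rewrite mulr_gt0// sqrtr_gt0. Qed.

Let G (w : R) : R := 2 * Num.sqrt 2 * l * gk1 (Num.sqrt 2 * l) w 0.

Let G_ge0 w : 0 <= G w.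
Proof.
apply: mulr_ge0; last by rewrite gk1_ge0// ltW.
by rewrite mulr_ge0 ?(ltW l0)// mulr_ge0 ?sqrtr_ge0.
Qed.

Let iG : leb.-integrable setT (EFin \o G).
Proof.
rewrite (_ : _ \o _ = fun w => ((2 * Num.sqrt 2 * l)%:E * (gk1 (Num.sqrt 2 * l) w 0)%:E)%E).
  by apply: integrableZl => //; exact: integrable_gk1.
by [].
Qed.

Let iN : leb.-integrable setT (EFin \o N). Proof. exact: integrable_gk1. Qed.

Let mtrig t (f : R -> R) : continuous f -> measurable_fun setT (fun w : R => f (t * w + theta)).
Proof.
move=> cf; apply: (measurableT_comp (f := f)).
  exact: continuous_measurable_fun.
by apply: measurable_funD => //; exact: measurable_funM.
Qed.

Let iNtrig t (f : R -> R) : continuous f -> (forall x, `|f x| <= 1) ->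
  leb.-integrable setT (EFin \o (fun w => N w * f (t * w + theta))).
Proof.
move=> cf f1; apply: (le_integrable measurableT _ _ iN).
  by apply/measurable_EFinP; apply: measurable_funM => //; exact: mtrig.
move=> w _ /=; rewrite lee_fin normrM ler_piMr//.
Qed.

Let iwNtrig t (f : R -> R) : continuous f -> (forall x, `|f x| <= 1) ->
  leb.-integrable setT (EFin \o (fun w => w * N w * f (t * w + theta))).
Proof.
move=> cf f1; apply: (le_integrable measurableT _ _ iG).
  apply/measurable_EFinP; apply: measurable_funM; first exact: measurable_funM.
  exact: mtrig.
move=> w _ /=; rewrite lee_fin normrM [leRHS]ger0_norm//.
apply: le_trans (wN_bound w); by rewrite ler_piMr.
Qed.

Let phi (t : R) : R := \int[leb]_w (N w * cos (t * w + theta)).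

(* The derivative of [N w * sin (t * w + theta)] has integral zero over the line. *)
Let by_parts t : \int[leb]_w (w * N w * sin (t * w + theta)) = l ^+ 2 * t * phi t.
Proof.
pose K w := N w * sin (t * w + theta).
pose D w := t * (N w * cos (t * w + theta)) - (l ^+ 2)^-1 * (w * N w * sin (t * w + theta)).
have dK (w : R) : is_derive w 1 K (D w).
  have ds : is_derive w 1 (fun w : R => sin (t * w + theta)) (t * cos (t * w + theta)).
    by apply: is_derive_eq; rewrite /GRing.scale /=; ring.
  apply: (is_derive_eq (is_deriveM (dN w) ds)); rewrite /GRing.scale /= /D.
  by field; rewrite (gt_eqF l0).
have clin : continuous ((fun w => t * w + theta) : R -> R).
  move=> w; apply: (@continuousD _ R^o); last exact: cst_continuous.
  by apply: (@continuousM _ R^o); [exact: cst_continuous|].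
have cD : continuous D.
  have ccos : continuous (fun w : R => cos (t * w + theta)).
    by move=> w; apply: continuous_comp; [exact: clin|exact: continuous_cos].
  have csin : continuous (fun w : R => sin (t * w + theta)).
    by move=> w; apply: continuous_comp; [exact: clin|exact: continuous_sin].
  move=> w; apply: (@cvgB _ R^o).
    by apply: cvgM; [exact: cvg_cst|apply: cvgM; [exact: cN|exact: ccos]].
  apply: cvgM; first exact: cvg_cst.
  by apply: cvgM; [apply: cvgM; [exact: cvg_id|exact: cN]|exact: csin].
have iD : leb.-integrable setT (EFin \o D).
  apply: rintegrableB; apply: rintegrableZ.
    by apply: iNtrig; [exact: continuous_cos|exact: cos_max].
  by apply: iwNtrig; [exact: continuous_sin|exact: sin_max].
have cvgD : (\int[leb]_(w in `[(- n.+1%:R)%R, n.+1%:R%R]) (D w)%:E @[n --> \oo] -->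
    \int[leb]_w (D w)%:E)%E.
  pose f_ (n : nat) : measurableTypeR R -> \bar R := (EFin \o D) \_ `[- n.+1%:R, n.+1%:R].
  rewrite (_ : (fun n => _) = fun n => (\int[leb]_w f_ n w)%E); last first.
    by apply/funext => n; rewrite integral_mkcond.
  have dcv := @dominated_cvg _ _ _ leb setT measurableT f_ (EFin \o D) (abse \o (EFin \o D)).
  apply: dcv => //.
  - move=> n; apply/(measurable_restrictT _ _).1 => //.
    by apply: measurable_funTS; exact: measurable_int iD.
  - move=> w _; apply: cvg_near_cst.
    near=> n; rewrite /f_ patchE mem_set//= in_itv/=.
    have wn : `|w| <= n%:R by near: n; exact: nbhs_infty_ger.
    move: wn; rewrite ler_norml => /andP[w1 w2].
    by rewrite -natr1; apply/andP; split; lra.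
  - exact: integrable_abse.
  - move=> n w _; rewrite /f_ patchE; case: ifP => //= _.
    by rewrite normr0 lee_fin.
have FTC n : (\int[leb]_(w in `[(- n.+1%:R)%R, n.+1%:R%R]) (D w)%:E =
    (N n.+1%:R * (sin (t * n.+1%:R + theta) - sin (t * - n.+1%:R + theta)))%:E)%E.
  rewrite (@continuous_FTC2 _ D K).
  - by rewrite -EFinB /K NN mulrBr.
  - by rewrite gtrN// ltr0n.
  - exact: continuous_subspaceT.
  - have cK : continuous K by move=> w; apply: differentiable_continuous; apply/derivable1_diffP; exact: ex_derive.
    split => //.
    + by apply: cvg_at_right_filter; exact: cK.
    + by apply: cvg_at_left_filter; exact: cK.
  - by move=> w _; rewrite derive1E derive_val.
have N0 : N n.+1%:R @[n --> \oo] --> (0 : R).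
  have -> : (fun n => N n.+1%:R) =
      (fun n => (Num.sqrt (2 * pi) * l)^-1 * gauss_fun (n.+1%:R / (Num.sqrt 2 * l))).
    apply/funext => n; rewrite NE /gauss_fun; congr (_ * expR _).
    rewrite exprMn exprVn [(Num.sqrt 2 * l) ^+ 2]exprMn sqr_sqrtr//.
    by rewrite mulNr.
  rewrite -[X in _ --> X](mulr0 (Num.sqrt (2 * pi) * l)^-1); apply: cvgMr.
  apply: cvg_comp; last exact: cvg_gauss_fun.
  apply/cvgryPge => A; near=> n; rewrite ler_pdivlMr//.
  have h : A * (Num.sqrt 2 * l) <= n%:R by near: n; exact: nbhs_infty_ger.
  by rewrite (le_trans h)// ler_nat.
have lim0 : ((N n.+1%:R * (sin (t * n.+1%:R + theta) - sin (t * - n.+1%:R + theta)))%:E @[n --> \oo] --> (0 : \bar R))%E.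
  apply: cvg_EFin; first by near=> n.
  have h2 : 2 * N n.+1%:R @[n --> \oo] --> (0 : R).
    by rewrite -[X in _ --> X](mulr0 2); apply: cvgMr.
  apply/norm_cvg0P; apply: (squeeze_cvgr _ (cvg_cst 0) h2); near=> n.
  rewrite normr_ge0 /= normrM ger0_norm// mulrC ler_wpM2r//.
  by rewrite (le_trans (ler_normB _ _))// -[leRHS]/(1 + 1) lerD// sin_max.
have int0 : (\int[leb]_w (D w)%:E = 0)%E.
  move: cvgD; rewrite (funext FTC) => c; apply: (cvg_unique _ c lim0).
  exact: ereal_hausdorff.
have := int0; rewrite -[X in _ = X]/(0%:E) => /(congr1 fine); rewrite -/(Rintegral _ _ _) /=.
rewrite /D RintegralB//; last 2 first.
- by apply: rintegrableZ; apply: iNtrig; [exact: continuous_cos|exact: cos_max].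
- by apply: rintegrableZ; apply: iwNtrig; [exact: continuous_sin|exact: sin_max].
rewrite RintegralZl//; last by apply: iNtrig; [exact: continuous_cos|exact: cos_max].
rewrite RintegralZl//; last by apply: iwNtrig; [exact: continuous_sin|exact: sin_max].
move=> /subr0_eq e; rewrite -mulrA -/(phi t) in e *; rewrite e mulrA mulfV ?mul1r//.
by rewrite gt_eqF// exprn_gt0.
Unshelve. all: end_near. Qed.

(* Differentiation under the integral sign, dominated by [G], gives the equation
   [phi' = - l^2 t phi]. *)
Let dphi (t : R) : is_derive t 1 phi (- (l ^+ 2 * t) * phi t).
Proof.
pose f (x w : R) := N w * cos (x * w + theta).
have df (x w : R) : is_derive x 1 (f ^~ w) (- (w * N w * sin (x * w + theta))).
  have dc : is_derive x 1 (fun x : R => cos (x * w + theta)) (- (w * sin (x * w + theta))).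
    by apply: is_derive_eq; rewrite /GRing.scale /=; ring.
  apply: (is_derive_eq (is_deriveM (is_derive_cst (N w) x 1) dc)).
  by rewrite /GRing.scale /=; ring.
have intf x : `]t - 1, t + 1[%classic x -> leb.-integrable setT (EFin \o f x).
  by move=> _; apply: iNtrig; [exact: continuous_cos|exact: cos_max].
have It : `]t - 1, t + 1[%classic t by rewrite /= in_itv/=; apply/andP; split; lra.
have derf x w : `]t - 1, t + 1[%classic x -> [set: R] w -> derivable (f ^~ w) x 1.
  by move=> _ _; exact: ex_derive.
have Gub x w : `]t - 1, t + 1[%classic x -> [set: R] w -> `|partial1of2 f x w| <= G w.
  move=> _ _; rewrite partial1of2E derive_val normrN normrM.
  by apply: le_trans (wN_bound w); rewrite ler_piMr// sin_max.
have d1 : derivable phi t 1 := derivable_under_integral measurableT It intf derf G_ge0 iG Gub.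
have d2 := differentiation_under_integral measurableT It intf derf G_ge0 iG Gub.
apply: (DeriveDef d1); rewrite -derive1E [LHS]d2.
rewrite mulNr -by_parts -[RHS]mulN1r -RintegralZl//; last first.
  by apply: iwNtrig; [exact: continuous_sin|exact: sin_max].
by apply: eq_Rintegral => w _; rewrite partial1of2E derive_val mulN1r.
Qed.

(** The function [phi] solves a linear differential equation of first order, so [phi] divided by
    the Gaussian is constant.  The phase [theta] makes the statement stable under integrating one
    coordinate after another. *)
Lemma gauss_char t :
  \int[leb]_w (gk1 l w 0 * cos (t * w + theta)) = cos theta * expR (- (l * t) ^+ 2 / 2).
Proof.
pose E x := phi x * expR (2^-1 * l ^+ 2 * x ^+ 2).
have dE (x : R) : is_derive x 1 E 0.
  have de : is_derive x 1 (fun x : R => expR (2^-1 * l ^+ 2 * x ^+ 2))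
      (l ^+ 2 * x * expR (2^-1 * l ^+ 2 * x ^+ 2)).
    by apply: is_derive_eq; rewrite /GRing.scale /=; field.
  apply: (is_derive_eq (is_deriveM (dphi x) de)); rewrite /GRing.scale /=; ring.
have EE : E t = E 0 by apply: is_derive_0_is_cst => x; exact: dE.
have phi0 : phi 0 = cos theta.
  rewrite /phi; under eq_Rintegral do rewrite mul0r add0r.
  rewrite RintegralZr//.
  by rewrite /Rintegral integral_gk1l// mul1r.
move: EE; rewrite /E phi0 expr0n /= mulr0 expR0 mulr1 -/(phi t) => <-.
rewrite -mulrA -expRD (_ : _ + _ = 0) ?expR0 ?mulr1//.
by field.
Qed.

End gauss_char.

Section euclid_integral.
Context {R : realType}.
Local Notation leb := (@lebesgue_measure R).

Lemma ge0_integral_euclid_prod m (h : 'I_m -> R -> R) :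
  (forall i, measurable_fun setT (h i)) -> (forall i x, 0 <= h i x) ->
  (\int[lebesgue_euclid R m]_x (\prod_(i < m) h i (tnth x i))%:E =
   \prod_(i < m) \int[leb]_x (h i x)%:E)%E.
Proof. by move=> mh h0; exact: (@ge0_integral_prod _ _ R leb m h mh h0). Qed.

Lemma ge0_integral_euclid0 (G : euclid R 0 -> \bar R) :
  (\int[lebesgue_euclid R 0]_x G x = G [tuple])%E.
Proof. exact: ge0_integral_power0. Qed.

Lemma ge0_integral_euclidS m (G : euclid R m.+1 -> \bar R) :
  measurable_fun setT G -> (forall x, (0 <= G x)%E) ->
  (\int[lebesgue_euclid R m.+1]_x G x =
   \int[leb]_x \int[lebesgue_euclid R m]_y G (tcons (x, y)))%E.
Proof. exact: ge0_integral_powerS. Qed.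

End euclid_integral.

(** * The Gaussian kernel in several variables *)

Section gauss_kernel.
Context {R : realType}.
Local Notation L := (lebesgue_euclid R).
Variables (m : nat) (lam : 'I_m -> R).
Hypothesis lam0 : forall i, 0 < lam i.
Local Notation gk := (gauss_kernel lam).
Implicit Types x y z : euclid R m.

(** The value of the kernel on the diagonal. *)
Definition gk_peak : R := \prod_(i < m) (Num.sqrt (2 * pi) * lam i)^-1.

Lemma gk_ge0 x y : 0 <= gk x y.
Proof. by apply: prodr_ge0 => i _; apply: gk1_ge0; exact: ltW. Qed.

Lemma gk_gt0 x y : 0 < gk x y.
Proof. by apply: prodr_gt0 => i _; apply: gk1_gt0. Qed.

Lemma gk_sym x y : gk x y = gk y x.
Proof. by apply: eq_bigr => i _; exact: gk1_sym. Qed.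

Lemma gk_le x y : gk x y <= gk_peak.
Proof. by apply: ler_prod => i _; rewrite [X in X && _]gk1_ge0 ?(ltW (lam0 i))//=; exact: gk1_le. Qed.

Lemma measurable_gk d (T : measurableType d) (f g : T -> euclid R m) :
  measurable_fun setT f -> measurable_fun setT g ->
  measurable_fun setT (fun t => gk (f t) (g t)).
Proof.
move=> mf mg; apply: measurable_prod => i _.
apply: (@measurable_gk1 _ _ T (fun t => tnth (f t) i) (fun t => tnth (g t) i));
by apply: measurableT_comp (measurable_tnth i) _.
Qed.

Lemma integral_gkl y : (\int[L m]_x (gk x y)%:E = 1)%E.
Proof.
rewrite (@ge0_integral_euclid_prod _ _ (fun i a => gk1 (lam i) a (tnth y i))).
- by rewrite big1// => i _; exact: integral_gk1l.
- by move=> i; exact: measurable_gk1.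
- by move=> i a; rewrite gk1_ge0// ltW.
Qed.

Lemma integral_gkr x : (\int[L m]_y (gk x y)%:E = 1)%E.
Proof. by under eq_integral do rewrite gk_sym; exact: integral_gkl. Qed.

Lemma integral_gk_conv x y : (\int[L m]_z (gk x z * gk z y)%:E =
  (gauss_kernel (fun i => Num.sqrt 2 * lam i) x y)%:E)%E.
Proof.
under eq_integral do rewrite -big_split /=.
rewrite (@ge0_integral_euclid_prod _ _
  (fun i a => gk1 (lam i) (tnth x i) a * gk1 (lam i) a (tnth y i))).
- rewrite -prodEFin; apply: eq_bigr => i _.
  exact: integral_gk1_conv.
- by move=> i; apply: measurable_funM; exact: measurable_gk1.
- by move=> i a; rewrite mulr_ge0// gk1_ge0// ltW.
Qed.

End gauss_kernel.

Section gauss_char_multi.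
Context {R : realType}.
Local Notation L := (lebesgue_euclid R).
Local Notation leb := (@lebesgue_measure R).

(** The density of independent centred Gaussians with standard deviations [s i]. *)
Definition gdens m (s : 'I_m -> R) (w : euclid R m) : R :=
  \prod_(i < m) gk1 (s i) (tnth w i) 0.

Lemma measurable_gdens m (s : 'I_m -> R) : measurable_fun setT (gdens s).
Proof.
by apply: (measurable_prod_tnth (h := fun i a => gk1 (s i) a 0)) => i; exact: measurable_gk1.
Qed.

Lemma gdens_ge0 m (s : 'I_m -> R) w : (forall i, 0 < s i) -> 0 <= gdens s w.
Proof. by move=> s0; apply: prodr_ge0 => i _; rewrite gk1_ge0// ltW. Qed.

Lemma integral_gdens m (s : 'I_m -> R) : (forall i, 0 < s i) ->
  (\int[L m]_w (gdens s w)%:E = 1)%E.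
Proof.
move=> s0; rewrite (@ge0_integral_euclid_prod _ _ (fun i a => gk1 (s i) a 0)).
- by rewrite big1// => i _; exact: integral_gk1l.
- by move=> i; exact: measurable_gk1.
- by move=> i a; rewrite gk1_ge0// ltW.
Qed.

Lemma measurable_dotp m d (T : measurableType d) (f g : T -> euclid R m) :
  measurable_fun setT f -> measurable_fun setT g ->
  measurable_fun setT (fun t => dotp (f t) (g t)).
Proof.
move=> mf mg; apply: measurable_sum => i.
by apply: measurable_funM; apply: measurableT_comp (measurable_tnth i) _.
Qed.

Lemma measurable_cos : measurable_fun setT (@cos R).
Proof. by apply: continuous_measurable_fun; exact: continuous_cos. Qed.

Lemma measurable_sin : measurable_fun setT (@sin R).
Proof. by apply: continuous_measurable_fun; exact: continuous_sin. Qed.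

Lemma dotp_tcons m (u : euclid R m.+1) (a : measurableTypeR R) (w : euclid R m) :
  dotp u (tcons (a, w)) = tnth u ord0 * a + dotp [tuple of behead u] w.
Proof.
rewrite /dotp big_ord_recl tconsE unlift_none; congr (_ + _).
apply: eq_bigr => i _; rewrite tconsE liftK; congr (_ * _).
by rewrite [in LHS](tuple_eta u) tnthS.
Qed.

(** The factor [c] collects the coordinates that have already been integrated; adding [1]
    keeps the integrand nonnegative. *)
Lemma gauss_char1 (s c t theta : R) : 0 < s -> 0 <= c <= 1 ->
  (\int[leb]_a (gk1 s a 0 * (1 + c * cos (t * a + theta)))%:E =
  (1 + c * (cos theta * expR (- (s * t) ^+ 2 / 2)))%:E)%E.
Proof.
move=> s0 c01.
have mc : measurable_fun setT (fun a : R => cos (t * a + theta)).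
  apply: (measurableT_comp measurable_cos).
  by apply: measurable_funD => //; exact: measurable_funM.
have i1 : leb.-integrable setT (EFin \o (fun a : R => gk1 s a 0)) by exact: integrable_gk1.
have i2 : leb.-integrable setT (EFin \o (fun a : R => gk1 s a 0 * cos (t * a + theta))).
  apply: (rintegrable_le i1).
    by apply: measurable_funM => //; exact: measurable_gk1.
  by move=> a; rewrite normrM ler_piMr// cos_max.
have i3 := rintegrableZ c i2.
transitivity (\int[leb]_a ((gk1 s a 0)%:E + (c * (gk1 s a 0 * cos (t * a + theta)))%:E))%E.
  by apply: eq_integral => a _; rewrite -EFinD; congr EFin; ring.
rewrite integralD_EFin// integral_gk1l// EFinD; congr (_ + _)%E.
rewrite -[LHS]fineK; last exact: integrable_fin_num.
by rewrite -/(Rintegral _ _ _) RintegralZl// gauss_char.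
Qed.

(** Integrating one coordinate at a time; the term [1 + cos] is nonnegative, which allows
    iterated integration without integrability conditions. *)
Lemma gauss_char_multi m (s : 'I_m -> R) (u : euclid R m) (theta : R) :
  (forall i, 0 < s i) ->
  (\int[L m]_w (gdens s w * (1 + cos (dotp u w + theta)))%:E =
  (1 + cos theta * \prod_(i < m) expR (- (s i * tnth u i) ^+ 2 / 2))%:E)%E.
Proof.
elim: m s u theta => [|m ih] s u theta s0.
  rewrite ge0_integral_euclid0 /gdens /dotp !big_ord0.
  by rewrite mul1r add0r mulr1.
have mG : measurable_fun setT (fun w : euclid R m.+1 => (gdens s w * (1 + cos (dotp u w + theta)))%:E).
  apply/measurable_EFinP; apply: measurable_funM; first exact: measurable_gdens.
  apply: measurable_funD => //; apply: (measurableT_comp measurable_cos).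
  by apply: measurable_funD => //; exact: measurable_dotp.
have cos0 t : 0 <= 1 + cos t :> R by have := cos_geN1 t; lra.
rewrite (ge0_integral_euclidS mG); last first.
  by move=> w; rewrite lee_fin mulr_ge0 ?gdens_ge0.
pose c := \prod_(i < m) expR (- (s (lift ord0 i) * tnth u (lift ord0 i)) ^+ 2 / 2) : R.
have c01 : 0 <= c <= 1.
  rewrite /c [X in X && _]prodr_ge0/=; last by move=> i _; exact: expR_ge0.
  apply: prodr_ile1 => i _; rewrite expR_ge0/= -[leRHS]expR0 ler_expR.
  by rewrite mulNr oppr_le0 divr_ge0 ?sqr_ge0.
transitivity (\int[leb]_a (gk1 (s ord0) a 0 * (1 + c * cos (tnth u ord0 * a + theta)))%:E)%E.
  apply: eq_integral => a _.
  have e w : gdens s (tcons (a, w)) * (1 + cos (dotp u (tcons (a, w)) + theta)) =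
     gk1 (s ord0) a 0 * (gdens (fun i => s (lift ord0 i)) w *
       (1 + cos (dotp [tuple of behead u] w + (tnth u ord0 * a + theta)))).
    rewrite dotp_tcons /gdens (prod_tcons (fun i b => gk1 (s i) b 0)) -mulrA; congr (_ * (_ * (_ + cos _))).
    by ring.
  under eq_integral do rewrite e EFinM.
  rewrite ge0_integralZl//; last 3 first.
  - apply/measurable_EFinP; apply: measurable_funM; first exact: measurable_gdens.
    apply: measurable_funD => //; apply: (measurableT_comp measurable_cos).
    by apply: measurable_funD => //; exact: measurable_dotp.
  - by move=> w _; rewrite lee_fin mulr_ge0 ?gdens_ge0.
  - by rewrite lee_fin gk1_ge0// ltW.
  rewrite [X in (_ * X)%E](ih (fun i => s (lift ord0 i)) [tuple of behead u]) -?EFinM//.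
  congr (_ * (_ + _))%:E; rewrite mulrC; congr (_ * _); apply: eq_bigr => i _.
  by rewrite [in RHS](tuple_eta u) tnthS.
rewrite gauss_char1// big_ord_recl; congr (_ + _)%:E; rewrite /c; ring.
Qed.

End gauss_char_multi.

(** * Probability measures given by a density *)

Section density_prob.
Context d (T : measurableType d) (R : realType) (mu : {measure set T -> \bar R}).
Variables (f : T -> R) (mf : measurable_fun setT f) (f0 : forall x, 0 <= f x).

(** The total mass is an argument for the same reason as the hypotheses of
    [density_measure]. *)
Definition density_prob of (\int[mu]_x (f x)%:E = 1)%E := density_measure mu mf f0.

Hypothesis f1 : (\int[mu]_x (f x)%:E = 1)%E.

HB.instance Definition _ := Measure.on (density_prob f1).

Let density_prob_setT : density_prob f1 setT = 1%E. Proof. exact: f1. Qed.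

HB.instance Definition _ := @Measure_isProbability.Build _ _ R (density_prob f1) density_prob_setT.

End density_prob.

(** * Fourier representation of the quadratic form *)

Section quadratic_form.
Context {R : realType} (m : nat).
Local Notation L := (lebesgue_euclid R).
Context dO (O : measurableType dO).
Variables (P : {sigma_finite_measure set (euclid R m) -> \bar R})
  (Q : {sigma_finite_measure set O -> \bar R}) (phi : O -> euclid R m).
Hypotheses (P1 : P setT = 1%E) (Q1 : Q setT = 1%E) (mphi : measurable_fun setT phi).

(** Integration against the signed measure given by the difference of [P] and of the law of
    [phi] under [Q]. *)
Definition dint (G : euclid R m -> R) : R := \int[P]_x G x - \int[Q]_z G (phi z).

Let bphi (G : euclid R m -> R) : bfun G -> bfun (fun z => G (phi z)).
Proof. by move=> bG; exact: bfun_comp bG mphi. Qed.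

Lemma dintD f g : bfun f -> bfun g -> dint (fun x => f x + g x) = dint f + dint g.
Proof.
move=> bf bg; rewrite /dint expectD// expectD//; [|exact: bphi..].
by rewrite opprD addrACA.
Qed.

Lemma dintZ c f : bfun f -> dint (fun x => c * f x) = c * dint f.
Proof. by move=> bf; rewrite /dint expectZl// expectZl//; [rewrite mulrBr|exact: bphi]. Qed.

Lemma dintZr c f : bfun f -> dint (fun x => f x * c) = dint f * c.
Proof. by move=> bf; rewrite /dint expectZr// expectZr//; [rewrite mulrBl|exact: bphi]. Qed.

Lemma bfun_dint dT (T : measurableType dT) (g : T * euclid R m -> R) :
  bfun g -> bfun (fun t => dint (fun x => g (t, x))).
Proof.
move=> bg; apply: bfunB; first exact: (bfun_expectr P1 bg).
apply: (bfun_expectr Q1 (f := fun w => g (w.1, phi w.2))).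
by apply: bfun_comp bg _; apply: measurable_fun_pair => //; exact: measurableT_comp.
Qed.

Lemma dint_swap dT (T : measurableType dT) (nu : {sigma_finite_measure set T -> \bar R})
    (g : T * euclid R m -> R) : nu setT = 1%E -> bfun g ->
  dint (fun x => \int[nu]_t g (t, x)) = \int[nu]_t dint (fun x => g (t, x)).
Proof.
move=> nu1 bg.
have bg2 : bfun (fun w : T * O => g (w.1, phi w.2)).
  by apply: bfun_comp bg _; apply: measurable_fun_pair => //; exact: measurableT_comp.
rewrite /dint expectB//; [|exact: (bfun_expectr P1 bg)|exact: (bfun_expectr Q1 bg2)].
by rewrite (expect_swap nu1 P1 bg) (expect_swap nu1 Q1 bg2).
Qed.

(** The squared modulus of the Fourier transform of this signed measure. *)
Definition power_spectrum (w : euclid R m) : R :=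
  dint (fun x => cos (dotp x w)) ^+ 2 + dint (fun x => sin (dotp x w)) ^+ 2.

Let bcos2 : bfun (fun t : euclid R m * euclid R m => cos (dotp t.2 t.1)).
Proof.
split; first by apply: (measurableT_comp measurable_cos); exact: measurable_dotp.
by exists 1 => t; exact: cos_max.
Qed.

Let bsin2 : bfun (fun t : euclid R m * euclid R m => sin (dotp t.2 t.1)).
Proof.
split; first by apply: (measurableT_comp measurable_sin); exact: measurable_dotp.
by exists 1 => t; exact: sin_max.
Qed.

Let bcos w : bfun (fun x : euclid R m => cos (dotp x w)).
Proof. exact: (bfun_pairr w bcos2). Qed.

Let bsin w : bfun (fun x : euclid R m => sin (dotp x w)).
Proof. exact: (bfun_pairr w bsin2). Qed.

Lemma bfun_power_spectrum : bfun power_spectrum.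
Proof.
by apply: bfunD; apply: bfunX; [exact: (bfun_dint bcos2)|exact: (bfun_dint bsin2)].
Qed.

Lemma power_spectrum_ge0 w : 0 <= power_spectrum w.
Proof. by rewrite addr_ge0// sqr_ge0. Qed.

Variable lam : 'I_m -> R.
Hypothesis lam0 : forall i, 0 < lam i.
Local Notation gk := (gauss_kernel lam).

Lemma bfun_gk dT (T : measurableType dT) (f g : T -> euclid R m) :
  measurable_fun setT f -> measurable_fun setT g -> bfun (fun t => gk (f t) (g t)).
Proof.
move=> mf mg; split; first exact: measurable_gk.
by exists (gk_peak lam) => t; rewrite ger0_norm ?gk_ge0// gk_le.
Qed.

Let s i := (lam i)^-1.
Let s0 i : 0 < s i. Proof. by rewrite invr_gt0. Qed.
Let gam : probability (euclid R m) R :=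
  density_prob (measurable_gdens s) (fun w => gdens_ge0 w s0) (integral_gdens s0).
Let gam1 : gam setT = 1%E. Proof. exact: probability_setT. Qed.

(** The Fourier transform of the kernel, normalized so that it integrates to the value of the
    kernel on the diagonal. *)
Definition spectral (w : euclid R m) : R :=
  (2 * pi) ^- m * expR (- (\sum_(i < m) (lam i * tnth w i) ^+ 2) / 2).

Let spectralE w : spectral w = gk_peak lam * gdens s w.
Proof.
rewrite /spectral /gk_peak /gdens -big_split /= mulNr mulr_suml -sumrN expR_sum.
rewrite -exprVn -[X in _ ^+ X](card_ord m) -prodr_const -big_split /=.
have sp : 0 < Num.sqrt (2 * pi) :> R by rewrite sqrtr_gt0 mulr_gt0 ?pi_gt0.
have sp2 : Num.sqrt (2 * pi) ^+ 2 = 2 * pi :> R by rewrite sqr_sqrtr// mulr_ge0 ?pi_ge0.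
apply: eq_bigr => i _; rewrite /gk1 /s subr0 mulrA; congr (_ * expR _).
  by rewrite -[X in X^-1 = _]sp2; field; rewrite (gt_eqF (lam0 i)) (gt_eqF sp).
by field; rewrite (gt_eqF (lam0 i)).
Qed.

Let gk_cos x y : gk x y = gk_peak lam * \int[gam]_w cos (dotp x w - dotp y w).
Proof.
have -> : \int[gam]_w cos (dotp x w - dotp y w) =
    \prod_(i < m) expR (- (s i * (tnth x i - tnth y i)) ^+ 2 / 2).
  pose u : euclid R m := [tuple tnth x i - tnth y i | i < m].
  have ue w : dotp x w - dotp y w = dotp u w + 0.
    rewrite addr0 /dotp -sumrB; apply: eq_bigr => i _.
    by rewrite tnth_mktuple mulrBl.
  have bc : bfun (fun w => cos (dotp u w + 0)).
    split; last by exists 1 => w; exact: cos_max.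
    apply: (measurableT_comp measurable_cos); apply: measurable_funD => //.
    exact: measurable_dotp.
  under eq_Rintegral do rewrite ue.
  apply: (@addrI _ 1).
  rewrite -[in LHS](@expect_cst _ _ R gam _ 1)// -expectD//; last exact: bfun_cst.
  apply: EFin_inj; rewrite EFin_Rintegral//; last by apply: bfunD => //; exact: bfun_cst.
  rewrite (@ge0_integral_density _ _ _ gam (L m) _ (measurable_gdens s) (fun w => gdens_ge0 w s0)).
  - under eq_integral do rewrite -EFinM mulrC.
    rewrite gauss_char_multi// cos0 mul1r; congr (_ + _)%:E; apply: eq_bigr => i _.
    by rewrite tnth_mktuple.
  - by [].
  - by apply/measurable_EFinP; apply: measurable_funD => //; case: bc.
  - by move=> w; rewrite lee_fin; have := cos_geN1 (dotp u w + 0); lra.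
rewrite /gk_peak -big_split /=; apply: eq_bigr => i _; congr (_ * expR _).
by rewrite /s; field; rewrite (gt_eqF (lam0 i)).
Qed.

(** The kernel is a mean of [cos (<x - y, w>)] over Gaussian frequencies [w], and the addition
    formula for the cosine separates [x] from [y]: the energy is the integral of the power
    spectrum against the spectral density. *)
Lemma quadratic_form_spectrum :
  ((dint (fun x => dint (fun y => gk x y)))%:E =
   \int[L m]_w (spectral w * power_spectrum w)%:E)%E.
Proof.
have bD : bfun (fun a : (euclid R m * euclid R m) * euclid R m =>
    cos (dotp a.1.2 a.1.1 - dotp a.2 a.1.1)).
  split; last by exists 1 => a; exact: cos_max.
  apply: (measurableT_comp measurable_cos); apply: measurable_funB;
  apply: measurable_dotp => //; by apply: measurableT_comp.
have e : dint (fun x => dint (fun y => gk x y)) =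
    gk_peak lam * \int[gam]_w power_spectrum w.
  have b2 x : bfun (fun a : euclid R m * euclid R m => cos (dotp x a.1 - dotp a.2 a.1)).
    by apply: (bfun_comp (g := fun a => ((a.1, x), a.2)) bD); do !apply: measurable_fun_pair.
  have e1 x : dint (fun y => gk x y) =
      gk_peak lam * \int[gam]_w dint (fun y => cos (dotp x w - dotp y w)).
    rewrite -(dint_swap (nu := gam) gam1 (b2 x)) -dintZ.
      by congr dint; apply/funext => y; exact: gk_cos.
    exact: (bfun_expectl gam1 (b2 x)).
  have b3 : bfun (fun a : euclid R m * euclid R m => dint (fun y => cos (dotp a.2 a.1 - dotp y a.1))).
    exact: (bfun_dint bD).
  rewrite (_ : (fun x => dint _) = fun x =>
     gk_peak lam * \int[gam]_w dint (fun y => cos (dotp x w - dotp y w))); last first.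
    by apply/funext => x; exact: e1.
  rewrite dintZ; last exact: (bfun_expectl gam1 b3).
  rewrite (dint_swap (nu := gam) gam1 b3); congr (_ * _); apply: eq_Rintegral => w _.
  rewrite /power_spectrum !expr2.
  rewrite -dintZr// -dintZr// -dintD; [|by apply: bfunM => //; exact: bfun_cst..].
  congr dint; apply/funext => x.
  rewrite -!dintZ// -dintD; [|by apply: bfunM => //; exact: bfun_cst..].
  by congr dint; apply/funext => y; rewrite cosB.
rewrite e EFinM EFin_Rintegral//; last exact: bfun_power_spectrum.
have pk : 0 <= gk_peak lam by apply: prodr_ge0 => i _; rewrite invr_ge0 mulr_ge0 ?sqrtr_ge0 ?ltW.
rewrite (@ge0_integral_density _ _ _ gam (L m) _ (measurable_gdens s) (fun w => gdens_ge0 w s0)).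
- have mS : measurable_fun setT power_spectrum by case: bfun_power_spectrum.
  rewrite -ge0_integralZl//.
  + by apply: eq_integral => w _; rewrite -!EFinM spectralE; congr EFin; ring.
  + by apply: emeasurable_funM; apply/measurable_EFinP => //; exact: measurable_gdens.
  + by move=> w _; rewrite mule_ge0 ?lee_fin ?power_spectrum_ge0 ?gdens_ge0.
- by [].
- by apply/measurable_EFinP; case: bfun_power_spectrum.
- by move=> w; rewrite lee_fin power_spectrum_ge0.
Qed.

End quadratic_form.

(** * Gaussian kernels form an approximate identity *)

Section cvg_helpers.
Local Open Scope ereal_scope.
Context {R : realType}.

Lemma cvge0_near (u : (\bar R)^nat) : (forall n, 0 <= u n) ->
  (forall e : R, (0 < e)%R -> \forall n \near \oo, u n <= e%:E) -> u n @[n --> \oo] --> 0.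
Proof.
move=> u0 ue; apply/fine_cvgP; split.
  near=> n; rewrite ge0_fin_numE//; apply: (@le_lt_trans _ _ 1%:E); last exact: ltry.
  by near: n; exact: ue.
apply/cvgrPdist_le => e e0; near=> n.
have une : u n <= e%:E by near: n; exact: ue.
rewrite sub0r normrN ger0_norm ?fine_ge0//= -lee_fin fineK//.
by rewrite ge0_fin_numE// (le_lt_trans une)// ltry.
Unshelve. all: by end_near. Qed.

Lemma near_cvge0 (u : (\bar R)^nat) : u n @[n --> \oo] --> 0 ->
  forall e : R, (0 < e)%R -> \forall n \near \oo, u n <= e%:E.
Proof.
move=> /fine_cvgP[uf /cvgrPdist_le uc] e e0; near=> n.
have un : u n \is a fin_num by near: n.
have : (`|0 - fine (u n)| <= e)%R by near: n; exact: uc.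
rewrite sub0r normrN => h; rewrite -[u n]fineK// lee_fin (le_trans _ h)// ler_norm.
Unshelve. all: by end_near. Qed.

Lemma cvg_integral_dominated0 d (T : measurableType d) (mu : {measure set T -> \bar R})
    (D : set T) (G : (T -> \bar R)^nat) (H : T -> \bar R) : measurable D ->
  (forall n, measurable_fun D (G n)) -> measurable_fun D H ->
  (forall n x, 0 <= G n x <= H x) -> \int[mu]_(x in D) H x < +oo ->
  (forall x, D x -> H x < +oo -> G ^~ x @ \oo --> 0) ->
  \int[mu]_(x in D) G n x @[n --> \oo] --> 0.
Proof.
move=> mD mG mH GH Hoo G0.
have H0 x : 0 <= H x by have /andP[] := GH 0%N x; exact: le_trans.
have iH : mu.-integrable D H.
  by apply/integrableP; split => //; under eq_integral do rewrite gee0_abs//.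
rewrite -[X in _ --> X](@integral0 _ _ _ mu D).
have dcv := @dominated_convergence _ _ _ mu D mD G (cst 0) H mG.
have [//|||_ _ //] := dcv _ _ iH.
- apply: filterS (integrable_ae mD iH) => x Hx Dx; apply: G0 => //.
  by have := Hx Dx; rewrite ge0_fin_numE.
- by apply/aeW => x n _; have /andP[g0 gh] := GH n x; rewrite gee0_abs.
Qed.

End cvg_helpers.

Section oscillation.
Local Open Scope ereal_scope.
Context d (T : measurableType d) (R : realType).
Variable mu : {sigma_finite_measure set T -> \bar R}.
Implicit Types (g : T * T -> R) (f h : T -> R).

(** Symmetric transition densities. *)
Definition markov_kernel g := [/\ measurable_fun setT g, forall w, (0 <= g w)%R,
  forall x y, g (x, y) = g (y, x) & forall x, \int[mu]_y (g (x, y))%:E = 1].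

(** The mean oscillation of [f] under one step of the kernel.  It dominates the [L1] distance of
    [f] to its smoothed version, and it tensorizes over coordinates by the triangle inequality. *)
Definition osc g f := \int[mu]_x \int[mu]_y (g (x, y) * `|f x - f y|)%:E.

Lemma measurable_iterated d1 d2 (T1 : measurableType d1) (T2 : measurableType d2)
    (nu : {sigma_finite_measure set T2 -> \bar R}) (G : T1 * T2 -> R) :
  measurable_fun setT G -> (forall w, (0 <= G w)%R) ->
  measurable_fun setT (fun x => \int[nu]_y (G (x, y))%:E).
Proof.
move=> mG G0; apply: (@measurable_fun_fubini_tonelli_F _ _ _ _ _ nu (EFin \o G)).
  exact/measurable_EFinP.
by move=> w /=; rewrite lee_fin.
Qed.

Lemma swap_iterated d1 d2 (T1 : measurableType d1) (T2 : measurableType d2)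
    (nu1 : {sigma_finite_measure set T1 -> \bar R})
    (nu2 : {sigma_finite_measure set T2 -> \bar R}) (G : T1 * T2 -> R) :
  measurable_fun setT G -> (forall w, (0 <= G w)%R) ->
  \int[nu1]_x \int[nu2]_y (G (x, y))%:E = \int[nu2]_y \int[nu1]_x (G (x, y))%:E.
Proof.
move=> mG G0; apply: (@fubini_tonelli _ _ _ _ _ nu1 nu2 (EFin \o G)).
  exact/measurable_EFinP.
by move=> w /=; rewrite lee_fin.
Qed.

Lemma measurable_osc_fun g f : markov_kernel g -> measurable_fun setT f ->
  measurable_fun setT (fun w => (g w * `|f w.1 - f w.2|)%R).
Proof.
move=> [mg _ _ _] mf; apply: measurable_funM => //; apply: measurableT_comp => //.
by apply: measurable_funB; apply: measurableT_comp.
Qed.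

Lemma osc_fun_ge0 g f w : markov_kernel g -> (0 <= g w * `|f w.1 - f w.2|)%R.
Proof. by move=> [_ g0 _ _]; rewrite mulr_ge0. Qed.

Lemma markov_meanl g f : markov_kernel g -> measurable_fun setT f -> (forall x, (0 <= f x)%R) ->
  \int[mu]_x \int[mu]_y (g (x, y) * f x)%:E = \int[mu]_x (f x)%:E.
Proof.
move=> [mg g0 gs g1] mf f0; apply: eq_integral => x _.
under eq_integral do rewrite mulrC EFinM.
rewrite ge0_integralZl ?g1 ?mule1 ?lee_fin//; last by move=> y _; rewrite lee_fin.
by apply/measurable_EFinP; apply: measurableT_comp mg _; exact: measurable_fun_pair.
Qed.

Lemma markov_meanr g f : markov_kernel g -> measurable_fun setT f -> (forall x, (0 <= f x)%R) ->
  \int[mu]_x \int[mu]_y (g (x, y) * f y)%:E = \int[mu]_x (f x)%:E.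
Proof.
move=> kg mf f0; have [mg g0 gs g1] := kg; rewrite -(markov_meanl kg mf f0).
rewrite (swap_iterated mu mu (G := fun w => (g w * f w.2)%R)).
- by apply: eq_integral => y _; apply: eq_integral => x _; rewrite gs.
- by apply: measurable_funM => //; exact: measurableT_comp.
- by move=> w; rewrite mulr_ge0.
Qed.

Lemma iterated_prod d1 d2 (T1 : measurableType d1) (T2 : measurableType d2)
    (nu1 : {sigma_finite_measure set T1 -> \bar R})
    (nu2 : {sigma_finite_measure set T2 -> \bar R}) (G : T1 * T2 -> R) :
  measurable_fun setT G -> (forall w, (0 <= G w)%R) ->
  \int[nu1]_x \int[nu2]_y (G (x, y))%:E = \int[nu1 \x nu2]_w (G w)%:E.
Proof.
move=> mG G0; rewrite (@fubini_tonelli1 _ _ _ _ _ nu1 nu2 (EFin \o G))//.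
exact/measurable_EFinP.
Qed.

(** Both marginals of a symmetric step started from [mu] are [mu]. *)
Lemma osc_triangle g f h : markov_kernel g -> measurable_fun setT f -> measurable_fun setT h ->
  osc g f <= osc g h + 2%:E * \int[mu]_x `|f x - h x|%:E.
Proof.
move=> kg mf mh; have [mg g0 gs g1] := kg.
pose D x : R := `|f x - h x|%R.
have mD : measurable_fun setT D by apply: measurableT_comp => //; exact: measurable_funB.
have D0 x : (0 <= D x)%R by rewrite normr_ge0.
have mD1 : measurable_fun setT (fun w => (g w * D w.1)%R).
  by apply: measurable_funM => //; exact: measurableT_comp.
have mD2 : measurable_fun setT (fun w => (g w * D w.2)%R).
  by apply: measurable_funM => //; exact: measurableT_comp.
have mof := measurable_osc_fun kg mf.
have moh := measurable_osc_fun kg mh.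
have e1 : \int[mu \x mu]_w (g w * D w.1)%:E = \int[mu]_x (D x)%:E.
  rewrite -(iterated_prod mu mu mD1) ?markov_meanl//.
  by move=> w; rewrite mulr_ge0.
have e2 : \int[mu \x mu]_w (g w * D w.2)%:E = \int[mu]_x (D x)%:E.
  rewrite -(iterated_prod mu mu mD2) ?markov_meanr//.
  by move=> w; rewrite mulr_ge0.
rewrite /osc (iterated_prod mu mu mof); last by move=> w; exact: osc_fun_ge0.
rewrite (iterated_prod mu mu moh); last by move=> w; exact: osc_fun_ge0.
rewrite mule_natl mule2n -{1}e1 -e2.
rewrite -ge0_integralD//; [|by move=> w _; rewrite lee_fin mulr_ge0|
  exact/measurable_EFinP|by move=> w _; rewrite lee_fin mulr_ge0|exact/measurable_EFinP].
rewrite -ge0_integralD//; [|by move=> w _; rewrite lee_fin mulr_ge0|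
  exact/measurable_EFinP|by move=> w _; rewrite adde_ge0 ?lee_fin ?mulr_ge0|
  by apply: emeasurable_funD; exact/measurable_EFinP].
apply: ge0_le_integral => //.
- by move=> w _; rewrite lee_fin mulr_ge0.
- exact/measurable_EFinP.
- by do !apply: emeasurable_funD; exact/measurable_EFinP.
- move=> w _; rewrite -!EFinD lee_fin -!mulrDr ler_wpM2l//.
  rewrite (_ : f w.1 - f w.2 = (h w.1 - h w.2) + ((f w.1 - h w.1) - (f w.2 - h w.2)))%R; last by ring.
  by rewrite (le_trans (ler_normD _ _))// lerD2l ler_normB.
Qed.

Lemma osc_le g f : markov_kernel g -> measurable_fun setT f ->
  osc g f <= 2%:E * \int[mu]_x `|f x|%:E.
Proof.
move=> kg mf; have := osc_triangle kg mf (@measurable_cst _ _ _ _ setT (0%R : R)).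
have -> : osc g (cst 0%R) = 0.
  rewrite /osc integral0_eq// => x _; rewrite integral0_eq// => y _.
  by rewrite subrr normr0 mulr0.
by rewrite add0e; under eq_integral do rewrite subr0.
Qed.

Lemma osc_ge0 g f : markov_kernel g -> 0 <= osc g f.
Proof.
move=> kg; apply: integral_ge0 => x _; apply: integral_ge0 => y _.
exact: (osc_fun_ge0 f (x, y) kg).
Qed.

Definition approx_id (g : nat -> T * T -> R) := forall f, measurable_fun setT f ->
  \int[mu]_x `|f x|%:E < +oo -> osc (g n) f @[n --> \oo] --> 0.

End oscillation.

Section power_kernel.
Local Open Scope ereal_scope.
Context d (T : measurableType d) (R : realType).
Variable mu : {sigma_finite_measure set T -> \bar R}.
Implicit Types (g : T * T -> R).

Definition power_kernel m g (w : m.-tuple T * m.-tuple T) : R :=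
  (\prod_(i < m) g (tnth w.1 i, tnth w.2 i))%R.
Arguments power_kernel m g w : clear implicits.

Lemma markov_power_kernel m g : markov_kernel mu g ->
  markov_kernel (power_measure mu m) (power_kernel m g).
Proof.
move=> [mg g0 gs g1]; split.
- apply: measurable_prod => i _; apply: (measurableT_comp mg).
  by apply: measurable_fun_pair; apply: measurableT_comp (measurable_tnth i) _.
- by move=> w; exact: prodr_ge0.
- by move=> x y; apply: eq_bigr => i _; rewrite gs.
- move=> x; rewrite (@ge0_integral_prod _ _ _ mu m (fun i a => g (tnth x i, a))).
  + by rewrite big1.
  + by move=> i; apply: (measurableT_comp mg); exact: measurable_fun_pair.
  + by [].
Qed.

Lemma power_kernel_tcons m g (a b : T) (x y : m.-tuple T) :
  power_kernel m.+1 g (tcons (a, x), tcons (b, y)) =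
  (g (a, b) * power_kernel m g (x, y))%R.
Proof.
rewrite /power_kernel big_ord_recl /= !tconsE unlift_none; congr (_ * _)%R.
by apply: eq_bigr => i _; rewrite !tconsE liftK.
Qed.

(** One step in all coordinates is a step in the first coordinate followed by a step in
    the others. *)
Lemma osc_power_step m g (f : m.+1.-tuple T -> R) :
  markov_kernel mu g -> measurable_fun setT f ->
  osc (power_measure mu m.+1) (power_kernel m.+1 g) f <=
  \int[power_measure mu m]_x osc mu g (fun a => f (tcons (a, x))) +
  \int[mu]_a osc (power_measure mu m) (power_kernel m g) (fun x => f (tcons (a, x))).
Proof.
move=> kg mf; pose nm := power_measure mu m; pose k := power_kernel m g.
have kk : markov_kernel nm k := markov_power_kernel m kg.
pose nu := power_measure mu m.+1; pose K := power_kernel m.+1 g.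
have kK : markov_kernel nu K := markov_power_kernel m.+1 kg.
have [mg g0 gs g1] := kg; have [mk k0 ks k1] := kk; have [mK K0 Ks K1] := kK.
have mF := measurable_osc_fun kK mf.
have mft : measurable_fun setT (fun w : T * m.-tuple T => f (tcons w)).
  exact: measurableT_comp mf (@measurable_tcons _ _ _).
pose W := (m.+1.-tuple T * m.+1.-tuple T)%type.
(* the first coordinate has already moved, the others have not *)
pose half (w : W) : m.+1.-tuple T := tcons (tnth w.2 ord0, [tuple of behead w.1]).
pose F1 (w : W) := (K w * `|f w.1 - f (half w)|)%R.
pose F2 (w : W) := (K w * `|f (half w) - f w.2|)%R.
have halfE a x b y : half (tcons (a, x), tcons (b, y)) = tcons (b, x).
  by rewrite /half /= tnth0; congr tcons; congr pair; exact/val_inj.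
have mh : measurable_fun setT half.
  apply: (measurableT_comp (@measurable_tcons _ _ _)); apply: measurable_fun_pair.
    by apply: measurableT_comp (measurable_tnth ord0) _.
  exact: (measurableT_comp (@measurable_behead _ _ _) measurable_fst).
have mF1 : measurable_fun setT F1.
  apply: measurable_funM => //; apply: measurableT_comp => //.
  by apply: measurable_funB; exact: measurableT_comp.
have mF2 : measurable_fun setT F2.
  apply: measurable_funM => //; apply: measurableT_comp => //.
  by apply: measurable_funB; exact: measurableT_comp.
have F10 w : (0 <= F1 w)%R by rewrite mulr_ge0.
have F20 w : (0 <= F2 w)%R by rewrite mulr_ge0.
have intS (Phi : m.+1.-tuple T -> R) : measurable_fun setT Phi -> (forall x, (0 <= Phi x)%R) ->
    \int[nu]_x (Phi x)%:E = \int[mu]_a \int[nm]_x (Phi (tcons (a, x)))%:E.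
  move=> mP P0; rewrite /nu ge0_integral_powerS//; exact/measurable_EFinP.
rewrite /osc (iterated_prod nu nu mF); last by move=> w; exact: (osc_fun_ge0 f w kK).
apply: (@le_trans _ _ (\int[nu \x nu]_w ((F1 w)%:E + (F2 w)%:E))).
  apply: ge0_le_integral => //.
  - by move=> w _; rewrite lee_fin mulr_ge0.
  - exact/measurable_EFinP.
  - by apply: emeasurable_funD; exact/measurable_EFinP.
  - move=> w _; rewrite -EFinD lee_fin -mulrDr ler_wpM2l//.
    by apply: le_trans (ler_normD _ _); rewrite le_eqVlt; apply/orP; left; apply/eqP; congr `|_|%R; ring.
rewrite ge0_integralD//; [|by move=> w _; rewrite lee_fin|exact/measurable_EFinP|
  by move=> w _; rewrite lee_fin|exact/measurable_EFinP].
rewrite -(iterated_prod nu nu mF1 F10) -(iterated_prod nu nu mF2 F20) (swap_iterated nu nu mF2 F20).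
rewrite {1 2}/nu ge0_integral_powerS; last 2 first.
- exact: (measurable_iterated nu mF1).
- by move=> x; apply: integral_ge0 => y _; rewrite lee_fin.
rewrite ge0_integral_powerS; last 2 first.
- apply: (measurable_iterated nu (G := fun w => F2 (w.2, w.1))) => //.
  by apply: (measurableT_comp mF2); exact: measurable_fun_pair.
- by move=> x; apply: integral_ge0 => y _; rewrite lee_fin.
apply: leeD.
  pose H (w : (T * m.-tuple T) * T) := (g (w.1.1, w.2) * `|f (tcons w.1) - f (tcons (w.2, w.1.2))|)%R.
  have mH : measurable_fun setT H.
    apply: measurable_funM.
      by apply: (measurableT_comp mg); apply: measurable_fun_pair => //; exact: measurableT_comp.
    apply: measurableT_comp => //; apply: measurable_funB; apply: (measurableT_comp mft) => //.
    by apply: measurable_fun_pair => //; exact: measurableT_comp.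
  have H0 w : (0 <= H w)%R by rewrite mulr_ge0.
  have inner a x : \int[nu]_v (F1 (tcons (a, x), v))%:E = \int[mu]_b (H ((a, x), b))%:E.
    rewrite (intS (fun v => F1 (tcons (a, x), v)))//; last first.
      by apply: (measurableT_comp mF1); exact: measurable_fun_pair.
    apply: eq_integral => b _.
    transitivity (\int[nm]_y ((H ((a, x), b))%:E * (k (x, y))%:E)).
      apply: eq_integral => y _; rewrite -EFinM /F1 /K power_kernel_tcons halfE /H /=.
      by rewrite mulrAC.
    rewrite ge0_integralZl ?k1 ?mule1 ?lee_fin//; last by move=> y _; rewrite lee_fin.
    by apply/measurable_EFinP; apply: (measurableT_comp mk); exact: measurable_fun_pair.
  rewrite (eq_integral (fun a => \int[nm]_x \int[mu]_b (H ((a, x), b))%:E)); last first.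
    by move=> a _; apply: eq_integral => x _; exact: inner.
  rewrite (@fubini_tonelli _ _ _ _ _ mu nm (fun u => \int[mu]_b (H (u, b))%:E))//.
  - exact: (measurable_iterated mu mH).
  - by move=> u; apply: integral_ge0 => v _; rewrite lee_fin.
rewrite le_eqVlt; apply/orP; left; apply/eqP; apply: eq_integral => b _.
apply: eq_integral => y _.
have mFv : measurable_fun setT (fun u => F2 (u, tcons (b, y))).
  by apply: (measurableT_comp mF2); exact: measurable_fun_pair.
rewrite (intS (fun u => F2 (u, tcons (b, y))))//.
rewrite (swap_iterated mu nm (G := fun w => F2 (tcons w, tcons (b, y))))//; last first.
  exact: (measurableT_comp mFv (@measurable_tcons _ _ _)).
apply: eq_integral => x _.
pose c : R := (k (y, x) * `|f (tcons (b, y)) - f (tcons (b, x))|)%R.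
transitivity (\int[mu]_a (c%:E * (g (b, a))%:E)).
  apply: eq_integral => a _; rewrite -EFinM /F2 /K power_kernel_tcons halfE /=.
  by rewrite gs -/k ks /c distrC -mulrA mulrC.
rewrite ge0_integralZl ?g1 ?mule1 ?lee_fin ?mulr_ge0//; last by move=> a _; rewrite lee_fin.
by apply/measurable_EFinP; apply: (measurableT_comp mg); exact: measurable_fun_pair.
Qed.

(** Induction on the number of coordinates.  For almost every value of the remaining
    coordinates the sections are integrable, and the oscillation of a section is dominated by
    twice its norm. *)
Lemma approx_id_power m (g : nat -> T * T -> R) : (forall n, markov_kernel mu (g n)) ->
  approx_id mu g -> approx_id (power_measure mu m) (fun n => power_kernel m (g n)).
Proof.
move=> kg ag; elim: m => [|m ih] f mf foo.
  rewrite (_ : (fun n => _) = cst 0); first exact: cvg_cst.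
  apply/funext => n; rewrite /osc !ge0_integral_power0.
  by rewrite subrr normr0 mulr0.
have mft : measurable_fun setT (fun w : T * m.-tuple T => f (tcons w)).
  exact: measurableT_comp mf (@measurable_tcons _ _ _).
have mf1 x : measurable_fun setT (fun a => f (tcons (a, x))).
  by apply: (measurableT_comp mft); exact: measurable_fun_pair.
have mf2 a : measurable_fun setT (fun x => f (tcons (a, x))).
  by apply: (measurableT_comp mft); exact: measurable_fun_pair.
have mnf : measurable_fun setT (fun w : T * m.-tuple T => `|f (tcons w)|%R) by exact: measurableT_comp.
have fooE : \int[mu]_a \int[power_measure mu m]_x `|f (tcons (a, x))|%:E < +oo.
  rewrite -(ge0_integral_powerS mu (G := fun y => `|f y|%:E))//.
  by apply/measurable_EFinP; exact: measurableT_comp.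
have fooE' : \int[power_measure mu m]_x \int[mu]_a `|f (tcons (a, x))|%:E < +oo.
  rewrite -(swap_iterated mu (power_measure mu m) mnf)//.
pose A n := \int[power_measure mu m]_x osc mu (g n) (fun a => f (tcons (a, x))).
pose B n := \int[mu]_a osc (power_measure mu m) (power_kernel m (g n)) (fun x => f (tcons (a, x))).
have kpg n := markov_power_kernel m (kg n).
have mosc d1 (T1 : measurableType d1) d2 (T2 : measurableType d2)
    (la : {sigma_finite_measure set T2 -> \bar R}) (h : T2 * T2 -> R) (F : T1 * T2 -> R) :
    markov_kernel la h -> measurable_fun setT F ->
    measurable_fun setT (fun x => osc la h (fun a => F (x, a))).
  move=> [mh h0 _ _] mF.
  apply: (@measurable_fun_fubini_tonelli_F _ _ _ _ _ la
    (fun u => \int[la]_b (h (u.2, b) * `|F u - F (u.1, b)|)%:E)).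
    apply: (measurable_iterated la (G := fun w => (h (w.1.2, w.2) * `|F w.1 - F (w.1.1, w.2)|)%R)).
      apply: measurable_funM.
        by apply: (measurableT_comp mh); apply: measurable_fun_pair => //; exact: measurableT_comp.
      apply: measurableT_comp => //; apply: measurable_funB; apply: (measurableT_comp mF) => //.
      by apply: measurable_fun_pair => //; exact: measurableT_comp.
    by move=> w; rewrite mulr_ge0.
  by move=> u; apply: integral_ge0 => b _; rewrite lee_fin mulr_ge0.
have A0 : A n @[n --> \oo] --> 0.
  apply: (@cvg_integral_dominated0 _ _ _ (power_measure mu m) setT _
    (fun x => 2%:E * \int[mu]_a `|f (tcons (a, x))|%:E)) => //.
  - move=> n; apply: (mosc _ _ _ _ mu (g n) (fun w => f (tcons (w.2, w.1)))) => //.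
    by apply: (measurableT_comp mft); exact: measurable_fun_pair.
  - apply: emeasurable_funM => //.
    apply: (measurable_iterated mu (G := fun w => `|f (tcons (w.2, w.1))|%R)) => //.
    by apply: measurableT_comp => //; apply: (measurableT_comp mft); exact: measurable_fun_pair.
  - by move=> n x; rewrite osc_ge0//= osc_le.
  - rewrite ge0_integralZl//.
    + by rewrite lte_mul_pinfty.
    + apply: (measurable_iterated mu (G := fun w => `|f (tcons (w.2, w.1))|%R)) => //.
      by apply: measurableT_comp => //; apply: (measurableT_comp mft); exact: measurable_fun_pair.
    + by move=> x _; exact: integral_ge0.
  - move=> x _ xoo; apply: ag => //.
    rewrite ltNge leye_eq; apply/eqP => xE; move: xoo; rewrite xE.
    by rewrite gt0_muley// ltxx.
have B0 : B n @[n --> \oo] --> 0.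
  apply: (@cvg_integral_dominated0 _ _ _ mu setT _
    (fun a => 2%:E * \int[power_measure mu m]_x `|f (tcons (a, x))|%:E)) => //.
  - by move=> n; exact: (mosc _ _ _ _ (power_measure mu m) (power_kernel m (g n)) (fun w => f (tcons w))).
  - apply: emeasurable_funM => //.
    exact: (measurable_iterated (power_measure mu m) mnf).
  - by move=> n x; rewrite osc_ge0//= osc_le.
  - rewrite ge0_integralZl//.
    + by rewrite lte_mul_pinfty.
    + exact: (measurable_iterated (power_measure mu m) mnf).
    + by move=> x _; exact: integral_ge0.
  - move=> x _ xoo; apply: ih => //.
    rewrite ltNge leye_eq; apply/eqP => xE; move: xoo; rewrite xE.
    by rewrite gt0_muley// ltxx.
apply: (@squeeze_cvge _ _ _ _ (cst 0) _ (fun n => A n + B n)).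
- by apply: nearW => n; rewrite osc_ge0 /=; [exact: osc_power_step|exact: markov_power_kernel].
- exact: cvg_cst.
- by rewrite -[X in _ --> X](adde0 0); exact: cvgeD.
Qed.

End power_kernel.

Section approx_id_line.
Local Open Scope ereal_scope.
Context {R : realType}.
Local Notation leb := (@lebesgue_measure R).

Lemma markov_gk1 (l : R) : (0 < l)%R -> markov_kernel leb (fun w => gk1 l w.1 w.2).
Proof.
move=> l0; split.
- exact: measurable_gk1.
- by move=> w; rewrite gk1_ge0// ltW.
- by move=> x y; rewrite gk1_sym.
- by move=> x; rewrite integral_gk1r.
Qed.

Let lk (n : nat) : R := (n.+1%:R^-1)%R.
Let lk0 n : (0 < lk n)%R. Proof. by rewrite invr_gt0. Qed.
Let g n (w : R * R) : R := gk1 (lk n) w.1 w.2.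
Let kg n : markov_kernel leb (g n). Proof. exact: markov_gk1. Qed.

Let mind (N : R) : measurable_fun setT (fun x : R => (`|x| < N)%R%:R : R).
Proof.
rewrite (_ : (fun x => _) = \1_`](- N)%R, N[%classic); first exact: measurable_indic.
by apply/funext => x; rewrite indicE mem_setE in_itv /= ltr_norml.
Qed.

(** Near [x] the increments are small by continuity; far from [x] they are bounded by a
    multiple of the distance, whose mean is of the order of the bandwidth. *)
Lemma cvg_mean_gk1 (f : R -> R) (K x : R) : measurable_fun setT f ->
  (forall y, `|f y| <= K)%R -> {for x, continuous f} ->
  \int[leb]_y (g n (x, y) * `|f x - f y|)%:E @[n --> \oo] --> 0.
Proof.
move=> mf fK fx; apply: cvge0_near => [n|e e0].
  by apply: integral_ge0 => y _; rewrite lee_fin mulr_ge0 ?gk1_ge0 ?(ltW (lk0 n)).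
have [del /= del0 Hdel] : exists2 del : R, (0 < del)%R &
   forall y, (`|x - y| < del -> `|f x - f y| <= e / 2)%R.
  have e2 : (0 < e / 2)%R by lra.
  move/cvgrPdist_le : fx => /(_ _ e2) /nbhs_ballP[del del0 H].
  by exists del => // y xy; exact: H.
have K0 : (0 <= K)%R := le_trans (normr_ge0 _) (fK x).
pose c := (2 * K / del)%R.
have c0 : (0 <= c)%R by rewrite divr_ge0 ?mulr_ge0// ltW.
have fb y : (`|f x - f y| <= e / 2 + c * `|x - y|)%R.
  have [/Hdel h|h] := ltP `|x - y|%R del.
    by rewrite (le_trans h)// lerDl mulr_ge0.
  apply: (@le_trans _ _ (2 * K)%R).
    rewrite (le_trans (ler_normB _ _))// (_ : 2 * K = K + K)%R ?lerD//; ring.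
  rewrite -[leLHS]add0r lerD//; first by lra.
  by rewrite /c mulrAC ler_pdivlMr// ler_wpM2l// mulr_ge0.
pose C := (c * (2 * Num.sqrt 2))%R.
have C0 : (0 <= C)%R by rewrite mulr_ge0// mulr_ge0// sqrtr_ge0.
have s2 : (0 < Num.sqrt 2 :> R)%R by rewrite sqrtr_gt0.
have bound n : \int[leb]_y (g n (x, y) * `|f x - f y|)%:E <= (e / 2 + C * lk n)%:E.
  have l0 := lk0 n.
  have mg : measurable_fun setT (fun y => g n (x, y)) by have [mg' _ _ _] := kg n; apply: (measurableT_comp mg'); exact: measurable_fun_pair.
  have sl0 : (0 < Num.sqrt 2 * lk n)%R by rewrite mulr_gt0.
  apply: (@le_trans _ _ (\int[leb]_y ((e / 2)%:E * (gk1 (lk n) x y)%:E +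
      (C * lk n)%:E * (gk1 (Num.sqrt 2 * lk n) x y)%:E))).
    apply: ge0_le_integral => //.
    - by move=> y _; rewrite lee_fin mulr_ge0 ?gk1_ge0 ?(ltW l0).
    - apply/measurable_EFinP; apply: measurable_funM; first exact: mg.
      by apply: measurableT_comp => //; exact: measurable_funB.
    - by apply: emeasurable_funD; apply: emeasurable_funM => //;
        apply/measurable_EFinP; exact: measurable_gk1.
    - move=> y _; rewrite -!EFinM -EFinD lee_fin.
      have gx l : gk1 l x y = gk1 l (x - y) 0 by rewrite /gk1 subr0.
      have g0 : (0 <= gk1 (lk n) x y)%R by rewrite gk1_ge0// ltW.
      apply: le_trans (_ : _ <= gk1 (lk n) x y * (e / 2 + c * `|x - y|))%R _.
        by rewrite ler_wpM2l.
      rewrite mulrDr mulrC lerD2l mulrCA [leRHS](_ : _ =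
        c * (2 * Num.sqrt 2 * lk n * gk1 (Num.sqrt 2 * lk n) (x - y) 0))%R; last first.
        by rewrite -gx /C; ring.
      rewrite ler_wpM2l// mulrC; apply: le_trans (gk1_moment (x - y) l0).
      by rewrite normrM -gx (ger0_norm g0).
  rewrite ge0_integralD//; last 4 first.
  - by move=> y _; rewrite -EFinM lee_fin mulr_ge0 ?gk1_ge0 ?(ltW l0)//; lra.
  - by apply: emeasurable_funM => //; apply/measurable_EFinP; exact: measurable_gk1.
  - by move=> y _; rewrite -EFinM lee_fin mulr_ge0 ?gk1_ge0 ?(ltW sl0)// mulr_ge0// (ltW l0).
  - by apply: emeasurable_funM => //; apply/measurable_EFinP; exact: measurable_gk1.
  rewrite ge0_integralZl//; last 3 first.
  - by apply/measurable_EFinP; exact: measurable_gk1.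
  - by move=> y _; rewrite lee_fin gk1_ge0// ltW.
  - by rewrite lee_fin; lra.
  rewrite ge0_integralZl//; last 3 first.
  - by apply/measurable_EFinP; exact: measurable_gk1.
  - by move=> y _; rewrite lee_fin gk1_ge0// ltW.
  - by rewrite lee_fin mulr_ge0 ?(ltW l0).
  by rewrite !integral_gk1r// !mule1.
have e2 : (0 < e / 2)%R by lra.
have H : (fun n => C * lk n)%R @ \oo --> (C * 0)%R by apply: cvgMr; exact: cvg_harmonic.
move: H; rewrite mulr0 => /cvgrPdist_le /(_ _ e2); apply: filterS => n.
rewrite sub0r normrN => /(le_trans (ler_norm _)) H.
by apply: le_trans (bound n) _; rewrite lee_fin; lra.
Qed.

(** Only pairs with a point in the interval count, and by symmetry they cost at most twice the
    pairs whose first point lies in it.  There the mean increment tends to zero at every point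
    and is bounded, and the interval has finite measure. *)
Lemma osc_gk1_truncated (f : R -> R) (N : R) : continuous f ->
  osc leb (g n) (fun x => f x * (`|x| < N)%R%:R)%R @[n --> \oo] --> 0.
Proof.
move=> cf; pose h x : R := (f x * (`|x| < N)%R%:R)%R.
have mh : measurable_fun setT h.
  by apply: measurable_funM; [exact: continuous_measurable_fun|exact: mind].
have [K hK] : exists K, forall x, (`|h x| <= K)%R.
  have [N0|N0] := leP 0%R N; last first.
    exists 0%R => x; rewrite /h (_ : (_ < N)%R = false) ?mulr0 ?normr0//.
    by apply/negbTE; rewrite -leNgt (le_trans (ltW N0)).
  have NN : (- N <= N)%R by lra.
  have cnf : {within `[(- N)%R, N], continuous (fun x => `|f x|%R)}.
    apply: continuous_subspaceT => x; apply: (@continuous_comp _ _ _ f (fun y : R => `|y|%R)); first exact: cf.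
    exact: norm_continuous.
  have [c _ Hc] := EVT_max NN cnf.
  exists `|f c|%R => x; rewrite /h normrM.
  case: ltP => xN; rewrite ?normr0 ?mulr0// normr1 mulr1.
  by apply: Hc; rewrite in_itv /= -ler_norml ltW.
pose G n x : \bar R := \int[leb]_y (g n (x, y) * `|h x - h y|)%:E.
have mq n : measurable_fun setT (fun w : R * R => g n w * `|h w.1 - h w.2|)%R.
  exact: (measurable_osc_fun (kg n) mh).
have q0 n w : (0 <= g n w * `|h w.1 - h w.2|)%R.
  by rewrite mulr_ge0// /g gk1_ge0// ltW.
have mG n : measurable_fun setT (G n) by exact: (measurable_iterated leb (mq n)).
have G0 n x : 0 <= G n x by apply: integral_ge0 => y _; exact: (q0 n (x, y)).
pose D : set R := `](- N)%R, N[%classic.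
have lim : \int[leb]_(x in D) G n x @[n --> \oo] --> 0.
  apply: (@cvg_integral_dominated0 _ _ _ leb D _ (cst (2 * K)%:E)) => //.
  - exact: measurable_itv.
  - by move=> n; exact: measurable_funTS (mG n).
  - move=> n x; rewrite G0 /=.
    apply: (@le_trans _ _ (\int[leb]_y ((2 * K)%:E * (g n (x, y))%:E))).
      have [mgn g0 _ _] := kg n.
      apply: ge0_le_integral => //.
      + by move=> y _; exact: (q0 n (x, y)).
      + by apply/measurable_EFinP; apply: (measurableT_comp (mq n)); exact: measurable_fun_pair.
      + apply: emeasurable_funM => //.
        by apply/measurable_EFinP; apply: (measurableT_comp mgn); exact: measurable_fun_pair.
      + move=> y _; rewrite -EFinM lee_fin mulrC ler_wpM2r//.
        by rewrite (le_trans (ler_normB _ _))// (_ : 2 * K = K + K)%R ?lerD//; ring.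
    have [mgn g0 _ g1] := kg n.
    rewrite ge0_integralZl ?g1 ?mule1 ?lee_fin//.
    + by apply/measurable_EFinP; apply: (measurableT_comp mgn); exact: measurable_fun_pair.
    + by move=> y _; rewrite lee_fin.
    + by rewrite mulr_ge0// (le_trans _ (hK 0%R)).
  - have Doo : leb D < +oo.
      by rewrite /D lebesgue_measure_itv /=; case: ifP => _; rewrite ?ltry// -EFinB ltry.
    have K0 : (0 <= 2 * K)%R by rewrite mulr_ge0// (le_trans _ (hK 0%R)).
    rewrite integral_cst; last exact: measurable_itv.
    by apply: lte_mul_pinfty; rewrite ?lee_fin.
  - move=> x; rewrite /D /= in_itv/= => Dx _; apply: (cvg_mean_gk1 mh hK).
    have oD : \forall y \near x, (`|y| < N)%R.
      have xN : (`|x| < N)%R by rewrite ltr_norml.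
      have d0 : (0 < N - `|x|)%R by lra.
      near=> y; have yx : (`|x - y| < N - `|x|)%R by near: y; exact: (nbhsx_ballx x _ d0).
      have := ler_normD (y - x)%R x; rewrite subrK distrC; lra.
    rewrite /prop_for /continuous_at /h.
    have -> : (f x * (`|x| < N)%R%:R = f x)%R by rewrite (nbhs_singleton oD) mulr1.
    apply: (cvg_trans _ (cf x)); apply: near_eq_cvg; near=> y.
    by rewrite (_ : (`|y| < N)%R = true) ?mulr1//; near: y.
pose A n := \int[leb]_x \int[leb]_y (g n (x, y) * `|h x - h y| * (`|x| < N)%R%:R)%:E.
have AE n : A n = \int[leb]_(x in D) G n x.
  rewrite [RHS]integral_mkcond; apply: eq_integral => x _; rewrite patchE mem_setE in_itv /= -ltr_norml.
  by case: ifP => _; [under eq_integral do rewrite mulr1|rewrite integral0_eq// => y _; rewrite mulr0].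
have mA n : measurable_fun setT (fun w : R * R => g n w * `|h w.1 - h w.2| * (`|w.1| < N)%R%:R)%R.
  by apply: measurable_funM => //; exact: (measurableT_comp (mind N)).
have A0 n w : (0 <= g n w * `|h w.1 - h w.2| * (`|w.1| < N)%R%:R)%R by rewrite mulr_ge0.
have mA2 n : measurable_fun setT (fun w : R * R => g n w * `|h w.1 - h w.2| * (`|w.2| < N)%R%:R)%R.
  by apply: measurable_funM => //; exact: (measurableT_comp (mind N)).
have A20 n w : (0 <= g n w * `|h w.1 - h w.2| * (`|w.2| < N)%R%:R)%R by rewrite mulr_ge0.
have AS n : \int[leb \x leb]_w (g n w * `|h w.1 - h w.2| * (`|w.2| < N)%R%:R)%:E = A n.
  rewrite -(iterated_prod leb leb (mA2 n) (A20 n)) (swap_iterated leb leb (mA2 n) (A20 n)).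
  apply: eq_integral => y _; apply: eq_integral => x _.
  by rewrite /g /= gk1_sym distrC.
have le n : osc leb (g n) h <= 2%:E * \int[leb]_(x in D) G n x.
  rewrite -AE mule_natl mule2n -{1}AS /A (iterated_prod leb leb (mA n) (A0 n)).
  rewrite /osc (iterated_prod leb leb (mq n) (q0 n)).
  rewrite -ge0_integralD//; [|by move=> w _; rewrite lee_fin; exact: A20|
    by apply/measurable_EFinP; exact: mA2|by move=> w _; rewrite lee_fin; exact: A0|
    by apply/measurable_EFinP; exact: mA].
  apply: ge0_le_integral => //.
  - by move=> w _; exact: q0.
  - by apply/measurable_EFinP; exact: mq.
  - by apply: emeasurable_funD; apply/measurable_EFinP; [exact: mA2|exact: mA].
  - move=> w _; rewrite -EFinD lee_fin -mulrDr.
    have := q0 n w; have [w2|w2] := ltP `|w.2|%R N; have [w1|w1] := ltP `|w.1|%R N => q.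
    + by rewrite mulrDr mulr1 lerDl.
    + by rewrite mulrDr mulr1 mulr0 addr0.
    + by rewrite mulrDr mulr1 mulr0 add0r.
    + by rewrite /h ltNge w1 ltNge w2 !mulr0 subrr normr0 mulr0 mul0r.
apply: (@squeeze_cvge _ _ _ _ (cst 0) _ (fun n => 2%:E * \int[leb]_(x in D) G n x)).
- by apply: nearW => n; rewrite osc_ge0//= le.
- exact: cvg_cst.
- by rewrite -[X in _ --> X](mule0 2%:E); apply: cvgeZl.
Unshelve. all: by end_near. Qed.

(** Truncated continuous functions are dense in [L1], and the oscillation is continuous for
    the [L1] norm, uniformly in the bandwidth. *)
Lemma approx_id_gk1 : approx_id leb g.
Proof.
move=> f mf foo; apply: cvge0_near => [n|e e0]; first exact: osc_ge0.
have e8 : (0 < e / 8)%R by lra.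
have mnf : measurable_fun setT (fun x : R => `|f x|%:E) by apply/measurable_EFinP; exact: measurableT_comp.
have [N tail] : exists N : R, \int[leb]_x `|f x - f x * (`|x| < N)%R%:R|%:E <= (e / 8)%:E.
  have : \int[leb]_x `|f x - f x * (`|x| < n%:R)%R%:R|%:E @[n --> \oo] --> 0.
    apply: (@cvg_integral_dominated0 _ _ _ leb setT _ (fun x => `|f x|%:E)) => //.
    - move=> n; apply/measurable_EFinP; apply: measurableT_comp => //.
      by apply: measurable_funB => //; apply: measurable_funM => //; exact: mind.
    - move=> n x; rewrite !lee_fin normr_ge0 /=.
      by case: (_ < _)%R; rewrite ?mulr1 ?mulr0 ?subrr ?normr0 ?subr0.
    - move=> x _ _; apply: cvg_near_cst; near=> n.
      rewrite (_ : (_ < _)%R = true) ?mulr1 ?subrr ?normr0//.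
      near: n; exact: nbhs_infty_gtr.
  move=> /near_cvge0 /(_ _ e8) [n _ /(_ n (leqnn n)) ?].
  by exists n%:R.
pose D : set R := `](- N)%R, N[%classic.
have Doo : leb D < +oo.
  by rewrite /D lebesgue_measure_itv /=; case: ifP => _; rewrite ?ltry// -EFinB ltry.
have fi : leb.-integrable D (EFin \o f).
  apply: (@integrableS _ _ _ leb setT D) => //; first exact: measurable_itv.
  by apply/integrableP; split => //; exact/measurable_EFinP.
have [h [ch _ hf]] := approximation_continuous_integrable (measurable_itv _) Doo fi.
have := near_cvge0 hf e8 => -[n _ /(_ n (leqnn n)) fh].
pose hD x : R := (h n x * (`|x| < N)%R%:R)%R.
have mhD : measurable_fun setT hD.
  by apply: measurable_funM; [apply: continuous_measurable_fun; exact: ch|exact: mind].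
have dist : \int[leb]_x `|f x - hD x|%:E <= (e / 4)%:E.
  have mfn : measurable_fun setT (fun x => `|f x - f x * (`|x| < N)%R%:R|%:E).
    apply/measurable_EFinP; apply: measurableT_comp => //.
    by apply: measurable_funB => //; apply: measurable_funM => //; exact: mind.
  have mfh : measurable_fun setT (fun x => `|(f x - h n x) * (`|x| < N)%R%:R|%:E).
    apply/measurable_EFinP; apply: measurableT_comp => //.
    apply: measurable_funM; last exact: mind.
    apply: measurable_funB => //; by apply: continuous_measurable_fun; exact: ch.
  have -> : (e / 4 = e / 8 + e / 8)%R by field.
  rewrite EFinD; apply: le_trans (leeD tail fh).
  have -> : \int[leb]_(z in `](- N)%R, N[) `|(f z - h n z)%:E| =
      \int[leb]_x `|(f x - h n x) * (`|x| < N)%R%:R|%:E.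
    rewrite integral_mkcond; apply: eq_integral.
    move=> x _; rewrite patchE mem_setE in_itv /= -ltr_norml.
    by case: ifP => _; rewrite ?mulr1 ?mulr0 ?normr0.
  rewrite -ge0_integralD//.
  apply: ge0_le_integral => //.
  - apply/measurable_EFinP; apply: measurableT_comp => //; exact: measurable_funB.
  - exact: emeasurable_funD.
  - move=> x _; rewrite -EFinD lee_fin /hD.
    by case: (_ < _)%R; rewrite ?mulr1 ?mulr0 ?subrr ?normr0 ?subr0 ?add0r ?addr0.
have e2 : (0 < e / 2)%R by lra.
have := near_cvge0 (osc_gk1_truncated N (ch n)) e2.
apply: filterS => k ok.
apply: le_trans (osc_triangle (kg k) mf mhD) _.
have -> : (e = e / 2 + 2 * (e / 4))%R by field.
rewrite [X in (_ <= X)](_ : _ = (e / 2)%:E + 2%:E * (e / 4)%:E); last by rewrite -EFinM -EFinD.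
apply: leeD => //.
by apply: lee_wpmul2l.
Unshelve. all: by end_near. Qed.

Lemma approx_id_gauss m :
  approx_id (lebesgue_euclid R m) (fun n w => gauss_kernel (fun=> lk n) w.1 w.2).
Proof. exact: (@approx_id_power _ _ _ leb m g kg approx_id_gk1). Qed.

End approx_id_line.

(** * Smoothness weights and densities of laws *)

Section real_helpers.
Context {R : realType}.

Lemma integrable_le d (T : measurableType d) (mu : {measure set T -> \bar R}) (f g : T -> R) (K : R) :
  mu.-integrable setT (EFin \o f) -> measurable_fun setT g -> (forall x, `|g x| <= K * `|f x|) ->
  mu.-integrable setT (EFin \o g).
Proof.
move=> fi mg gf; apply: (rintegrable_le (rintegrableZ K fi) mg) => x.
by apply: le_trans (gf x) _; rewrite normrM ler_wpM2r// ler_norm.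
Qed.

Lemma measurable_integrable d (T : measurableType d) (mu : {measure set T -> \bar R}) (f : T -> R) :
  mu.-integrable setT (EFin \o f) -> measurable_fun setT f.
Proof. by case/integrableP => /measurable_EFinP. Qed.

Lemma EFin_Rintegral_integrable d (T : measurableType d) (mu : {measure set T -> \bar R}) (f : T -> R) :
  mu.-integrable setT (EFin \o f) -> (\int[mu]_x f x)%:E = (\int[mu]_x (f x)%:E)%E.
Proof. by move=> fi; rewrite fineK//; exact: integrable_fin_num. Qed.

(** Either the kernel keeps at least the fraction [exp (- 1 / 2)] of a frequency, or one product
    [lam i * |w|] is at least [1] for the largest bandwidth, and then the weighted
    power of [|w|] is at least [1]. *)
Lemma frequency_split m (lam : 'I_m -> R) (s : R) (w : euclid R m) :
  0 < s -> (forall i, 0 < lam i) ->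
  1 <= expR 2^-1 * expR (- (\sum_(i < m) (lam i * tnth w i) ^+ 2) / 2) +
       (\sum_(i < m) lam i `^ (2 * s)) * norm2 w `^ (2 * s).
Proof.
move=> s0 l0; set q := \sum_(i < m) (lam i * tnth w i) ^+ 2.
have A0 : 0 <= \sum_(i < m) lam i `^ (2 * s) by apply: sumr_ge0 => i _; exact: powR_ge0.
have [q1|q1] := leP q 1.
  rewrite -[leLHS]addr0 lerD//; last by rewrite mulr_ge0 ?powR_ge0.
  by rewrite -expRD -[leLHS]expR0 ler_expR; lra.
rewrite -[leLHS]add0r lerD ?mulr_ge0 ?expR_ge0//.
have [i0 _ /= imax] : exists2 i0 : 'I_m, true & forall i, lam i <= lam i0.
  case: m lam w l0 @q q1 {A0} => [|m] lam w l0 q q1.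
    by move: q1; rewrite /q big_ord0 ltNge ler01.
  by case: (@arg_maxP _ _ _ ord0 xpredT lam isT) => i _ H; exists i => // j; exact: H.
have nw : 0 <= norm2 w by exact: sqrtr_ge0.
have dw0 : 0 <= dotp w w by apply: sumr_ge0 => i _; rewrite -expr2 sqr_ge0.
have l1 : 1 <= lam i0 * norm2 w.
  rewrite -(ler_pXn2r (n := 2)) ?nnegrE ?mulr_ge0 ?(ltW (l0 _))// expr1n.
  apply: (le_trans (ltW q1)); rewrite exprMn sqr_sqrtr// /dotp mulr_sumr.
  apply: ler_sum => i _; rewrite exprMn -[tnth w i * tnth w i]expr2.
  by rewrite ler_wpM2r ?sqr_ge0// ler_pXn2r ?nnegrE ?(ltW (l0 _)).
have l2 : 1 <= lam i0 `^ (2 * s) * norm2 w `^ (2 * s).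
  have e1 : 1 `^ (2 * s) = 1 :> R by rewrite powR1.
  rewrite -powRM ?(ltW (l0 _))// -[leLHS]e1.
  by rewrite ge0_ler_powR ?nnegrE ?mulr_ge0 ?(ltW (l0 _)) ?(ltW s0).
apply: (le_trans l2); rewrite ler_wpM2r ?powR_ge0// (bigD1 i0)//= lerDl.
by apply: sumr_ge0 => i _; exact: powR_ge0.
Qed.

End real_helpers.

(** The law of [phi] under [Q] has density [f] with respect to [mu]. *)
Definition law_density (R : realType) d (T : measurableType d) d' (O : measurableType d')
  (Q : {measure set O -> \bar R}) (phi : O -> T) (mu : {measure set T -> \bar R}) (f : T -> R) :=
  forall G : T -> \bar R, measurable_fun setT G -> (forall x, 0 <= G x)%E ->
    (\int[Q]_z G (phi z) = \int[mu]_x (G x * (f x)%:E))%E.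

Section law_density.
Context (R : realType) d (T : measurableType d) d' (O : measurableType d').
Variables (Q : {sigma_finite_measure set O -> \bar R}) (phi : O -> T)
  (mu : {sigma_finite_measure set T -> \bar R}) (f : T -> R).
Hypotheses (Q1 : Q setT = 1%E) (mphi : measurable_fun setT phi)
  (mf : measurable_fun setT f) (f0 : forall x, 0 <= f x) (Qf : law_density Q phi mu f).

Lemma integral_density1 : (\int[mu]_x (f x)%:E = 1)%E.
Proof.
transitivity (\int[Q]_z 1)%E; last by rewrite integral_cst// mul1e.
rewrite (Qf (G := cst 1%E))//; first by under eq_integral do rewrite mul1e.
Qed.

Lemma integrable_density : mu.-integrable setT (EFin \o f).
Proof.
apply/integrableP; split; first exact/measurable_EFinP.
under eq_integral do rewrite /= ger0_norm//.
by rewrite integral_density1 ltry.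
Qed.

Lemma integrable_bfun_density G : bfun G -> mu.-integrable setT (EFin \o (fun x => G x * f x)).
Proof.
move=> [mG [K GK]]; apply: (integrable_le (K := K) integrable_density).
  exact: measurable_funM.
by move=> x; rewrite normrM ler_wpM2r.
Qed.

Lemma expect_density G : bfun G -> \int[Q]_z G (phi z) = \int[mu]_x (G x * f x).
Proof.
move=> bG; have [mG [K GK]] := bG.
have bGp : bfun (fun z => G (phi z)) by exact: bfun_comp bG mphi.
have GK0 x : 0 <= G x + K by have := GK x; rewrite ler_norml => /andP[]; lra.
have K1 : \int[mu]_x (K * f x) = K.
  by rewrite RintegralZl ?integrable_density// /Rintegral integral_density1 mulr1.
apply: (@addIr _ K); rewrite -[in RHS]K1 -[in LHS](expect_cst Q1 K) -expectD//; last exact: bfun_cst.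
rewrite -RintegralD//; last 2 first.
- exact: integrable_bfun_density.
- by apply: rintegrableZ; exact: integrable_density.
congr fine; transitivity (\int[mu]_x ((G x + K)%:E * (f x)%:E))%E; last first.
  by apply: eq_integral => x _; rewrite -EFinM mulrDl.
apply: (Qf (G := fun x => (G x + K)%:E)) => [|x]; last by rewrite lee_fin.
by apply/measurable_EFinP; exact: measurable_funD.
Qed.

Lemma expect_density_le (M : R) (G : T -> R) : (forall x, f x <= M) -> bfun G ->
  (forall x, 0 <= G x) ->
  ((\int[Q]_z G (phi z))%:E <= M%:E * \int[mu]_x (G x)%:E)%E.
Proof.
move=> fM bG G0; have [mG _] := bG.
have bGp : bfun (fun z => G (phi z)) by exact: bfun_comp bG mphi.
rewrite EFin_Rintegral// (Qf (G := fun x => (G x)%:E))//; last exact/measurable_EFinP.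
have M0 (x : T) : 0 <= M := le_trans (f0 x) (fM x).
have [->|/set0P[x0 _]] := eqVneq [set: T] set0; first by rewrite !integral_set0 mule0.
rewrite -ge0_integralZl//; [|exact/measurable_EFinP|by move=> x _; rewrite lee_fin|by rewrite lee_fin (M0 x0)].
apply: ge0_le_integral => //.
- by move=> x _; rewrite mule_ge0 ?lee_fin.
- by apply: emeasurable_funM; exact/measurable_EFinP.
- by apply: emeasurable_funM => //; exact/measurable_EFinP.
- by move=> x _; rewrite muleC lee_wpmul2r ?lee_fin.
Qed.

End law_density.

Section density_pair.
Context {R : realType} (m : nat).
Local Notation L := (lebesgue_euclid R).
Context dO (O : measurableType dO).
Variables (P : {sigma_finite_measure set (euclid R m) -> \bar R})
  (Q : {sigma_finite_measure set O -> \bar R}) (phi : O -> euclid R m).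
Hypotheses (P1 : P setT = 1%E) (Q1 : Q setT = 1%E) (mphi : measurable_fun setT phi).
Variables f q : euclid R m -> R.
Hypotheses (mf : measurable_fun setT f) (mq : measurable_fun setT q)
  (f0 : forall x, 0 <= f x) (q0 : forall x, 0 <= q x)
  (Pf : law_density P id (L m) f) (Qq : law_density Q phi (L m) q).

Local Notation psi := (fun x => f x - q x).
Local Notation Dint := (dint P Q phi).

Lemma integrable_psi : (L m).-integrable setT (EFin \o psi).
Proof.
apply: rintegrableB; first exact: (integrable_density P1 mf f0 Pf).
exact: (integrable_density Q1 mq q0 Qq).
Qed.

Lemma dint_density G : bfun G -> Dint G = \int[L m]_x (psi x * G x).
Proof.
move=> bG; rewrite /dint.
have /= -> := expect_density P1 (@measurable_id _ _ setT) mf f0 Pf bG.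
rewrite (expect_density Q1 mphi mq q0 Qq bG) -RintegralB//; last 2 first.
- exact: (integrable_bfun_density P1 mf f0 Pf bG).
- exact: (integrable_bfun_density Q1 mq q0 Qq bG).
by apply: eq_Rintegral => x _; rewrite mulrBl mulrC [q x * _]mulrC.
Qed.

Lemma normc_fourier w : Normc.normc (fourier psi w) ^+ 2 = power_spectrum P Q phi w.
Proof.
rewrite /fourier /= sqr_sqrtr ?addr_ge0 ?sqr_ge0// sqrrN /power_spectrum.
rewrite !dint_density//.
- split; last by exists 1 => x; exact: sin_max.
  by apply: (measurableT_comp measurable_sin); exact: measurable_dotp.
- split; last by exists 1 => x; exact: cos_max.
  by apply: (measurableT_comp measurable_cos); exact: measurable_dotp.
Qed.

End density_pair.

(** * Energy of the difference of two densities *)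

Section kernel_moments.
Context {R : realType} (m : nat) (lam : 'I_m -> R).
Hypothesis lam0 : forall i, 0 < lam i.
Local Notation L := (lebesgue_euclid R).
Local Notation gk := (gauss_kernel lam).

Let bgk2 : bfun (fun w : euclid R m * euclid R m => gk w.1 w.2).
Proof. exact: bfun_gk. Qed.

Let bgk x : bfun (gk x). Proof. exact: (bfun_pairr x bgk2). Qed.

Lemma gk_peak_ge0 : 0 <= gk_peak lam.
Proof. by apply: prodr_ge0 => i _; rewrite invr_ge0 mulr_ge0// ltW. Qed.

(** One factor of the square is bounded by the value on the diagonal, the density by [M], and
    the other factor integrates to one. *)
Lemma expect_gk_sqr_le dO (O : measurableType dO)
    (Q : {sigma_finite_measure set O -> \bar R}) (phi : O -> euclid R m) (q : euclid R m -> R) (M : R) x :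
  Q setT = 1%E -> measurable_fun setT phi -> measurable_fun setT q ->
  (forall y, 0 <= q y) -> law_density Q phi (L m) q -> (forall y, q y <= M) ->
  \int[Q]_z gk x (phi z) ^+ 2 <= gk_peak lam * M.
Proof.
move=> Q1 mphi mq q0 Qq qM; have [mg _] := bgk x.
have M0 : 0 <= M := le_trans (q0 [tuple 0 | _ < m]) (qM _).
rewrite -lee_fin; apply: le_trans (expect_density_le Q1 mphi mq q0 Qq qM (bfunX 2 (bgk x)) _) _.
  by move=> y; exact: sqr_ge0.
rewrite mulrC EFinM; apply: lee_wpmul2l; first by rewrite lee_fin.
apply: (@le_trans _ _ (\int[L m]_y ((gk_peak lam)%:E * (gk x y)%:E))%E).
  apply: ge0_le_integral => //.
  - by move=> y _; rewrite lee_fin sqr_ge0.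
  - by apply/measurable_EFinP; exact: measurable_funX.
  - by apply: emeasurable_funM => //; exact/measurable_EFinP.
  - by move=> y _; rewrite -EFinM lee_fin expr2 ler_wpM2r ?gk_ge0// gk_le.
rewrite ge0_integralZl//; last 3 first.
- exact/measurable_EFinP.
- by move=> y _; rewrite lee_fin gk_ge0.
- by rewrite lee_fin gk_peak_ge0.
by rewrite integral_gkr// mule1.
Qed.

(** Integrating out [x] convolves the two kernels, which doubles the variances. *)
Lemma integral_smoothed_prod d1 (O1 : measurableType d1) d2 (O2 : measurableType d2)
    (Q1 : {sigma_finite_measure set O1 -> \bar R}) (phi1 : O1 -> euclid R m)
    (Q2 : {sigma_finite_measure set O2 -> \bar R}) (phi2 : O2 -> euclid R m) :
  Q1 setT = 1%E -> Q2 setT = 1%E -> measurable_fun setT phi1 -> measurable_fun setT phi2 ->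
  (\int[L m]_x ((\int[Q1]_z gk x (phi1 z)) * (\int[Q2]_z gk x (phi2 z)))%:E =
  (\int[Q1]_z \int[Q2]_z' gauss_kernel (fun i => Num.sqrt 2 * lam i) (phi1 z) (phi2 z'))%:E)%E.
Proof.
move=> Q11 Q21 m1 m2.
have lam2 i : 0 < Num.sqrt 2 * lam i by rewrite mulr_gt0// sqrtr_gt0.
have b1 : bfun (fun w : euclid R m * O1 => gk w.1 (phi1 w.2)).
  by apply: bfun_gk => //; exact: measurableT_comp.
have b2 : bfun (fun w : euclid R m * O2 => gk w.1 (phi2 w.2)).
  by apply: bfun_gk => //; exact: measurableT_comp.
have [mb1 _] := b1; have [mb2 _] := b2.
pose e2 x := \int[Q2]_z gk x (phi2 z).
have [me2 _] : bfun e2 by exact: (bfun_expectr Q21 b2).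
have e20 x : 0 <= e2 x by apply: expect_ge0 => z; exact: gk_ge0.
have b1x x : bfun (fun z => gk x (phi1 z)) by exact: (bfun_pairr x b1).
have b2x x : bfun (fun z => gk x (phi2 z)) by exact: (bfun_pairr x b2).
transitivity (\int[L m]_x \int[Q1]_z (gk x (phi1 z) * e2 x)%:E)%E.
  apply: eq_integral => x _; rewrite -/(e2 x) -expectZr// EFin_Rintegral//.
  by apply: bfunM => //; exact: bfun_cst.
rewrite (swap_iterated (L m) Q1 (G := fun w => gk w.1 (phi1 w.2) * e2 w.1)); last 2 first.
- by apply: measurable_funM => //; exact: (measurableT_comp me2).
- by move=> w; rewrite mulr_ge0 ?gk_ge0.
have b3 : bfun (fun w : O1 * O2 => gauss_kernel (fun i => Num.sqrt 2 * lam i) (phi1 w.1) (phi2 w.2)).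
  by apply: bfun_gk => //; exact: measurableT_comp.
rewrite EFin_Rintegral//; last exact: (bfun_expectr Q21 b3).
apply: eq_integral => z _; rewrite EFin_Rintegral//; last exact: (bfun_pairr z b3).
have mz : measurable_fun setT (fun w : euclid R m * O2 => gk w.1 (phi1 z) * gk w.1 (phi2 w.2)).
  by apply: measurable_funM => //; apply: measurable_gk => //; exact: measurable_cst.
transitivity (\int[L m]_x \int[Q2]_z' (gk x (phi1 z) * gk x (phi2 z'))%:E)%E.
  apply: eq_integral => x _; rewrite -expectZl// EFin_Rintegral//.
  by apply: bfunM => //; exact: bfun_cst.
rewrite (swap_iterated (L m) Q2 mz); last by move=> w; rewrite mulr_ge0 ?gk_ge0.
apply: eq_integral => z' _.
transitivity (\int[L m]_x (gk (phi1 z) x * gk x (phi2 z'))%:E)%E.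
  by apply: eq_integral => x _; congr (_ * _)%:E; exact: gk_sym.
exact: integral_gk_conv.
Qed.

End kernel_moments.

Section density_pair_kernel.
Context {R : realType} (m : nat).
Local Notation L := (lebesgue_euclid R).
Context dO (O : measurableType dO).
Variables (P : {sigma_finite_measure set (euclid R m) -> \bar R})
  (Q : {sigma_finite_measure set O -> \bar R}) (phi : O -> euclid R m).
Hypotheses (P1 : P setT = 1%E) (Q1 : Q setT = 1%E) (mphi : measurable_fun setT phi).
Variables f q : euclid R m -> R.
Hypotheses (mf : measurable_fun setT f) (mq : measurable_fun setT q)
  (f0 : forall x, 0 <= f x) (q0 : forall x, 0 <= q x)
  (Pf : law_density P id (L m) f) (Qq : law_density Q phi (L m) q).

Local Notation psi := (fun x => f x - q x).
Local Notation Dint := (dint P Q phi).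

Section kernel.
Variables (lam : 'I_m -> R) (lam0 : forall i, 0 < lam i).
Local Notation gk := (gauss_kernel lam).
Local Notation hs l := (Dint (fun x => Dint (fun y => gauss_kernel l x y))).

Let bgk2 : bfun (fun w : euclid R m * euclid R m => gk w.1 w.2).
Proof. exact: bfun_gk. Qed.

Let bgk x : bfun (gk x). Proof. exact: (bfun_pairr x bgk2). Qed.

Lemma bfun_witness : bfun (fun x => Dint (gk x)).
Proof. exact: (bfun_dint P1 Q1 mphi bgk2). Qed.

Let hsE (l : 'I_m -> R) : (forall i, 0 < l i) ->
  ((hs l)%:E = \int[L m]_w (spectral l w * power_spectrum P Q phi w)%:E)%E.
Proof. by move=> l0; exact: (quadratic_form_spectrum P1 Q1 mphi l0). Qed.

Let c : R := (2 * pi) ^- m.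
Let c0 : 0 <= c. Proof. by rewrite invr_ge0 exprn_ge0// mulr_ge0 ?pi_ge0. Qed.

Let mps : measurable_fun setT (power_spectrum P Q phi).
Proof. by case: (bfun_power_spectrum P1 Q1 mphi). Qed.

Let mspectral (l : 'I_m -> R) : measurable_fun setT (spectral l).
Proof.
apply: measurable_funM => //; apply: (measurableT_comp (@measurable_expR R)).
apply: measurable_funM => //; apply: measurableT_comp => //; apply: measurable_sum => i.
by apply: measurable_funX; apply: measurable_funM => //; exact: measurable_tnth.
Qed.

Let spectral_ge0 (l : 'I_m -> R) w : 0 <= spectral l w.
Proof. by rewrite mulr_ge0 ?expR_ge0. Qed.

(** The spectral density decreases when the bandwidths grow. *)
Lemma hsic_widen (l : 'I_m -> R) : (forall i, lam i <= l i) -> hs l <= hs lam.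
Proof.
move=> ll; have l0 i : 0 < l i := lt_le_trans (lam0 i) (ll i).
rewrite -lee_fin [leLHS](hsE l0) [leRHS](hsE lam0); apply: ge0_le_integral; first exact: measurableT.
- by move=> w _; rewrite lee_fin mulr_ge0 ?power_spectrum_ge0.
- by apply/measurable_EFinP; exact: measurable_funM.
- by apply/measurable_EFinP; exact: measurable_funM.
move=> w _; rewrite lee_fin ler_wpM2r ?power_spectrum_ge0//.
rewrite /spectral ler_wpM2l// ler_expR ler_wpM2r// lerN2.
apply: ler_sum => i _; rewrite !exprMn ler_wpM2r ?sqr_ge0//.
by rewrite ler_pXn2r ?nnegrE ?(ltW (lam0 _)) ?(ltW (l0 _)).
Qed.

(** The kernel with bandwidths [eta] dampens frequencies, so its spectral density is at most
    [(2 pi) ^- m]; by [frequency_split] this constant is bounded by a multiple of the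
    spectral density for [lam] plus a multiple of the smoothness weight.  The bound does not
    depend on [eta]. *)
Lemma hsic_smooth (s rad : R) (eta : 'I_m -> R) : 0 < s -> (forall i, 0 < eta i) ->
  (\int[L m]_w (norm2 w `^ (2 * s) * power_spectrum P Q phi w)%:E
     <= ((2 * pi) ^+ m * rad ^+ 2)%:E)%E ->
  hs eta <= expR 2^-1 * hs lam + (\sum_(i < m) lam i `^ (2 * s)) * rad ^+ 2.
Proof.
move=> s0 eta0 sob; set A := \sum_(i < m) _.
have A0 : 0 <= A by apply: sumr_ge0 => i _; exact: powR_ge0.
have mnorm : measurable_fun setT (fun w : euclid R m => norm2 w `^ (2 * s)).
  apply: (measurableT_comp (measurable_powR (2 * s))).
  apply: (@measurableT_comp _ _ _ _ _ _ (@Num.sqrt R)); last exact: measurable_dotp.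
  by apply: continuous_measurable_fun; exact: sqrt_continuous.
pose I1 := (\int[L m]_w ((spectral lam w * power_spectrum P Q phi w)%:E))%E.
pose I2 := (\int[L m]_w ((norm2 w `^ (2 * s) * power_spectrum P Q phi w)%:E))%E.
rewrite -lee_fin [leLHS](hsE eta0).
apply: (@le_trans _ _ ((expR 2^-1)%:E * I1 + (A * c)%:E * I2)%E).
  rewrite -ge0_integralZl//; last 2 first.
  - by apply/measurable_EFinP; exact: measurable_funM.
  - by move=> w _; rewrite lee_fin mulr_ge0 ?power_spectrum_ge0.
  rewrite -ge0_integralZl//; last 3 first.
  - by apply/measurable_EFinP; exact: measurable_funM.
  - by move=> w _; rewrite lee_fin mulr_ge0 ?power_spectrum_ge0 ?powR_ge0.
  - by rewrite lee_fin mulr_ge0.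
  rewrite -ge0_integralD//; last 4 first.
  - by move=> w _; rewrite -EFinM lee_fin !mulr_ge0 ?power_spectrum_ge0 ?expR_ge0.
  - by apply: emeasurable_funM => //; apply/measurable_EFinP; exact: measurable_funM.
  - by move=> w _; rewrite -EFinM lee_fin !mulr_ge0 ?power_spectrum_ge0 ?powR_ge0.
  - by apply: emeasurable_funM => //; apply/measurable_EFinP; exact: measurable_funM.
  apply: ge0_le_integral => //.
  - by move=> w _; rewrite lee_fin mulr_ge0 ?power_spectrum_ge0.
  - by apply/measurable_EFinP; exact: measurable_funM.
  - apply: emeasurable_funD; apply: emeasurable_funM => //;
    by apply/measurable_EFinP; exact: measurable_funM.
  move=> w _; rewrite -!EFinM -EFinD lee_fin !mulrA -mulrDl ler_wpM2r ?power_spectrum_ge0//.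
  apply: (@le_trans _ _ c).
    rewrite /spectral -/c -[leRHS]mulr1 ler_wpM2l// -[leRHS]expR0 ler_expR mulNr oppr_le0.
    by rewrite divr_ge0// sumr_ge0// => i _; exact: sqr_ge0.
  rewrite -[leLHS]mulr1 [leRHS](_ : _ = c * (expR 2^-1 *
     expR (- (\sum_(i < m) (lam i * tnth w i) ^+ 2) / 2) + A * norm2 w `^ (2 * s))); last first.
    by rewrite /spectral -/c; ring.
  by rewrite ler_wpM2l// frequency_split.
have -> : (expR 2^-1 * hs lam + A * rad ^+ 2)%:E = ((expR 2^-1)%:E * I1 + (A * rad ^+ 2)%:E)%E.
  by rewrite EFinD EFinM; congr (_ * _ + _)%E; exact: hsE.
apply: leeD => //.
apply: (@le_trans _ _ ((A * c)%:E * ((2 * pi) ^+ m * rad ^+ 2)%:E)%E).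
  by apply: lee_wpmul2l => //; rewrite lee_fin mulr_ge0.
rewrite -EFinM lee_fin /c -mulrA mulKf// expf_neq0// mulf_neq0 ?pnatr_eq0//.
by rewrite gt_eqF ?pi_gt0.
Qed.

Variable M : R.
Hypotheses (fM : forall x, f x <= M) (qM : forall x, q x <= M).

Let M0 : 0 <= M. Proof. exact: le_trans (f0 [tuple 0 | _ < m]) (fM _). Qed.

Let psiM x : `|psi x| <= M.
Proof. by rewrite ler_norml; have := f0 x; have := q0 x; have := fM x; have := qM x; lra. Qed.

Let ipsi : (L m).-integrable setT (EFin \o psi).
Proof. exact: (integrable_psi P1 Q1 mf mq f0 q0 Pf Qq). Qed.

Let mpsi : measurable_fun setT psi. Proof. exact: measurable_funB. Qed.

Let dintE G : bfun G -> Dint G = \int[L m]_x (psi x * G x).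
Proof. by move=> bG; exact: (dint_density P1 Q1 mphi mf mq f0 q0 Pf Qq bG). Qed.

Let igk x : (L m).-integrable setT (EFin \o gk x).
Proof.
apply/integrableP; split; first by apply/measurable_EFinP; case: (bgk x).
under eq_integral do rewrite /= ger0_norm ?gk_ge0//.
by rewrite integral_gkr// ltry.
Qed.

(** The error of replacing one factor of [psi x ^+ 2] by its smoothed version
    [Dint (gk x)] is at most [M] times the mean increment of [psi] around [x]. *)
Lemma sqr_distance_le_osc : (\int[L m]_x (psi x ^+ 2)%:E <=
  (hs lam)%:E + M%:E * osc (L m) (fun w => gk w.1 w.2) psi)%E.
Proof.
pose h x := Dint (gk x).
have mgk2 : measurable_fun setT (fun w : euclid R m * euclid R m => gk w.1 w.2) by case: bgk2.
have kgk : markov_kernel (L m) (fun w => gk w.1 w.2).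
  split => //; [by move=> w; rewrite gk_ge0|by move=> x y; exact: gk_sym|].
  by move=> x; rewrite integral_gkr.
have mo := measurable_osc_fun kgk mpsi.
have o0 w := osc_fun_ge0 psi w kgk.
pose S x := \int[L m]_y (gk x y * `|psi x - psi y|).
have iS1 x : (L m).-integrable setT (EFin \o (fun y => gk x y * `|psi x - psi y|)).
  apply: (integrable_le (K := 2 * M) (igk x)).
    apply: measurable_funM; first by case: (bgk x).
    by apply: measurableT_comp => //; exact: measurable_funB.
  move=> y; rewrite normrM normr_id mulrC ler_wpM2r// (le_trans (ler_normB _ _))//.
  by have := psiM x; have := psiM y; lra.
have SE x : (S x)%:E = (\int[L m]_y (gk x y * `|psi x - psi y|)%:E)%E.
  exact: EFin_Rintegral_integrable (iS1 x).
have S0 x : 0 <= S x by apply: Rintegral_ge0 => y _; exact: (o0 (x, y)).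
have mS : measurable_fun setT S.
  apply/measurable_EFinP; rewrite (_ : EFin \o S = fun x => (\int[L m]_y (gk x y * `|psi x - psi y|)%:E)%E).
    exact: (measurable_iterated (L m) mo o0).
  by apply/funext => x; exact: SE.
have oE : osc (L m) (fun w => gk w.1 w.2) psi = (\int[L m]_x (S x)%:E)%E.
  by apply: eq_integral => x _; rewrite SE.
have ioo : (osc (L m) (fun w => gk w.1 w.2) psi < +oo)%E.
  apply: (le_lt_trans (osc_le kgk mpsi)).
  by have /integrableP[_ h2] := ipsi; apply: lte_mul_pinfty.
have iS : (L m).-integrable setT (EFin \o S).
  apply/integrableP; split; first exact/measurable_EFinP.
  under eq_integral do rewrite /= ger0_norm//.
  by rewrite -oE.
have [mh [K hK]] := bfun_witness.
have ih : (L m).-integrable setT (EFin \o (fun x => psi x * h x)).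
  apply: (integrable_le (K := K) ipsi); first exact: measurable_funM mpsi mh.
  by move=> x; rewrite normrM mulrC ler_wpM2r//; exact: hK.
have i2 : (L m).-integrable setT (EFin \o (fun x => psi x ^+ 2)).
  apply: (integrable_le (K := M) ipsi); first exact: measurable_funX mpsi.
  by move=> x; rewrite normrX expr2 ler_wpM2r.
have pw x : psi x ^+ 2 <= psi x * h x + M * S x.
  have i1 : (L m).-integrable setT (EFin \o (fun y => gk x y * psi x)).
    by under eq_fun do rewrite mulrC; exact: rintegrableZ (igk x).
  have i3 : (L m).-integrable setT (EFin \o (fun y => psi y * gk x y)).
    have [mg [Kg gK]] := bgk x.
    apply: (integrable_le (K := Kg) ipsi); first exact: measurable_funM.
    by move=> y; rewrite normrM mulrC ler_wpM2r.
  have hE : psi x - h x = \int[L m]_y (gk x y * (psi x - psi y)).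
    rewrite /h dintE//.
    have -> : psi x = \int[L m]_y (gk x y * psi x).
      by rewrite RintegralZr ?igk// /Rintegral integral_gkr// mul1r.
    rewrite -RintegralB//; apply: eq_Rintegral => y _.
    by rewrite RintegralZr ?igk// /Rintegral integral_gkr// mul1r [psi y * _]mulrC -mulrBr.
  have dS : `|psi x - h x| <= S x.
    rewrite hE; apply: le_trans (le_normr_Rintegral _ _) _ => //.
      apply: (rintegrable_le (iS1 x)).
        by apply: measurable_funM; [case: (bgk x)|exact: measurable_funB].
      by move=> y; rewrite !normrM normr_id.
    apply: le_Rintegral => //.
      apply: (rintegrable_le (iS1 x)).
        apply: measurableT_comp => //.
        by apply: measurable_funM; [case: (bgk x)|exact: measurable_funB].
      by move=> y; rewrite normr_id !normrM normr_id.
    by move=> y _; rewrite normrM (ger0_norm (gk_ge0 _ _ _)).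
  rewrite -lerBlDl expr2 -mulrBr (le_trans (ler_norm _))// normrM.
  by apply: ler_pM.
rewrite -EFin_Rintegral_integrable// oE -EFin_Rintegral_integrable// -EFinM -EFinD lee_fin.
rewrite dintE; last exact: bfun_witness.
rewrite -RintegralZl// -RintegralD//; last exact: rintegrableZ.
apply: le_Rintegral => //; exact: (integrableD measurableT ih (rintegrableZ M iS)).
Qed.

End kernel.

Local Notation hs l := (Dint (fun x => Dint (fun y => gauss_kernel l x y))).
Variable M : R.
Hypotheses (fM : forall x, f x <= M) (qM : forall x, q x <= M).

(** Isotropic bandwidths tending to zero serve as an approximate identity: the oscillation
    vanishes in the limit, while [hsic_smooth] bounds the energies uniformly.  This gives the
    bound that the Plancherel theorem would give. *)
Lemma sqr_distance_le_hsic (lam : 'I_m -> R) (s rad : R) : 0 < s -> (forall i, 0 < lam i) ->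
  (\int[L m]_w (norm2 w `^ (2 * s) * power_spectrum P Q phi w)%:E
     <= ((2 * pi) ^+ m * rad ^+ 2)%:E)%E ->
  (\int[L m]_x (psi x ^+ 2)%:E <=
    (expR 2^-1 * hs lam + (\sum_(i < m) lam i `^ (2 * s)) * rad ^+ 2)%:E)%E.
Proof.
move=> s0 lam0 sob; set b := _ + _.
have ipsi := integrable_psi P1 Q1 mf mq f0 q0 Pf Qq.
have mpsi := measurable_integrable ipsi.
have /integrableP[_ ioo] := ipsi.
have M0 : 0 <= M := le_trans (f0 [tuple 0 | _ < m]) (fM _).
have oc := approx_id_gauss mpsi ioo.
apply/lee_addgt0Pr => e e0.
have e1 : 0 < e / (M + 1) by rewrite divr_gt0 ?ltr_wpDl.
have := near_cvge0 oc e1 => -[n _ /(_ n (leqnn n)) on].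
have l0 (i : 'I_m) : 0 < n.+1%:R^-1 :> R by rewrite invr_gt0.
apply: le_trans (sqr_distance_le_osc l0 fM qM) _.
apply: leeD; first by rewrite lee_fin; exact: hsic_smooth.
apply: le_trans (lee_wpmul2l _ on) _; first by rewrite lee_fin.
rewrite -EFinM lee_fin mulrA ler_pdivrMr ?ltr_wpDl//.
by rewrite mulrC ler_wpM2l ?(ltW e0)// lerDl.
Qed.

Variables (lam : 'I_m -> R) (lam0 : forall i, 0 < lam i).
Local Notation gk := (gauss_kernel lam).

Let bgk2 : bfun (fun w : euclid R m * euclid R m => gk w.1 w.2).
Proof. exact: bfun_gk. Qed.

(** Smoothing the signed measure twice is smoothing it once with doubled variances. *)
Lemma integral_witness_sqr :
  (\int[L m]_x (Dint (gk x) ^+ 2)%:E = (hs (fun i => Num.sqrt 2 * lam i))%:E)%E.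
Proof.
have lam2 i : 0 < Num.sqrt 2 * lam i by rewrite mulr_gt0// sqrtr_gt0.
pose a x := \int[P]_y gk x y; pose b x := \int[Q]_z gk x (phi z).
have mid : measurable_fun setT (@id (euclid R m)) by exact: measurable_id.
have e11 := integral_smoothed_prod lam0 P1 P1 mid mid.
have e12 := integral_smoothed_prod lam0 P1 Q1 mid mphi.
have e21 := integral_smoothed_prod lam0 Q1 P1 mphi mid.
have e22 := integral_smoothed_prod lam0 Q1 Q1 mphi mphi.
have b2 : bfun (fun w : euclid R m * O => gk w.1 (phi w.2)).
  by apply: bfun_gk => //; exact: measurableT_comp.
have [ma _] : bfun a by exact: (bfun_expectr P1 bgk2).
have [mb _] : bfun b by exact: (bfun_expectr Q1 b2).
have a0 x : 0 <= a x by apply: expect_ge0 => z; exact: gk_ge0.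
have b0 x : 0 <= b x by apply: expect_ge0 => z; exact: gk_ge0.
move: e11 e12 e21 e22.
set A := \int[P]_z \int[P]_z' _; set B := \int[P]_z \int[Q]_z' _.
set B' := \int[Q]_z \int[P]_z' _; set C := \int[Q]_z \int[Q]_z' _.
move=> e11 e12 e21 e22.
have BB : B = B'.
  by apply: EFin_inj; rewrite -e12 -e21; apply: eq_integral => x _; rewrite mulrC.
have hE : hs (fun i => Num.sqrt 2 * lam i) = A - B - (B' - C).
  have k1 : bfun (fun w : euclid R m * euclid R m =>
      gauss_kernel (fun i => Num.sqrt 2 * lam i) w.1 w.2) by exact: bfun_gk.
  have k2 : bfun (fun w : euclid R m * O =>
      gauss_kernel (fun i => Num.sqrt 2 * lam i) w.1 (phi w.2)).
    by apply: bfun_gk => //; exact: measurableT_comp.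
  have bA := bfun_expectr P1 k1; have bB := bfun_expectr Q1 k2.
  rewrite /dint expectB// expectB//; [exact: bfun_comp bA mphi|exact: bfun_comp bB mphi].
have s0 : (\int[L m]_x (Dint (gk x) ^+ 2)%:E + 2%:E * B%:E = A%:E + C%:E)%E.
  rewrite -e11 -e12 -e22 -ge0_integralZl//; last 2 first.
  - by apply/measurable_EFinP; exact: (measurable_funM ma mb).
  - by move=> x _; rewrite lee_fin; exact: (mulr_ge0 (a0 x) (b0 x)).
  rewrite -ge0_integralD//; last 4 first.
  - by move=> x _; rewrite lee_fin sqr_ge0.
  - by apply/measurable_EFinP; apply: measurable_funX; exact: measurable_funB ma mb.
  - by move=> x _; rewrite -EFinM lee_fin; apply: mulr_ge0 => //; exact: (mulr_ge0 (a0 x) (b0 x)).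
  - by apply: emeasurable_funM => //; apply/measurable_EFinP; exact: (measurable_funM ma mb).
  rewrite -ge0_integralD//; last 4 first.
  - by move=> x _; rewrite lee_fin; exact: (mulr_ge0 (a0 x) (a0 x)).
  - by apply/measurable_EFinP; exact: (measurable_funM ma ma).
  - by move=> x _; rewrite lee_fin; exact: (mulr_ge0 (b0 x) (b0 x)).
  - by apply/measurable_EFinP; exact: (measurable_funM mb mb).
  apply: eq_integral => x _; rewrite -EFinM -!EFinD; congr EFin.
  by rewrite /dint; ring.
have -> : (\int[L m]_x (Dint (gk x) ^+ 2)%:E = (A%:E + C%:E) - 2%:E * B%:E)%E.
  by rewrite -s0 addeK.
rewrite hE -BB (_ : A - B - (B - C) = (A + C) - 2 * B); last by ring.
by rewrite EFinB EFinD EFinM.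
Qed.

(** The densities are at most [M], and the energy at the doubled variances does not exceed
    the energy itself. *)
Lemma expect_witness_sqr_le : \int[P]_x Dint (gk x) ^+ 2 <= M * hs lam /\
  \int[Q]_z Dint (gk (phi z)) ^+ 2 <= M * hs lam.
Proof.
have bw := bfunX 2 (bfun_dint P1 Q1 mphi bgk2).
have M0 : 0 <= M := le_trans (f0 [tuple 0 | _ < m]) (fM _).
have w0 x : 0 <= Dint (gk x) ^+ 2 by exact: sqr_ge0.
have lw : (\int[L m]_x (Dint (gk x) ^+ 2)%:E <= (hs lam)%:E)%E.
  rewrite integral_witness_sqr lee_fin; apply: hsic_widen => // i.
  rewrite ler_peMl ?(ltW (lam0 i))// -[leLHS]sqrtr1 ler_wsqrtr//; lra.
split; rewrite -lee_fin EFinM.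
  apply: le_trans (expect_density_le P1 (@measurable_id _ _ setT) mf f0 Pf fM bw w0) _.
  by apply: lee_wpmul2l; rewrite ?lee_fin.
apply: le_trans (expect_density_le Q1 mphi mq q0 Qq qM bw w0) _.
by apply: lee_wpmul2l; rewrite ?lee_fin.
Qed.

End density_pair_kernel.

(** * Moments of the statistic under an alternative *)

Section flat_bandwidths.
Variables (R : realType) (d : nat) (p : 'I_d -> nat) (lam : forall j, 'I_(p j) -> R).

(** The bandwidths listed along the coordinates of an observation. *)
Definition flat (k : 'I_(\sum_j p j)) : R := let u := tagnat.sig k in lam (tagged u).

Lemma flat_rank j i : flat (tagnat.Rank j i) = lam i.
Proof. by rewrite /flat tagnat.rankK. Qed.

Lemma prod_blockk (x y : obs R p) :
  \prod_(j < d) blockk lam j x y = gauss_kernel flat x y.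
Proof.
rewrite /gauss_kernel big_rank; apply: eq_bigr => j _; apply: eq_bigr => i _.
by rewrite /block !tnth_mktuple flat_rank.
Qed.

Lemma sum_flat (g : R -> R) : \sum_k g (flat k) = \sum_(j < d) \sum_(i < p j) g (lam i).
Proof.
by rewrite big_rank; apply: eq_bigr => j _; apply: eq_bigr => i _; rewrite flat_rank.
Qed.

Hypothesis lam0 : forall j (i : 'I_(p j)), 0 < lam i.

Lemma flat_gt0 k : 0 < flat k. Proof. exact: lam0. Qed.

(** The normalizing constants [sqrt (2 pi)] are at least one. *)
Lemma gk_peak_flat_le : gk_peak flat <= (\prod_(j < d) \prod_(i < p j) lam i)^-1.
Proof.
have -> : \prod_(j < d) \prod_(i < p j) lam i = \prod_k flat k.
  by rewrite big_rank; apply: eq_bigr => j _; apply: eq_bigr => i _; rewrite flat_rank.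
rewrite -prodfV; apply: ler_prod => k _.
have k0 := flat_gt0 k.
have p1 : 1 <= Num.sqrt (2 * pi) :> R.
  by rewrite -[leLHS]sqrtr1 ler_wsqrtr//; have := pi_ge2 R; lra.
rewrite invr_ge0 mulr_ge0 ?(ltW k0) ?sqrtr_ge0//= lef_pV2 ?posrE ?mulr_gt0//.
  by rewrite ler_peMl// ltW.
exact: lt_le_trans ltr01 p1.
Qed.

Lemma bfun_blockk j : bfun (fun w : obs R p * obs R p => blockk lam j w.1 w.2).
Proof.
apply: bfun_gk; first by move=> i; exact: lam0.
- by apply: measurableT_comp; [exact: measurable_block|exact: measurable_fst].
- by apply: measurableT_comp; [exact: measurable_block|exact: measurable_snd].
Qed.

Lemma blockk_sym j (x y : obs R p) : blockk lam j x y = blockk lam j y x.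
Proof. exact: gk_sym. Qed.

Lemma blockk_mixb j (z : d.-tuple (obs R p)) x :
  blockk lam j (mixb z) x = blockk lam j (tnth z j) x.
Proof. by rewrite /blockk block_mixb. Qed.

End flat_bandwidths.

Section alternatives.
Variables (R : realType) (d : nat) (p : 'I_d -> nat).
Local Notation L := (lebesgue_euclid R (\sum_j p j)%N).

Lemma law_density_ae d1 (O : measurableType d1) (Q : {measure set O -> \bar R})
    (phi : O -> obs R p) (f g : obs R p -> R) :
  measurable_fun setT f -> measurable_fun setT g -> {ae L, forall x, f x = g x} ->
  law_density Q phi L f -> law_density Q phi L g.
Proof.
move=> mf mg fg Qf G mG G0; rewrite (Qf G mG G0); apply: ae_eq_integral => //.
- by apply: emeasurable_funM => //; exact/measurable_EFinP.
- by apply: emeasurable_funM => //; exact/measurable_EFinP.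
- by apply: filterS fg => x -> _.
Qed.

Lemma Lnormy_ae (f : obs R p -> R) (M : R) :
  ('N[L]_+oo[EFin \o f] <= M%:E)%E -> {ae L, forall x, `|f x| <= M}.
Proof.
rewrite unlock; case: ifPn => [_ /ess_supP|L0 _].
  by apply: filterS => x; rewrite /= lee_fin.
exists setT; split => //; apply/eqP; rewrite eq_le measure_ge0 andbT.
by rewrite leNgt.
Qed.

Lemma Lnorm2_sqr (f : obs R p -> R) (rho : R) : 0 <= rho ->
  (rho%:E <= 'N[L]_2%:E[EFin \o f])%E -> ((rho ^+ 2)%:E <= \int[L]_x (f x ^+ 2)%:E)%E.
Proof.
move=> r0 h.
have -> : (\int[L]_x (f x ^+ 2)%:E = 'N[L]_2%:E[EFin \o f] `^ 2)%E.
  rewrite poweR_Lnorm//; apply: eq_integral => x _ /=.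
  by rewrite powR_mulrn// real_normK ?num_real.
move: h; case: ('N[L]_2%:E[EFin \o f])%E => [r|_|//]; last by rewrite poweRyr ?leey.
by rewrite lee_fin => rr; rewrite poweR_EFin lee_fin powR_mulrn ?(le_trans r0)// ler_pXn2r ?nnegrE ?(le_trans r0).
Qed.

Variables (lam : forall j, 'I_(p j) -> R) (s rad M rho : R).
Hypotheses (lam0 : forall j (i : 'I_(p j)), 0 < lam i) (s0 : 0 < s) (rho0 : 0 <= rho).
Variable P : probability (obs R p) R.
Local Notation H := (hsic P (@mixb R d p) (gauss_kernel (flat lam))).
Local Notation Q := (power_measure P d).
Local Notation mx := (@mixb R d p).
Local Notation k := (gauss_kernel (flat lam)).

(** The bounds of the alternative hold almost everywhere; truncating the densities at [M]
    makes them hold everywhere and changes the densities only on a null set. *)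
Lemma alternatives_densities : alternatives s rad M rho P ->
  exists f q : obs R p -> R,
    [/\ (measurable_fun setT f /\ measurable_fun setT q),
        (forall x, 0 <= f x <= M) /\ (forall x, 0 <= q x <= M),
        law_density P id L f /\ law_density Q mx L q,
        ((rho ^+ 2)%:E <= \int[L]_x ((f x - q x) ^+ 2)%:E)%E &
        (\int[L]_w (norm2 w `^ (2 * s) * power_spectrum P Q mx w)%:E
          <= ((2 * pi) ^+ (\sum_j p j) * rad ^+ 2)%:E)%E].
Proof.
move=> [f [fj [[[mf f0 fE] fjd] nrm [_ _ sob] bnd]]].
pose q x := \prod_(j < d) fj j (block j x).
have mq : measurable_fun setT q.
  apply: measurable_prod => j _; have [mfj _ _] := fjd j.
  by apply: (measurableT_comp mfj); exact: measurable_block.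
have q0 x : 0 <= q x by apply: prodr_ge0 => j _; have [_ + _] := fjd j; exact.
have Pf : law_density P id L f.
  by move=> G mG G0; exact: (ge0_integral_density mf f0 fE mG G0).
have Qq : law_density Q mx L q.
  by move=> G mG G0; exact: (ge0_integral_mix_density fjd mG G0).
have P1 : P setT = 1%E by exact: probability_setT.
have Q1 : Q setT = 1%E by exact: power_setT.
move: bnd; rewrite ge_max => /andP[/Lnormy_ae fM /Lnormy_ae qM].
have M0 : 0 <= M.
  rewrite leNgt; apply/negP => M0.
  have fae : {ae L, forall x, f x = 0}.
    by apply: filterS fM => x; rewrite leNgt (lt_le_trans M0).
  have /eqP := integral_density1 P1 Pf; apply/negP.
  rewrite (ae_eq_integral (cst 0%E)) ?integral0 ?lt_eqF ?lte_fin//.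
  - exact/measurable_EFinP.
  - by apply: filterS fae => x -> _.
pose f' x := Num.min (f x) M; pose q' x := Num.min (q x) M.
have mf' : measurable_fun setT f' by exact: measurable_minr.
have mq' : measurable_fun setT q' by exact: measurable_minr.
have ff : {ae L, forall x, f x = f' x}.
  by apply: filterS fM => x; rewrite ger0_norm// /f' => /min_idPl ->.
have qq : {ae L, forall x, q x = q' x}.
  by apply: filterS qM => x; rewrite (ger0_norm (q0 x)) /q' => /min_idPl ->.
exists f', q'; split.
- by [].
- by split=> x; rewrite /f' /q' le_min ?f0 ?q0 M0 ge_min lexx orbT.
- by split; [exact: law_density_ae ff Pf|exact: law_density_ae qq Qq].
- apply: le_trans (Lnorm2_sqr rho0 nrm) _; rewrite le_eqVlt; apply/orP; left; apply/eqP.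
  apply: ae_eq_integral => //.
  + by apply/measurable_EFinP; apply: measurable_funX; exact: measurable_funB.
  + by apply/measurable_EFinP; apply: measurable_funX; exact: measurable_funB.
  + by apply: filterS2 ff qq => x fx qx _ /=; rewrite -fx -qx.
- apply: le_trans sob; rewrite le_eqVlt; apply/orP; left; apply/eqP.
  apply: eq_integral => w _; congr (_ * _)%:E; apply/esym.
  exact: (normc_fourier P1 Q1 (@measurable_mixb R d p) mf mq f0 q0 Pf Qq).
Qed.

Hypothesis PA : alternatives s rad M rho P.

Let P1 : P setT = 1%E. Proof. exact: probability_setT. Qed.
Let Q1 : Q setT = 1%E. Proof. exact: power_setT. Qed.
Let mm : measurable_fun setT mx. Proof. exact: measurable_mixb. Qed.
Let fl := flat_gt0 lam0.
Let l0 := \prod_(j < d) \prod_(i < p j) lam i.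
Let l0_gt0 : 0 < l0.
Proof. by apply: prodr_gt0 => j _; apply: prodr_gt0 => i _; exact: lam0. Qed.

Lemma alternatives_M : 0 <= M.
Proof.
have [f [q [_ [fM _] _ _ _]]] := alternatives_densities PA.
by have /andP[+ +] := fM [tuple 0 | _ < _]; exact: le_trans.
Qed.

(** The squared distance of the densities, which is at least [rho ^+ 2], is bounded by the
    energy and the bias of smoothing. *)
Lemma alternatives_separation :
  rho ^+ 2 <= expR 2^-1 * H + (\sum_(j < d) \sum_(i < p j) lam i `^ (2 * s)) * rad ^+ 2.
Proof.
have [f [q [[mf mq] [fM qM] [Pf Qq] rhoE sob]]] := alternatives_densities PA.
have f0 x : 0 <= f x by have /andP[] := fM x.
have q0 x : 0 <= q x by have /andP[] := qM x.
have fM' x : f x <= M by have /andP[] := fM x.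
have qM' x : q x <= M by have /andP[] := qM x.
have -> : \sum_(j < d) \sum_(i < p j) lam i `^ (2 * s) = \sum_k flat lam k `^ (2 * s).
  exact: (esym (sum_flat lam (fun l => l `^ (2 * s)))).
rewrite -lee_fin; apply: (le_trans rhoE).
exact: (sqr_distance_le_hsic P1 Q1 mm mf mq f0 q0 Pf Qq fM' qM' s0 fl sob).
Qed.

Lemma alternatives_kernel_sqr x :
  \int[P]_u k x u ^+ 2 <= M / l0 /\ \int[Q]_z k x (mx z) ^+ 2 <= M / l0.
Proof.
have [f [q [[mf mq] [fM qM] [Pf Qq] rhoE sob]]] := alternatives_densities PA.
have f0 y : 0 <= f y by have /andP[] := fM y.
have q0 y : 0 <= q y by have /andP[] := qM y.
have fM' y : f y <= M by have /andP[] := fM y.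
have qM' y : q y <= M by have /andP[] := qM y.
have pk : gk_peak (flat lam) * M <= M / l0.
  by rewrite mulrC ler_wpM2l ?alternatives_M// gk_peak_flat_le.
split; apply: le_trans pk.
  exact: (expect_gk_sqr_le fl x P1 (@measurable_id _ _ setT) mf f0 Pf fM').
exact: (expect_gk_sqr_le fl x Q1 mm mq q0 Qq qM').
Qed.

Lemma alternatives_mix_sqr : \int[Q]_z \int[Q]_z' k (mx z) (mx z') ^+ 2 <= M / l0.
Proof.
rewrite -[leRHS](expect_cst Q1); apply: le_expect => //.
- apply: (bfun_expectr Q1 (f := fun w => k (mx w.1) (mx w.2) ^+ 2)).
  by apply: bfunX; apply: bfun_gk => //; exact: measurableT_comp.
- exact: bfun_cst.
- by move=> z; have [] := alternatives_kernel_sqr (mx z).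
Qed.

(** The second moments of the witness function are of the order of the energy, so the
    leading term of the variance is at most a multiple of [H / n]. *)
Lemma alternatives_variance n (hd : (1 < d)%N) (hn : (2 * d <= n)%N) :
  \int[power_measure P n]_x
    (ustat hd hn (fun j a b => blockk lam j (tnth x a) (tnth x b)) - H) ^+ 2 <=
  n%:R^-1 * (4 * d.+1%:R * (M * H + d%:R * (M * H)))
  + (1 + (2 * d) ^ 2)%:R * ((2 * d) ^ 4)%:R * (18 * (M / l0)) * 2 / n%:R ^+ 2.
Proof.
have QA : \int[P]_x \int[P]_u k x u ^+ 2 <= M / l0.
  rewrite -[leRHS](expect_cst P1); apply: le_expect => //.
  - apply: (bfun_expectr P1 (f := fun w => k w.1 w.2 ^+ 2)).
    by apply: bfunX; exact: bfun_gk.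
  - exact: bfun_cst.
  - by move=> x; have [] := alternatives_kernel_sqr x.
have QC : \int[Q]_z \int[P]_u k (mx z) u ^+ 2 <= M / l0.
  rewrite -[leRHS](expect_cst Q1); apply: le_expect => //.
  - apply: (bfun_expectr P1 (f := fun w => k (mx w.1) w.2 ^+ 2)).
    by apply: bfunX; apply: bfun_gk => //; exact: measurableT_comp.
  - exact: bfun_cst.
  - by move=> z; have [] := alternatives_kernel_sqr (mx z).
have kE x y := esym (prod_blockk lam x y).
apply: le_trans (ustat_variance P1 hd hn (bfun_blockk lam0) (blockk_sym lam) mm (blockk_mixb lam)
   kE QA alternatives_mix_sqr QC) _.
have [f [q [[mf mq] [fM qM] [Pf Qq] rhoE sob]]] := alternatives_densities PA.
have f0 y : 0 <= f y by have /andP[] := fM y.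
have q0 y : 0 <= q y by have /andP[] := qM y.
have fM' y : f y <= M by have /andP[] := fM y.
have qM' y : q y <= M by have /andP[] := qM y.
have [w1 w2] := expect_witness_sqr_le P1 Q1 mm mf mq f0 q0 Pf Qq fM' qM' fl.
apply: lerD; last exact: lexx.
apply: ler_wpM2l; first by rewrite invr_ge0.
apply: ler_wpM2l; first by rewrite mulr_ge0.
apply: lerD; first exact: w1.
by apply: ler_wpM2l => //; exact: w2.
Qed.

End alternatives.

(** * The statistic as an average over permutations *)

Section statistic.
Variables (R : realType) (d n : nat) (p : 'I_d -> nat) (lam : forall j, 'I_(p j) -> R).
Hypotheses (hd : (1 < d)%N) (hn : (2 * d <= n)%N).
Local Notation w := (widen_ord hn).
Implicit Types (X Y : n.-tuple (obs R p)) (pi : {ffun 'I_d -> 'S_n}).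

(** The sums over tuples of lengths [2], [2 * d] and [d.+1] are read off one window of
    length [2 * d] under a uniform permutation. *)
Lemma U_dHSIC_ustat X :
  U_dHSIC lam X = ustat hd hn (fun j a b => blockk lam j (tnth X a) (tnth X b)).
Proof.
pose Lk j a b := blockk lam j (tnth X a) (tnth X b).
pose T (t : term) (s : 'S_n) := \prod_(j < d) Lk j (s (w (ea hd t j))) (s (w (eb hd t j))).
have -> : ustat hd hn Lk = pavg (T (Some true)) + pavg (T (Some false)) - 2 * pavg (T None).
  rewrite /ustat /ustat_kernel -pavgZl -pavgD -pavgB; apply: eq_pavg => s.
  by rewrite -(sum_coef (fun t => T t s)).
have d1n : (d.+1 <= n)%N.
  apply: leq_trans hn; rewrite mul2n -addnn -addn1 leq_add2l; exact: ltnW.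
have n2 : (2 <= n)%N := leq_trans hd (leq_trans (leqnSn d) d1n).
rewrite /U_dHSIC; congr (_ + _ - _).
- rewrite -(@pavg_uniq R n 2 (widen_ord n2)); last by move=> i j [] /val_inj.
  apply: eq_pavg => s; apply: eq_bigr => j _; rewrite !tnth_mktuple.
  have -> : widen_ord n2 ord0 = w (ea hd (Some true) j) by exact/val_inj.
  by have -> : widen_ord n2 ord_max = w (eb hd (Some true) j) by exact/val_inj.
- rewrite -(@pavg_uniq R n (2 * d) w); last exact: widen_inj.
  by apply: eq_pavg => s; apply: eq_bigr => j _; rewrite !tnth_mktuple.
- rewrite -subnDA addn1 -!mulrA; congr (2 * _); rewrite mulrA.
  rewrite -(@pavg_uniq R n d.+1 (widen_ord d1n)); last by move=> i j [] /val_inj.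
  apply: eq_pavg => s; apply: eq_bigr => j _; rewrite !tnth_mktuple.
  have -> : widen_ord d1n ord0 = w (ea hd None j) by exact/val_inj.
  by have -> : widen_ord d1n (lift ord0 j) = w (eb hd None j) by exact/val_inj.
Qed.

Lemma block_permute_data pi X j a :
  block j (tnth (permute_data pi X) a) = block j (tnth X (pi j a)).
Proof.
by apply: eq_from_tnth => i; rewrite !tnth_mktuple tagnat.Rank1K.
Qed.

Lemma U_dHSIC_permute pi X : U_dHSIC lam (permute_data pi X) =
  ustat hd hn (fun j a b => blockk lam j (tnth X (pi j a)) (tnth X (pi j b))).
Proof.
rewrite U_dHSIC_ustat; apply: eq_pavg => s; apply: eq_bigr => t _; congr (_ * _).
by apply: eq_bigr => j _; rewrite /blockk !block_permute_data.
Qed.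

Lemma permute_data1 X : permute_data [ffun=> 1%g] X = X.
Proof.
apply: eq_from_tnth => i; apply: eq_from_tnth => k.
by rewrite !tnth_mktuple ffunE perm1.
Qed.

Hypothesis lam0 : forall j (i : 'I_(p j)), 0 < lam i.
Let l0 := \prod_(j < d) \prod_(i < p j) lam i.

Lemma prod_blockk_bound (x y : 'I_d -> obs R p) :
  0 <= \prod_(j < d) blockk lam j (x j) (y j) <= l0^-1.
Proof.
rewrite prodr_ge0 /=; last by move=> j _; apply: gk_ge0 => i; exact: lam0.
apply: le_trans (gk_peak_flat_le lam0).
rewrite /gk_peak big_rank; apply: ler_prod => j _.
rewrite gk_ge0 /=; last by move=> i; exact: lam0.
apply: le_trans (gk_le _ _ _) _; first by move=> i; exact: lam0.
by rewrite le_eqVlt; apply/orP; left; apply/eqP; apply: eq_bigr => i _; rewrite flat_rank.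
Qed.

Lemma ustat_kernel_dist (x y : 'I_d -> 'I_n -> obs R p) s :
  `|ustat_kernel hd hn (fun j a b => blockk lam j (x j a) (x j b)) s
    - ustat_kernel hd hn (fun j a b => blockk lam j (y j a) (y j b)) s| <= 8 * l0^-1.
Proof.
rewrite /ustat_kernel !sum_coef.
have b (z : 'I_d -> 'I_n -> obs R p) t := prod_blockk_bound
  (fun j => z j (s (w (ea hd t j)))) (fun j => z j (s (w (eb hd t j)))).
have /andP[] := b x (Some true); have /andP[] := b x (Some false); have /andP[] := b x None.
have /andP[] := b y (Some true); have /andP[] := b y (Some false); have /andP[] := b y None.
set a1 := \prod_(j < d) _; set a2 := \prod_(j < d) _; set a3 := \prod_(j < d) _.
set a4 := \prod_(j < d) _; set a5 := \prod_(j < d) _; set a6 := \prod_(j < d) _.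
by move=> *; rewrite ler_norml; apply/andP; split; lra.
Qed.

(** Changing one observation affects only the permutations that, followed by the
    permutation of some block, place it in the window.  This has probability at most
    [2 * d * d / n], and the kernel of the statistic then moves by at most [8] times the largest
    value of the product kernel. *)
Lemma U_dHSIC_hamming pi X Y : (hamming X Y <= 1)%N ->
  `|U_dHSIC lam (permute_data pi X) - U_dHSIC lam (permute_data pi Y)| <=
  16 * d%:R ^+ 2 / (n%:R * l0).
Proof.
have n0 : (0 < n)%N by apply: leq_trans hn; rewrite muln_gt0 /= ltnW.
have l0_gt0 : 0 < l0 by apply: prodr_gt0 => j _; apply: prodr_gt0 => i _; exact: lam0.
move=> hXY; have [i0 Hi0] : exists i0, forall i, i != i0 -> tnth X i = tnth Y i.
  have [e he|hi0] := pickP (fun i => tnth X i != tnth Y i).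
    exists e => i ie; apply/eqP; apply: contraTT hXY => xy.
    rewrite -ltnNge /hamming; apply/card_gt1P; exists i, e; split => //.
  by exists (Ordinal n0) => i _; apply/eqP; move: (hi0 i) => /negbFE.
rewrite !U_dHSIC_permute /ustat -pavgB.
apply: le_trans (pavg_norm _) _.
apply: (@le_trans _ _ (pavg (fun s => \sum_(v < 2 * d) \sum_(j < d)
    8 * l0^-1 * (s (w v) == (pi j)^-1%g i0)%:R))).
  apply: le_pavg => s.
  have H0 : 0 <= 8 * l0^-1 by rewrite mulr_ge0// invr_ge0 ltW.
  have [/forallP H|] := boolP [forall v : 'I_(2 * d), [forall j : 'I_d, s (w v) != (pi j)^-1%g i0]].
    rewrite [leLHS](_ : _ = 0); first by apply: sumr_ge0 => v _; apply: sumr_ge0 => j _; rewrite mulr_ge0.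
    apply/normr0P; rewrite subr_eq0; apply/eqP; apply: eq_bigr => t _; congr (_ * _).
    apply: eq_bigr => j _.
    have e v : tnth X (pi j (s (w v))) = tnth Y (pi j (s (w v))).
      apply: Hi0; have /forallP /(_ j) := H v; apply: contra => /eqP <-.
      by rewrite permK.
    by rewrite !e.
  rewrite negb_forall => /existsP[v]; rewrite negb_forall => /existsP[j]; rewrite negbK => vj.
  apply: le_trans (ustat_kernel_dist _ _ _) _.
  rewrite (bigD1 v)//= (bigD1 j)//= vj mulr1 -addrA lerDl addr_ge0//.
    by apply: sumr_ge0 => j' _; rewrite mulr_ge0.
  by apply: sumr_ge0 => v' _; apply: sumr_ge0 => j' _; rewrite mulr_ge0.
rewrite pavg_sum (eq_bigr (fun=> \sum_(j < d) 8 * l0^-1 * n%:R^-1)); last first.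
  by move=> v _; rewrite pavg_sum; apply: eq_bigr => j _; rewrite pavgZl pavg_eq.
rewrite !sumr_const !card_ord -[_ *+ d]mulr_natr -[_ *+ (2 * d)]mulr_natr natrM le_eqVlt; apply/orP; left; apply/eqP.
by field; rewrite (gt_eqF l0_gt0) pnatr_eq0 -lt0n n0.
Qed.

Let sens_ub : ubound [set r | exists pi : {ffun 'I_d -> 'S_n},
               exists X Y : n.-tuple (obs R p), (hamming X Y <= 1)%N /\
       r = `|U_dHSIC lam (permute_data pi X) - U_dHSIC lam (permute_data pi Y)|]
   (16 * d%:R ^+ 2 / (n%:R * l0)).
Proof. by move=> _ [pi [X [Y [h ->]]]]; exact: U_dHSIC_hamming. Qed.

Let sens0 : [set r | exists pi : {ffun 'I_d -> 'S_n},
               exists X Y : n.-tuple (obs R p), (hamming X Y <= 1)%N /\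
       r = `|U_dHSIC lam (permute_data pi X) - U_dHSIC lam (permute_data pi Y)|] 0.
Proof.
pose X : n.-tuple (obs R p) := [tuple [tuple (0 : R) | _ < _] | _ < n].
exists [ffun=> 1%g], X, X; split; last by rewrite subrr normr0.
by rewrite /hamming eq_card0// => i; rewrite inE eqxx.
Qed.

Lemma sensitivity_ge0 : 0 <= sensitivity lam n.
Proof. by apply: ub_le_sup; [exists (16 * d%:R ^+ 2 / (n%:R * l0))|]. Qed.

Lemma sensitivity_le : sensitivity lam n <= 16 * d%:R ^+ 2 / (n%:R * l0).
Proof. by apply: ge_sup => //; exists 0. Qed.

End statistic.

(** * Second moments of the block kernels *)

Lemma expect_gt0 d (T : measurableType d) (R : realType) (mu : {measure set T -> \bar R}) (f : T -> R) :
  mu setT = 1%E -> bfun f -> (forall x, 0 < f x) -> 0 < \int[mu]_x f x.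
Proof.
move=> mu1 bf f0; have [mf _] := bf.
rewrite lt_neqAle expect_ge0 ?andbT; last by move=> x; exact: ltW.
apply/eqP => e0.
have : (\int[mu]_x `|(f x)%:E| = 0)%E.
  under eq_integral do rewrite gee0_abs ?lee_fin ?(ltW (f0 _))//.
  by rewrite -EFin_Rintegral// -e0.
move/(ae_eq_integral_abs _ measurableT) => -[|N [mN N0 sN]]; first exact/measurable_EFinP.
have : mu setT = 0%E.
  apply/eqP; rewrite eq_le measure_ge0 andbT -N0; apply: le_measure; rewrite ?inE//.
  move=> x _; apply: sN => /= /(_ I) [fx].
  by have := f0 x; rewrite fx ltxx.
by rewrite mu1 => /eqP; rewrite onee_eq0.
Qed.

Lemma expect_pavg d (T : measurableType d) (R : realType) (mu : {measure set T -> \bar R}) n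
    (F : 'S_n -> T -> R) : mu setT = 1%E -> (forall s, bfun (F s)) ->
  \int[mu]_x pavg (fun s => F s x) = pavg (fun s => \int[mu]_x F s x).
Proof.
move=> mu1 bF; rewrite /pavg expectZl//; last by apply: bfun_sum.
by rewrite expect_sum.
Qed.

Section edge_moments.
Variables (R : realType) (d n : nat) (p : 'I_d -> nat) (lam : forall j, 'I_(p j) -> R).
Hypotheses (hd : (1 < d)%N) (hn : (2 * d <= n)%N).
Hypothesis lam0 : forall j (i : 'I_(p j)), 0 < lam i.
Variable P : probability (obs R p) R.
Let P1 : P setT = 1%E. Proof. exact: probability_setT. Qed.
Local Notation w := (widen_ord hn).

(** Expectation of the squared kernel of the block [j] at two independent observations, and
    its empirical counterpart [edge_data]. *)
Definition edge_mean j : R := \int[P]_x \int[P]_u blockk lam j x u ^+ 2.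
Definition edge_data (X : n.-tuple (obs R p)) j : R :=
  edge_sqr hd hn (fun j a b => blockk lam j (tnth X a) (tnth X b)) j.

Let b2 j : bfun (fun a : obs R p * obs R p => blockk lam j a.1 a.2 ^+ 2).
Proof. by apply: bfunX; exact: bfun_blockk. Qed.

Let blockk_gt0 j (x u : obs R p) : 0 < blockk lam j x u.
Proof. by apply: gk_gt0 => i; exact: lam0. Qed.

Lemma edge_mean_gt0 j : 0 < edge_mean j.
Proof.
apply: expect_gt0 => //; first exact: (bfun_expectr P1 (b2 j)).
move=> x; apply: expect_gt0 => //; first exact: (bfun_pairr x (b2 j)).
by move=> u; rewrite exprn_gt0.
Qed.

Let bdata (s : 'S_n) j : bfun (fun X : n.-tuple (obs R p) =>
  blockk lam j (tnth X (s (w (pzero hd)))) (tnth X (s (w (pone hd)))) ^+ 2).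
Proof.
apply: (bfun_comp (g := fun X : n.-tuple (obs R p) => (tnth X _, tnth X _)) (b2 j)).
by apply: measurable_fun_pair; exact: measurable_tnth.
Qed.

Lemma bfun_edge_data j : bfun (edge_data^~ j).
Proof.
rewrite /edge_data /edge_sqr /pavg; apply: bfunM; first exact: bfun_cst.
by apply: bfun_sum => s _; exact: bdata.
Qed.

Lemma edge_data_ge0 X j : 0 <= edge_data X j.
Proof. by apply: pavg_ge0 => s; exact: sqr_ge0. Qed.

Lemma expect_edge_data j : \int[power_measure P n]_X edge_data X j = edge_mean j.
Proof.
rewrite /edge_data /edge_sqr expect_pavg//.
rewrite -[RHS](@pavg_cst R n); apply: eq_pavg => s.
apply: (expect_tnth2 P1 (G := fun a => blockk lam j a.1 a.2 ^+ 2)) => //.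
by rewrite (inj_eq perm_inj) (inj_eq (@widen_inj _ _ hn)).
Qed.

(** Drawing an independent pair of observations for each block turns the product of the
    moments into a moment of the product kernel under the product of the marginals. *)
Lemma prod_edge_mean :
  \prod_(j < d) edge_mean j =
  \int[power_measure P d]_z \int[power_measure P d]_z'
     gauss_kernel (flat lam) (mixb z) (mixb z') ^+ 2.
Proof.
rewrite /edge_mean -(expect_prod_tnth P1 (g := fun j x => \int[P]_u blockk lam j x u ^+ 2)); last first.
  by move=> j; exact: (bfun_expectr P1 (b2 j)).
apply: eq_Rintegral => y _.
rewrite -(expect_prod_tnth P1 (g := fun j u => blockk lam j (tnth y j) u ^+ 2)); last first.
  by move=> j; exact: (bfun_pairr _ (b2 j)).
apply: eq_Rintegral => y' _; rewrite -prod_blockk -prodrXl; apply: eq_bigr => j _.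
by rewrite [in RHS]blockk_mixb [in RHS]blockk_sym [in RHS]blockk_mixb blockk_sym.
Qed.

End edge_moments.

(** * The type II error of the test *)

Section averages.
Variable R : realType.

(** Each component of a uniform tuple is uniform. *)
Lemma ffun_marginal (T : finType) B (i : 'I_B) (g : T -> R) (t0 : T) :
  #|{: {ffun 'I_B -> T}}|%:R^-1 * \sum_(f : {ffun 'I_B -> T}) g (f i) =
  #|T|%:R^-1 * \sum_t g t.
Proof.
have T0 : (#|T|%:R : R) != 0 by rewrite pnatr_eq0 -lt0n; apply/card_gt0P; exists t0.
have -> : \sum_(f : {ffun 'I_B -> T}) g (f i) =
    \prod_(l < B) \sum_t (if l == i then g t else 1).
  rewrite bigA_distr_bigA; apply: eq_bigr => f _.
  by rewrite (bigD1 i)//= eqxx big1 ?mulr1// => l /negbTE ->.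
rewrite (bigD1 i)//= eqxx [X in _ * (_ * X)](eq_bigr (fun=> #|T|%:R)); last first.
  by move=> l /negbTE ->; rewrite sumr_const.
rewrite card_ffun card_ord natrX prodr_const cardC1 card_ord.
case: B i => [[]//|B] i; rewrite exprS invfM /=.
rewrite [X in _ = X]mulrC mulrCA -!mulrA; congr (_ * _).
by rewrite [_ ^- _ * _]mulVf ?mulr1// expf_neq0.
Qed.

Lemma bool01 (b : bool) : 0 <= (b%:R : R) <= 1.
Proof. by case: b; rewrite ?lexx ?ler01. Qed.

Lemma bfun_le_indic d (T : measurableType d) (f g : T -> R) :
  measurable_fun setT f -> measurable_fun setT g -> bfun (fun x => (f x <= g x)%R%:R : R).
Proof.
move=> mf mg; split; last by exists 1 => x; case: (f x <= g x)%R; rewrite ?normr1 ?normr0.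
rewrite (_ : (fun x => _) = \1_[set x | f x <= g x]).
  apply: measurable_indic; rewrite -[X in measurable X]setTI.
  exact: measurable_fun_le.
by apply/funext => x; rewrite indicE mem_setE.
Qed.

(** For a noisy permuted statistic to reach the noisy observed one, either the observed
    statistic [u0] is below its mean [H] by a quarter of [H], or the permuted statistic exceeds a
    quarter of [H], or one of the noises [c * z] does; the first event is bounded by
    Chebyshev. *)
Lemma noise_split (H c t u0 u1 z0 z1 : R) : 0 < H -> 0 <= c -> c * t <= H / 4 ->
  (u0 + c * z0 <= u1 + c * z1)%R%:R <=
  16 / H ^+ 2 * (u0 - H) ^+ 2 + (H / 4 <= `|u1|)%R%:R + (t <= `|z0|)%R%:R + (t <= `|z1|)%R%:R :> R.
Proof.
move=> H0 c0 ct; set q := 16 / _ * _.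
have q0 : 0 <= q by rewrite mulr_ge0 ?sqr_ge0// divr_ge0// sqr_ge0.
set i0 := (u0 + _ <= _)%R; set i1 := (H / 4 <= _)%R.
set i2 := (t <= `|z0|)%R; set i3 := (t <= `|z1|)%R.
have /andP[a0 b0] := bool01 i0; have /andP[a1 b1] := bool01 i1.
have /andP[a2 b2] := bool01 i2; have /andP[a3 b3] := bool01 i3.
have [h1|h1] := boolP i1; first by rewrite /=; lra.
have [h2|h2] := boolP i2; first by rewrite /=; lra.
have [h3|h3] := boolP i3; first by rewrite /=; lra.
have [le|_] := boolP i0; last by rewrite /=; lra.
move: h1 h2 h3; rewrite /i1 /i2 /i3 -!ltNge => u1H z0t z1t; rewrite /i0 in le.
have n0 : c * `|z0| <= H / 4 by apply: le_trans ct; rewrite ler_wpM2l// ltW.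
have n1 : c * `|z1| <= H / 4 by apply: le_trans ct; rewrite ler_wpM2l// ltW.
have m0 : - (c * z0) <= c * `|z0| by rewrite -mulrN ler_wpM2l// ler_normr lexx orbT.
have m1 : c * z1 <= c * `|z1| by rewrite ler_wpM2l// ler_norm.
have v1 := ler_norm u1.
have dev : H / 4 <= H - u0 by lra.
have : 1 <= q.
  rewrite /q mulrAC ler_pdivlMr ?exprn_gt0// mul1r -(sqrrN (u0 - H)) opprB.
  have -> : H ^+ 2 = 16 * (H / 4) ^+ 2 by field.
  by rewrite ler_wpM2l// ler_pXn2r ?nnegrE//; lra.
by rewrite /=; lra.
Qed.

End averages.

Section test.
Variables (R : realType) (d n B : nat) (p : 'I_d -> nat) (lam : forall j, 'I_(p j) -> R).
Variables (alpha eps delta : R).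
Hypotheses (hd : (1 < d)%N) (hn : (2 * d <= n)%N).
Hypothesis lam0 : forall j (i : 'I_(p j)), 0 < lam i.
Implicit Types X : n.-tuple (obs R p).
Local Notation S := {ffun 'I_d -> 'S_n}.
Local Notation M0 X z := (noisy_stat lam eps delta X [ffun=> 1%g] (tnth z ord0)).
Local Notation Mi X pis z i := (noisy_stat lam eps delta X (pis i) (tnth z (lift ord0 i))).
Local Notation c := (2 * sensitivity lam n * (xi eps delta)^-1).

(** Acceptance means that the count of exceedances plus one exceeds [alpha * B.+1]; as
    [alpha * B >= 3], the count is then at least [2 / 3] of [alpha * B]. *)
Lemma acceptance_bound X (pis : {ffun 'I_B -> S}) (z : euclid R B.+1) :
  0 < alpha -> 3 <= alpha * B%:R ->
  1 - dpdHSIC_test lam alpha eps delta X pis z <=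
  3 / (2 * (alpha * B%:R)) * \sum_(i < B) (M0 X z <= Mi X pis z i)%R%:R.
Proof.
move=> a0 aB; rewrite /dpdHSIC_test; set s := \sum_(i < B) _.
have s0 : 0 <= s by apply: sumr_ge0 => i _.
have aB0 : 0 < alpha * B%:R by lra.
have [_|] := leP (dp_pvalue _ _ _ _ _ _) alpha.
  by rewrite subrr mulr_ge0// divr_ge0// mulr_ge0// ltW.
rewrite /dp_pvalue -/s subr0 => h.
have {}h : alpha * B.+1%:R < s + 1.
  by rewrite mulrC -ltr_pdivlMl ?ltr0n.
rewrite mulrAC ler_pdivlMr; last by rewrite mulr_gt0.
move: h; rewrite -natr1 mulrDr mulr1; lra.
Qed.

Lemma bfun_ustat_data dO (O : measurableType dO) (x : 'I_d -> 'I_n -> O -> obs R p) :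
  (forall j a, measurable_fun setT (x j a)) ->
  bfun (fun o => ustat hd hn (fun j a b => blockk lam j (x j a o) (x j b o))).
Proof.
move=> mx; rewrite /ustat /pavg; apply: bfunM; first exact: bfun_cst.
apply: bfun_sum => s _; apply: bfun_sum => t _; apply: bfunM; first exact: bfun_cst.
apply: bfun_prod => j _.
apply: (bfun_comp (g := fun o => (x j _ o, x j _ o)) (bfun_blockk lam0 j)).
exact: measurable_fun_pair.
Qed.

Lemma bfun_U_permute (pi : S) : bfun (fun X => U_dHSIC lam (permute_data pi X)).
Proof.
rewrite (_ : (fun X => _) = fun X => ustat hd hn (fun j a b =>
   blockk lam j (tnth X (pi j a)) (tnth X (pi j b)))); last first.
  by apply/funext => X; exact: U_dHSIC_permute.
by apply: (bfun_ustat_data (x := fun j a X => tnth X (pi j a))) => j a; exact: measurable_tnth.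
Qed.

Lemma measurable_noisy (pi : S) (l : 'I_B.+1) :
  measurable_fun setT (fun w : n.-tuple (obs R p) * euclid R B.+1 =>
    noisy_stat lam eps delta w.1 pi (tnth w.2 l)).
Proof.
apply: measurable_funD.
  by have [mU _] := bfun_U_permute pi; exact: (measurableT_comp mU).
apply: measurable_funM => //.
exact: (measurableT_comp (measurable_tnth l) measurable_snd).
Qed.

Lemma bfun_test (pis : {ffun 'I_B -> S}) :
  bfun (fun w : n.-tuple (obs R p) * euclid R B.+1 =>
    dpdHSIC_test lam alpha eps delta w.1 pis w.2).
Proof.
apply: bfun_le_indic; last exact: measurable_cst.
have bM i := bfun_le_indic (measurable_noisy [ffun=> 1%g] ord0)
  (measurable_noisy (pis i) (lift ord0 i)).
have bs : bfun (fun w : n.-tuple (obs R p) * euclid R B.+1 => dp_pvalue lam eps delta w.1 pis w.2).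
  apply: bfunM; first exact: bfun_cst.
  apply: bfunD; last exact: bfun_cst.
  by apply: bfun_sum => i _; exact: bM.
by case: bs.
Qed.

Variables (P : probability (obs R p) R) (H t T Q : R).
Hypotheses (H0 : 0 < H) (T0 : 0 < T) (ct : c * t <= H / 4) (c0 : 0 <= c).
Hypothesis Qe : \prod_(j < d) edge_mean lam P j <= Q.
Let cd : R := (1 + (2 * d) ^ 2)%:R * ((2 * d) ^ 4)%:R.
Let A : R := 16 / H ^+ 2 * (cd * (16 * (T ^+ d * Q)) * 2 / n%:R ^+ 2).

(** Either a block moment of the data exceeds [T] times its mean, which Markov bounds by the
    first sum, or [perm_moment] applies with all block moments under control. *)
Lemma permuted_bound X :
  favg (fun pi : S => (H / 4 <= `|U_dHSIC lam (permute_data pi X)|)%R%:R) <=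
  \sum_(j < d) edge_data lam hd hn X j / (T * edge_mean lam P j) + A.
Proof.
have cd0 : 0 <= cd by rewrite mulr_ge0.
have em j : 0 < edge_mean lam P j by exact: edge_mean_gt0.
have r0 j : 0 <= edge_data lam hd hn X j / (T * edge_mean lam P j).
  by rewrite divr_ge0 ?edge_data_ge0// mulr_ge0// ltW.
have Q0 : 0 <= Q by apply: le_trans Qe; apply: prodr_ge0 => j _; exact: ltW.
have A0 : 0 <= A.
  by rewrite mulr_ge0 ?divr_ge0 ?sqr_ge0// !mulr_ge0// exprn_ge0// ltW.
have card0 : 0 < #|{: S}|%:R :> R.
  by rewrite ltr0n; apply/card_gt0P; exists [ffun=> 1%g].
have favg1 (F : S -> R) : (forall pi, F pi <= 1) -> favg F <= 1.
  move=> F1; rewrite /favg ler_pdivrMl// mulr1 -sum1_card natr_sum.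
  by apply: ler_sum => pi _.
have [/forallP small|] := boolP [forall j, edge_data lam hd hn X j <= T * edge_mean lam P j]; last first.
  rewrite negb_forall => /existsP[j]; rewrite -ltNge => lj.
  apply: (@le_trans _ _ 1); first by apply: favg1 => pi; have /andP[] := bool01 R (H / 4 <= `|U_dHSIC lam (permute_data pi X)|)%R.
  rewrite (bigD1 j)//= -addrA -[leLHS]addr0 lerD//.
    by rewrite ler_pdivlMr ?mul1r ?(ltW lj)// mulr_gt0.
  by rewrite addr_ge0// sumr_ge0.
rewrite -[leLHS]add0r lerD//; first by rewrite sumr_ge0.
apply: (@le_trans _ _ (16 / H ^+ 2 * favg (fun pi : S => U_dHSIC lam (permute_data pi X) ^+ 2))).
  rewrite -favgZl /favg ler_wpM2l ?invr_ge0 ?(ltW card0)//; apply: ler_sum => pi _.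
  have [h|_] := leP (H / 4) `|_|; last by rewrite mulr_ge0 ?sqr_ge0// divr_ge0 ?sqr_ge0.
  rewrite mulrAC ler_pdivlMr ?exprn_gt0// mul1r.
  have -> : H ^+ 2 = 16 * (H / 4) ^+ 2 by field.
  rewrite ler_wpM2l// -[leRHS]real_normK ?num_real// ler_pXn2r ?nnegrE//.
  by rewrite divr_ge0// ltW.
rewrite /A ler_wpM2l ?divr_ge0 ?sqr_ge0//.
under eq_favg do rewrite (U_dHSIC_permute lam hd hn).
apply: le_trans (perm_moment hd hn (K := fun j a b => blockk lam j (tnth X a) (tnth X b)) _) _.
  by move=> j a b; exact: blockk_sym.
rewrite ler_wpM2r ?invr_ge0 ?exprn_ge0// ler_wpM2r// -/cd ler_wpM2l// ler_wpM2l//.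
apply: (@le_trans _ _ (\prod_(j < d) (T * edge_mean lam P j))).
  by apply: ler_prod => j _; rewrite edge_data_ge0/=; exact: small.
rewrite big_split /= prodr_const card_ord ler_wpM2l// exprn_ge0// ltW//.
Qed.

Variables (V e : R).
Hypotheses (a0 : 0 < alpha) (aB : 3 <= alpha * B%:R).
Hypothesis tail : \int[@laplace_prob R]_x (t <= `|x|)%R%:R <= e.
Hypothesis var : \int[power_measure P n]_X (U_dHSIC lam X - H) ^+ 2 <= V.

Let m1 := power_measure P n.
Let m2 := power_measure (@laplace_prob R) B.+1.
Let m11 : m1 setT = 1%E.
Proof. by apply: power_setT; exact: probability_setT. Qed.
Let m21 : m2 setT = 1%E.
Proof. by apply: power_setT; exact: probability_setT. Qed.
Local Notation W := (n.-tuple (obs R p) * euclid R B.+1)%type.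

Let f1 (X : n.-tuple (obs R p)) : R :=
  16 / H ^+ 2 * (U_dHSIC lam X - H) ^+ 2 +
  (\sum_(j < d) edge_data lam hd hn X j / (T * edge_mean lam P j) + A).
Let f2 (z : euclid R B.+1) (i : 'I_B) : R :=
  (t <= `|tnth z ord0|)%R%:R + (t <= `|tnth z (lift ord0 i)|)%R%:R.

Let noise_bound (X : n.-tuple (obs R p)) z i :
  favg (fun pi : S => (M0 X z <=
    noisy_stat lam eps delta X pi (tnth z (lift ord0 i)))%R%:R) <= f1 X + f2 z i.
Proof.
have card0 : 0 < #|{: S}|%:R :> R.
  by rewrite ltr0n; apply/card_gt0P; exists [ffun=> 1%g].
have favgc (k : R) : favg (fun _ : S => k) = k.
  by rewrite /favg sumr_const -(mulr_natr k) mulrCA mulVf ?mulr1// gt_eqF.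
apply: (@le_trans _ _ (favg (fun pi : S =>
   16 / H ^+ 2 * (U_dHSIC lam X - H) ^+ 2 +
   (H / 4 <= `|U_dHSIC lam (permute_data pi X)|)%R%:R + f2 z i))).
  rewrite /favg ler_wpM2l ?invr_ge0 ?(ltW card0)//; apply: ler_sum => pi _.
  by rewrite /noisy_stat permute_data1 /f2 addrA; exact: noise_split.
have favgD (F G : S -> R) : favg (fun pi => F pi + G pi) = favg F + favg G.
  by rewrite /favg big_split mulrDr.
rewrite favgD favgD !favgc lerD2r /f1 lerD2l.
exact: permuted_bound.
Qed.

Let g1 (w : W) : R := #|{: {ffun 'I_B -> S}}|%:R^-1 *
  \sum_(pis : {ffun 'I_B -> S}) (1 - dpdHSIC_test lam alpha eps delta w.1 pis w.2).
Let C := 3 / (2 * (alpha * B%:R)).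
Let g2 (w : W) : R := C * \sum_(i < B) (f1 w.1 + f2 w.2 i).

Let aB0 : 0 < alpha * B%:R. Proof. by move: aB; lra. Qed.
Let C0 : 0 <= C. Proof. by rewrite divr_ge0// mulr_ge0// ltW. Qed.

Let g12 w : g1 w <= g2 w.
Proof.
have card0 : 0 < #|{: {ffun 'I_B -> S}}|%:R :> R.
  by rewrite ltr0n; apply/card_gt0P; exists [ffun=> [ffun=> 1%g]].
apply: (@le_trans _ _ (#|{: {ffun 'I_B -> S}}|%:R^-1 *
  \sum_(pis : {ffun 'I_B -> S}) (C * \sum_(i < B) (M0 w.1 w.2 <= Mi w.1 pis w.2 i)%R%:R))).
  rewrite /g1 ler_wpM2l ?invr_ge0 ?(ltW card0)//; apply: ler_sum => pis _.
  exact: acceptance_bound.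
rewrite -mulr_sumr mulrCA ler_wpM2l// exchange_big /= mulr_sumr.
apply: ler_sum => i _.
have := @ffun_marginal R {ffun 'I_d -> 'S_n} B i (fun pi => (M0 w.1 w.2 <=
  noisy_stat lam eps delta w.1 pi (tnth w.2 (lift ord0 i)))%R%:R) [ffun=> 1%g].
move=> ->; exact: noise_bound.
Qed.

Let bf1 : bfun f1.
Proof.
have bU : bfun (U_dHSIC lam (n := n)).
  have := bfun_U_permute [ffun=> 1%g]; congr bfun; apply/funext => X.
  by rewrite permute_data1.
apply: bfunD.
  by apply: bfunM; [exact: bfun_cst|apply: bfunX; apply: bfunB => //; exact: bfun_cst].
apply: bfunD; last exact: bfun_cst.
apply: bfun_sum => j _; apply: bfunM; last exact: bfun_cst.
exact: (bfun_edge_data hd hn lam0).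
Qed.

Let btail : bfun (fun x : R => (t <= `|x|)%R%:R : R).
Proof. by apply: bfun_le_indic => //; exact: measurableT_comp. Qed.

Let bf2 i : bfun (f2^~ i).
Proof.
by apply: bfunD; apply: (bfun_comp btail); exact: measurable_tnth.
Qed.

Let bg1 : bfun g1.
Proof.
apply: bfunM; first exact: bfun_cst.
apply: bfun_sum => pis _; apply: bfunB; first exact: bfun_cst.
exact: bfun_test.
Qed.

Let bf12 i : bfun (fun w : W => f1 w.1 + f2 w.2 i).
Proof.
by apply: bfunD; [exact: (bfun_comp bf1)|exact: (bfun_comp (bf2 i))].
Qed.

Let bg2 : bfun g2.
Proof. by apply: bfunM; [exact: bfun_cst|apply: bfun_sum => i _; exact: bf12]. Qed.

Let mean_f1 : \int[m1]_X f1 X <= 16 / H ^+ 2 * V + (d%:R / T + A).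
Proof.
have bU : bfun (fun X : n.-tuple (obs R p) => (U_dHSIC lam X - H) ^+ 2).
  apply: bfunX; apply: bfunB; last exact: bfun_cst.
  have := bfun_U_permute [ffun=> 1%g]; congr bfun; apply/funext => X.
  by rewrite permute_data1.
have be j : bfun (fun X : n.-tuple (obs R p) =>
    edge_data lam hd hn X j / (T * edge_mean lam P j)).
  by apply: bfunM; [exact: (bfun_edge_data hd hn lam0)|exact: bfun_cst].
have bs : bfun (fun X : n.-tuple (obs R p) =>
    \sum_(j < d) edge_data lam hd hn X j / (T * edge_mean lam P j)) by exact: bfun_sum.
rewrite /f1 expectD//; last 2 first.
- by apply: bfunM => //; exact: bfun_cst.
- by apply: bfunD => //; exact: bfun_cst.
rewrite expectZl// lerD//.
  by rewrite ler_wpM2l// divr_ge0// sqr_ge0.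
rewrite expectD//; last exact: bfun_cst.
rewrite expect_cst// lerD2r expect_sum//.
rewrite (eq_bigr (fun=> T^-1)); last first.
  move=> j _; rewrite expectZr//; last exact: (bfun_edge_data hd hn lam0).
  rewrite (expect_edge_data hd hn lam0) invfM mulrCA mulfV ?mulr1//.
  by rewrite gt_eqF// edge_mean_gt0.
by rewrite sumr_const card_ord -[_ *+ d]mulr_natl.
Qed.

Let mean_f2 i : \int[m2]_z f2 z i <= 2 * e.
Proof.
have L1 : laplace_prob [set: measurableTypeR R] = 1%E by exact: probability_setT.
have ht l := expect_tnth L1 (l : 'I_B.+1) btail.
rewrite /f2 expectD//; [|by apply: (bfun_comp btail); exact: measurable_tnth..].
by rewrite mulr2n mulrDl mul1r lerD// ht.
Qed.

(** Markov on the number of exceedances reduces the type II error to the probability of one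
    exceedance, and the number [B] of permutations cancels. *)
Lemma type2_error_le : (type2_error lam n B alpha eps delta P <=
  (3 / (2 * alpha) * (16 / H ^+ 2 * V + (d%:R / T + A) + 2 * e))%:E)%E.
Proof.
have mm1 : (m1 \x m2)%E setT = 1%E := prod_setT m11 m21.
rewrite /type2_error -/m1 -/m2 -(EFin_Rintegral mm1 bg1) lee_fin.
apply: le_trans (le_expect mm1 bg1 bg2 g12) _.
rewrite /g2 expectZl//; last by apply: bfun_sum => i _; exact: bf12.
rewrite expect_sum//.
apply: (@le_trans _ _ (C * \sum_(i < B) (16 / H ^+ 2 * V + (d%:R / T + A) + 2 * e))).
  rewrite ler_wpM2l//; apply: ler_sum => i _.
  rewrite expectD//; [|exact: (bfun_comp bf1)|exact: (bfun_comp (bf2 i))].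
  apply: lerD.
    rewrite (expect_prodr m11 m21); last exact: (bfun_comp bf1).
    apply: le_trans mean_f1; rewrite le_eqVlt; apply/orP; left; apply/eqP.
    by apply: eq_Rintegral => X _; exact: (expect_cst m21 (f1 X)).
  rewrite (expect_prodl m11 m21); last exact: (bfun_comp (bf2 i)).
  apply: le_trans (mean_f2 i); rewrite le_eqVlt; apply/orP; left; apply/eqP.
  by apply: eq_Rintegral => z _; exact: (expect_cst m11 (f2 z i)).
rewrite sumr_const card_ord -[_ *+ B]mulr_natr le_eqVlt; apply/orP; left; apply/eqP.
rewrite /C; field.
have B0 : B%:R != 0 :> R.
  by apply/eqP => B0; move: aB0; rewrite B0 mulr0 ltxx.
by rewrite B0 (gt_eqF T0) (gt_eqF H0) (gt_eqF a0).
Qed.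

End test.

(** * Choice of the separation *)

Lemma laplace_tail (R : realType) (e : R) : 0 < e ->
  exists2 t : R, 0 <= t & \int[@laplace_prob R]_x (t <= `|x|)%R%:R <= e.
Proof.
move=> e0.
have L1 : laplace_prob [set: measurableTypeR R] = 1%E by exact: probability_setT.
have b (t : R) : bfun (fun x : measurableTypeR R => (t <= `|x|)%R%:R : R).
  by apply: bfun_le_indic => //; exact: measurableT_comp.
have : (\int[@laplace_prob R]_x ((n%:R <= `|x|)%R%:R)%:E @[n --> \oo] --> 0)%E.
  apply: (@cvg_integral_dominated0 _ _ _ (@laplace_prob R) setT _ (cst 1%E)) => //.
  - by move=> n; apply/measurable_EFinP; case: (b n%:R).
  - by move=> n x; rewrite !lee_fin; exact: bool01.
  - by rewrite integral_cst// mul1e; apply: (@le_lt_trans _ _ 1%E); [rewrite -L1|exact: ltry].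
  - move=> x _ _; apply: cvg_near_cst; near=> n.
    rewrite (_ : (_ <= _)%R = false)//; apply/negbTE; rewrite -ltNge.
    by near: n; exact: nbhs_infty_gtr.
move=> /near_cvge0 /(_ _ e0) [n _ /(_ n (leqnn n)) ?].
by exists n%:R => //; rewrite -lee_fin EFin_Rintegral.
Unshelve. all: by end_near. Qed.

Lemma ln_ge_half (R : realType) (x : R) : 2 <= x -> 2^-1 <= ln x.
Proof.
move=> x2; rewrite -[leLHS]expRK ler_ln ?posrE ?expR_gt0//; last by lra.
apply: le_trans x2; have := expR_ge1Dx (- 2^-1 : R); rewrite expRN.
have -> : 1 + - 2^-1 = 2^-1 :> R by field.
by rewrite lef_pV2 ?posrE ?expR_gt0.
Qed.

Lemma xi_gt0 (R : realType) (eps delta : R) : 0 < eps -> 0 <= delta < 1 -> 0 < xi eps delta.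
Proof.
move=> e0 /andP[d0 d1]; rewrite /xi ltr_wpDr// ln_ge0// div1r.
by rewrite -[leLHS]invr1 lef_pV2 ?posrE//; lra.
Qed.

Section rate.
Variables (R : realType) (d : nat) (p : 'I_d -> nat) (alpha beta s rad M : R).
Hypotheses (hd : (2 <= d)%N) (halpha : 0 < alpha < 1) (hbeta : 0 < beta < 1 - alpha)
  (hs : 0 < s) (hM : 0 < M).
Variables (n B : nat) (eps delta : R) (lam : forall j : 'I_d, 'I_(p j) -> R).
Hypotheses (hn : (2 * d <= n)%N) (heps : 0 < eps) (hdelta : 0 <= delta < 1)
  (hB : 6 * alpha^-1 * ln (2 * beta^-1) <= B%:R)
  (lam_gt0 : forall j (i : 'I_(p j)), 0 < lam i) (lam_le1 : forall j, \prod_(i < p j) @lam j i <= 1).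
Let l0 := \prod_(j < d) \prod_(i < p j) @lam j i.
Let tau := alpha * beta / 9.
Let cd : R := (1 + (2 * d) ^ 2)%:R * ((2 * d) ^ 4)%:R.
Let T := d%:R / tau.
Variable t : R.
Hypotheses (t0 : 0 <= t) (tail : \int[@laplace_prob R]_x (t <= `|x|)%R%:R <= tau).
Let x1 := 64 * d.+1%:R ^+ 2 * M.
Let x2 := 576 * cd * M.
Let x3 := 512 * cd * T ^+ d * M.
(** The constants [x1], [x2], [x3] come from the two parts of the variance and from the
    permuted statistics; the last summand makes the noise smaller than a quarter of the energy. *)
Definition rate_const : R := 1 + (x1 + x2 + x3) / tau + 128 * d%:R ^+ 2 * t.
Local Notation D := rate_const.
Local Notation r1 := (1 / (n%:R * Num.sqrt l0)).
Local Notation r2 := (1 / (n%:R * l0 * xi eps delta)).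
Local Notation Sig := (\sum_(j < d) \sum_(i < p j) @lam j i `^ (2 * s)).

Let a0 : 0 < alpha. Proof. by case/andP: halpha. Qed.
Let b0 : 0 < beta. Proof. by case/andP: hbeta. Qed.
Let b1 : beta < 1. Proof. by case/andP: hbeta; move: a0; lra. Qed.
Let tau0 : 0 < tau. Proof. by rewrite divr_gt0// mulr_gt0. Qed.
Let d0 : 0 < d%:R :> R. Proof. by rewrite ltr0n ltnW. Qed.
Let T0 : 0 < T. Proof. by rewrite divr_gt0. Qed.
Let cd0 : 0 <= cd. Proof. by rewrite mulr_ge0. Qed.
Let n0 : 0 < n%:R :> R.
Proof. by rewrite ltr0n; apply: leq_trans hn; rewrite muln_gt0 /= ltnW. Qed.
Let l0_gt0 : 0 < l0.
Proof. by apply: prodr_gt0 => j _; apply: prodr_gt0 => i _. Qed.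
Let l0_le1 : l0 <= 1.
Proof.
by apply: prodr_ile1 => j _; rewrite lam_le1 andbT; apply: prodr_ge0 => i _; exact: ltW.
Qed.
Let xi0 : 0 < xi eps delta. Proof. exact: xi_gt0. Qed.

Let aB : 3 <= alpha * B%:R.
Proof.
have h : 2^-1 <= ln (2 * beta^-1).
  apply: ln_ge_half; rewrite -[leLHS]mulr1 ler_pM2l// -[leLHS]invr1 lef_pV2 ?posrE//; exact: ltW.
apply: (@le_trans _ _ (alpha * (6 * alpha^-1 * ln (2 * beta^-1)))).
  have -> : alpha * (6 * alpha^-1 * ln (2 * beta^-1)) = 6 * ln (2 * beta^-1).
    by field; rewrite (gt_eqF a0).
  lra.
by rewrite ler_wpM2l// ltW.
Qed.

Let x10 : 0 <= x1.
Proof. by apply: mulr_ge0; [apply: mulr_ge0; [exact: ler0n|exact: sqr_ge0]|exact: ltW]. Qed.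

Let x20 : 0 <= x2.
Proof. by apply: mulr_ge0; [apply: mulr_ge0; [exact: ler0n|]|exact: ltW]. Qed.

Let x30 : 0 <= x3.
Proof.
apply: mulr_ge0; last exact: ltW.
by apply: mulr_ge0; [apply: mulr_ge0; [exact: ler0n|]|apply: exprn_ge0; exact: ltW].
Qed.

Let xt0 : 0 <= (x1 + x2 + x3) / tau.
Proof. by apply: divr_ge0; [do 2?apply: addr_ge0|exact: ltW]. Qed.

Let dt0 : 0 <= 128 * d%:R ^+ 2 * t.
Proof. by apply: mulr_ge0. Qed.

Lemma rate_const_ge1 : 1 <= D.
Proof.
by rewrite /rate_const; move: xt0 dt0; set x := _ / tau; set y := 128 * _ * _; lra.
Qed.

Let D_tau : x1 + x2 + x3 <= tau * D.
Proof.
have -> : x1 + x2 + x3 = tau * ((x1 + x2 + x3) / tau).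
  by rewrite mulrCA mulfV ?mulr1// gt_eqF.
rewrite ler_pM2l// /rate_const.
by move: dt0; set x := _ / tau; set y := 128 * _ * _; lra.
Qed.

(** The choice of [rho] makes the energy [H] at least [D * (r1 + r2)].  With
    [tau = alpha * beta / 9], the variance and the permuted statistics then contribute at most [tau]
    to the bound of [type2_error_le], the block moments another [tau] and the noises [2 * tau]. *)
Lemma type2_error_small (P : probability (obs R p) R) (rho : R) :
  0 <= rho -> rho ^+ 2 = (rad ^+ 2 + expR 2^-1 * D) * (Sig + r1 + r2) ->
  alternatives s rad M rho P ->
  (type2_error lam n B alpha eps delta P <= beta%:E)%E.
Proof.
move=> rho0 rhoE PA.
pose H := hsic P (@mixb R d p) (gauss_kernel (flat lam)).
have sep := alternatives_separation lam_gt0 hs rho0 PA.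
have D0 : 0 < D by exact: lt_le_trans rate_const_ge1.
have S0 : 0 <= Sig.
  by apply: sumr_ge0 => j _; apply: sumr_ge0 => i _; exact: powR_ge0.
have sl0 : 0 < Num.sqrt l0 by rewrite sqrtr_gt0.
have r10 : 0 < r1 by rewrite divr_gt0// mulr_gt0.
have r20 : 0 < r2 by rewrite divr_gt0// !mulr_gt0.
have E0 : 0 < expR 2^-1 :> R by exact: expR_gt0.
(* The smoothing bias in [sep] is absorbed by the summand [rad ^+ 2] of the constant. *)
have HD : D * (r1 + r2) <= H.
  have alg (E D' S r h q : R) : (q + E * D') * (S + r) <= E * h + S * q ->
      0 <= E * D' * S -> 0 <= q * r -> E * (D' * r) <= E * h by move=> *; lra.
  rewrite -(ler_pM2l E0); apply: (alg _ _ Sig _ _ (rad ^+ 2)).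
  - by rewrite addrA -rhoE.
  - by rewrite !mulr_ge0 ?(ltW D0) ?(ltW E0).
  - by rewrite mulr_ge0 ?sqr_ge0// addr_ge0 ?(ltW r10) ?(ltW r20).
have H1 : D * r1 <= H by apply: le_trans HD; rewrite ler_pM2l// lerDl ltW.
have H2 : D * r2 <= H by apply: le_trans HD; rewrite ler_pM2l// lerDr ltW.
have H0 : 0 < H by apply: lt_le_trans H1; rewrite mulr_gt0.
have sH : D <= n%:R * Num.sqrt l0 * H.
  by rewrite -ler_pdivrMl ?mulr_gt0// mulrC -[X in D * X]mul1r.
have s1 : Num.sqrt l0 <= 1 by rewrite -[leRHS]sqrtr1 ler_wsqrtr.
have nH : D <= n%:R * H.
  apply: (le_trans sH); rewrite mulrAC -[leRHS]mulr1 ler_wpM2l//.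
  by rewrite mulr_ge0 ?(ltW H0) ?(ltW n0).
(* The base of this square is at least [D >= 1], hence at most its square. *)
have lnH : D <= l0 * n%:R ^+ 2 * H ^+ 2.
  have -> : l0 * n%:R ^+ 2 * H ^+ 2 = (n%:R * Num.sqrt l0 * H) ^+ 2.
    by rewrite !exprMn sqr_sqrtr ?(ltW l0_gt0)//; ring.
  move: (sH) (le_trans rate_const_ge1 sH); set y := _ * H => Dy y1; apply: (le_trans Dy).
  by rewrite expr2 ler_peMr// (le_trans ler01).
have sens0 := sensitivity_ge0 hd hn lam_gt0.
have sensb := sensitivity_le hd hn lam_gt0.
have c0 : 0 <= 2 * sensitivity lam n * (xi eps delta)^-1.
  by rewrite mulr_ge0 ?invr_ge0 ?(ltW xi0)// mulr_ge0.
have ct : 2 * sensitivity lam n * (xi eps delta)^-1 * t <= H / 4.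
  apply: (@le_trans _ _ (32 * d%:R ^+ 2 * t * r2)).
    rewrite [leRHS](_ : _ = 2 * (16 * d%:R ^+ 2 / (n%:R * l0)) * (xi eps delta)^-1 * t); last first.
      by field; rewrite (gt_eqF xi0) (gt_eqF l0_gt0) (gt_eqF n0).
    by rewrite !ler_wpM2r ?invr_ge0 ?(ltW xi0)// ler_wpM2l.
  apply: le_trans (_ : D / 4 * r2 <= _); last by lra.
  rewrite ler_wpM2r ?(ltW r20)// /rate_const.
  move: xt0; set x := _ / tau.
  rewrite (_ : 128 * d%:R ^+ 2 * t = 4 * (32 * d%:R ^+ 2 * t)); last by ring.
  by set y := 32 * _ * _; lra.
have Qe : \prod_(j < d) edge_mean lam P j <= M / l0.
  by rewrite prod_edge_mean//; exact: (alternatives_mix_sqr lam_gt0 rho0 PA).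
have var := alternatives_variance lam_gt0 rho0 PA hd hn.
have {}var : \int[power_measure P n]_X (U_dHSIC lam X - H) ^+ 2 <=
    4 * d.+1%:R ^+ 2 * M * H / n%:R + 36 * cd * M / (l0 * n%:R ^+ 2).
  rewrite [leRHS](_ : _ = n%:R^-1 * (4 * d.+1%:R * (M * H + d%:R * (M * H))) +
      cd * (18 * (M / l0)) * 2 / n%:R ^+ 2); last first.
    by rewrite -natr1; field; rewrite (gt_eqF l0_gt0) (gt_eqF n0).
  apply: le_trans var; rewrite le_eqVlt; apply/orP; left; apply/eqP.
  by apply: eq_Rintegral => X _; rewrite (U_dHSIC_ustat lam hd hn).
apply: le_trans (type2_error_le hd hn lam_gt0 H0 T0 ct c0 Qe a0 aB tail var) _.
rewrite lee_fin.
have ln0 : 0 < l0 * n%:R ^+ 2 * H ^+ 2 by rewrite !mulr_gt0 ?exprn_gt0.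
have nH0 : 0 < n%:R * H by rewrite mulr_gt0.
rewrite [leLHS](_ : _ = 3 / (2 * alpha) * (x1 / (n%:R * H) + x2 / (l0 * n%:R ^+ 2 * H ^+ 2)
   + x3 / (l0 * n%:R ^+ 2 * H ^+ 2) + tau + 2 * tau)); last first.
  rewrite /x1 /x2 /x3 /T -/cd; field.
  by rewrite (gt_eqF l0_gt0) (gt_eqF n0) (gt_eqF H0) (gt_eqF a0) (gt_eqF d0) (gt_eqF tau0).
have q1 : x1 / (n%:R * H) <= x1 / D by rewrite ler_wpM2l// lef_pV2 ?posrE.
have q2 : x2 / (l0 * n%:R ^+ 2 * H ^+ 2) <= x2 / D by rewrite ler_wpM2l// lef_pV2 ?posrE.
have q3 : x3 / (l0 * n%:R ^+ 2 * H ^+ 2) <= x3 / D by rewrite ler_wpM2l// lef_pV2 ?posrE.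
have q4 : x1 / D + x2 / D + x3 / D <= tau.
  have -> : x1 / D + x2 / D + x3 / D = (x1 + x2 + x3) / D by rewrite !mulrDl.
  by rewrite ler_pdivrMr//; exact: D_tau.
rewrite mulrC mulrA ler_pdivrMr ?mulr_gt0//.
have : 9 * tau = alpha * beta by rewrite /tau; field.
move: a0 b0 tau0 q1 q2 q3 q4.
set y1 := x1 / _; set y2 := x2 / _; set y3 := x3 / _; set z1 := x1 / D; set z2 := x2 / D; set z3 := x3 / D.
by move=> *; nra.
Qed.

End rate.

Theorem theoremC2 (R : realType) (d : nat) (p : 'I_d -> nat)
    (alpha beta s rad M : R) (hd : (2 <= d)%N) (hp : forall j, (0 < p j)%N)
    (halpha : 0 < alpha < 1) (hbeta : 0 < beta < 1 - alpha)
    (hs : 0 < s) (hrad : 0 < rad) (hM : 0 < M) :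
  exists2 C : R, 0 < C &
    forall (n B : nat) (eps delta : R) (lam : forall j : 'I_d, 'I_(p j) -> R),
      (2 * d <= n)%N -> 0 < eps -> 0 <= delta < 1 ->
      6 * alpha^-1 * ln (2 * beta^-1) <= B%:R ->
      (forall j i, 0 < lam j i) ->
      (forall j, \prod_(i < p j) lam j i <= 1) ->
      let lam0 := \prod_(j < d) \prod_(i < p j) lam j i in
      (min_separation lam n B alpha beta eps delta s rad M ^+ 2 <=
        (C * (\sum_(j < d) \sum_(i < p j) lam j i `^ (2 * s)
              + 1 / (n%:R * Num.sqrt lam0)
              + 1 / (n%:R * lam0 * xi eps delta)))%:E)%E.
Proof.
have a0 : 0 < alpha by case/andP: halpha.
have b0 : 0 < beta by case/andP: hbeta.
have tau0 : 0 < alpha * beta / 9 by rewrite divr_gt0// mulr_gt0.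
have [t t0 tail] := laplace_tail tau0.
pose D := rate_const d alpha beta M t.
have D1 : 1 <= D by exact: (rate_const_ge1 hd halpha hbeta hM t0).
have C0 : 0 < rad ^+ 2 + expR 2^-1 * D.
  by rewrite ltr_wpDl ?sqr_ge0// mulr_gt0 ?expR_gt0// (lt_le_trans ltr01).
exists (rad ^+ 2 + expR 2^-1 * D) => // n B eps delta lam hn he hdel hB l_gt0 l_le1.
cbv zeta; set lam0 := \prod_(j < d) _.
set r := (X in (_ * X)%:E).
have n0 : 0 < n%:R :> R.
  by rewrite ltr0n; apply: leq_trans hn; rewrite muln_gt0 /= ltnW.
have lam00 : 0 < lam0 by apply: prodr_gt0 => j _; apply: prodr_gt0 => i _.
have x0 : 0 < xi eps delta by exact: xi_gt0.
have r0 : 0 < r.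
  rewrite /r ltr_wpDl// ?divr_gt0 ?mulr_gt0//.
  rewrite addr_ge0 ?divr_ge0 ?mulr_ge0 ?sqrtr_ge0//.
  by apply: sumr_ge0 => j _; apply: sumr_ge0 => i _; exact: powR_ge0.
pose rho := Num.sqrt ((rad ^+ 2 + expR 2^-1 * D) * r).
have rho0 : 0 < rho by rewrite sqrtr_gt0 mulr_gt0.
have rhoE : rho ^+ 2 = (rad ^+ 2 + expR 2^-1 * D) * r.
  by rewrite sqr_sqrtr// mulr_ge0 ?(ltW C0) ?(ltW r0).
have le : (min_separation lam n B alpha beta eps delta s rad M <= rho%:E)%E.
  apply: ereal_inf_lbound; exists rho => //; split => //.
  apply: ge_ereal_sup => _ [P PA <-].
  exact: (type2_error_small hd halpha hbeta hs hM hn he hdel hB l_gt0 l_le1 t0 tail (ltW rho0) rhoE PA).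
have ge : (0 <= min_separation lam n B alpha beta eps delta s rad M)%E.
  by apply: le_ereal_inf_tmp => _ [x [x_gt0 _] <-]; rewrite lee_fin ltW.
rewrite -rhoE EFin_expe; move: le ge.
case: (min_separation _ _ _ _ _ _ _ _ _ _) => [x||//] //.
rewrite !lee_fin => xr x_ge0.
by apply: ler_pM.
Qed.
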